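(* Let $f>0$, $\kappa>0$, $r\ge 0$, and let $\|\cdot\|$ be the Euclidean norm on $\mathbb{R}^2$. Let $z$ be the optimal value of the transshipment facility layout problem and let $g(6,r)$ be as defined in the context. Then $$z\ \le\ 3\sqrt[3]{\frac{\kappa^2 f^3}{4\,g^2(6,r)}} ,$$ and the right-hand side is the cost of a feasible design whose service regions are identical cyclic hexagons (convex hexagons circumscribed by a circle centered at the facility), each consisting of two isosceles basic triangles with apex angle $2\alpha^*(6,r)$ that are passed through by the inbound truck and four isosceles basic triangles with apex angle $2\cdot\frac{\pi-2\alpha^*(6,r)}{4}$, and each having area $\left(\frac{\kappa}{2}\right)^{-2/3}\left[g(6,r)\right]^{2/3}$.
   Context: Problem. A design consists of: (i) a locally finite infinite set $X\subset\mathbb{R}^2$ of facility locations; (ii) service regions $\mathcal{A}(p)$, $p\in X$, which are measurable sets of finite positive area, cover $\mathbb{R}^2$, overlap pairwise only in null sets, and satisfy $\|x-p\|\le\|x-q\|$ for all $x\in\mathcal{A}(p)$ and $q\in X$ (Voronoi diagram, ties broken arbitrarily); (iii) for each $N\ge 1$ a closed inbound truck tour $x_1,x_2,\dots,x_N,x_1$ through $N$ distinct facilities of $X$ (the choice may depend on $N$; indices are taken modulo $N$), such that, with $\mathcal{A}_i=\mathcal{A}(x_i)$ and $A_i=|\mathcal{A}_i|$, the sets $U_N=\bigcup_{i=1}^N\mathcal{A}_i$ exhaust the plane: there are $\rho_N\to\infty$ such that, for all large $N$, $B(0,\rho_N)\subset U_N$ up to a null set, and $|U_N\setminus B(0,\rho_N)|/|U_N|\to0$.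 The truck's travel distance attributed to facility $i$ is $l_i=\frac12(\|x_i-x_{i-1}\|+\|x_i-x_{i+1}\|)$. The cost of the design is $$\liminf_{N\to\infty}\ \left[\frac{f}{\sum_{i=1}^N A_i}\sum_{i=1}^N\Bigl(1+\kappa\int_{\mathcal{A}_i}\|x-x_i\|\,dx\Bigr)+\frac{\kappa r f}{N}\sum_{i=1}^N l_i\right],$$ and $z$ is the infimum of the cost over all designs. A basic triangle of a polygonal service region is the triangle spanned by the facility location (apex) and one side of the polygon. Function $g(6,r)$. For real $n\ge3$, $\alpha\in[\pi/n,\pi/2)$, put $\bar\alpha=\frac{\pi-2\alpha}{n-2}$ and $$H(n,r,\alpha)=\sin\alpha\cos^2\bar\alpha\,\log\tan\Bigl(\frac{\pi}{4}+\frac{\bar\alpha}{2}\Bigr)-\cos^2\alpha\,\sin\bar\alpha\,\log\tan\Bigl(\frac{\pi}{4}+\frac{\alpha}{2}\Bigr)-r\sin 2\alpha\,\sin\bar\alpha-r(n-2)\cos\bar\alpha\,\sin^2\bar\alpha .$$ $\alpha^*(n,r)$ denotes the unique root of $H(n,r,\alpha)=0$ in $[\pi/n,\pi/2)$, and, with $\alpha=\alpha^*(n,r)$ and $\bar\alpha=\frac{\pi-2\alpha}{n-2}$, $$g(n,r)=\frac{3\sin\bar\alpha\,\bigl(\sin 2\alpha+(n-2)\cos\bar\alpha\sin\bar\alpha\bigr)^{1/2}}{\sin\bar\alpha+\cos^2\bar\alpha\,\log\tan\bigl(\frac{\pi}{4}+\frac{\bar\alpha}{2}\bigr)+4r\sin\bar\alpha\cos\alpha}.$$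 *)

(* Defs.v *)
From HB Require Import structures.
From mathcomp Require Import all_boot all_order all_algebra.
From mathcomp Require Import all_classical all_reals all_analysis.

Set Implicit Arguments.
Unset Strict Implicit.
Unset Printing Implicit Defensive.

Import Order.TTheory GRing.Theory Num.Theory.
Import numFieldNormedType.Exports.

Local Open Scope classical_set_scope.
Local Open Scope ring_scope.

(** * The Euclidean plane

    [measurableTypeR R] is [R] with its Borel sigma-algebra.  The library norm
    on a product type is the sup norm, so the Euclidean norm is defined here. *)

Notation plane R := (measurableTypeR R * measurableTypeR R)%type.

Section Plane.
Context {R : realType}.
Implicit Types p q u v : plane R.

Definition vec p q : plane R := (q.1 - p.1, q.2 - p.2).

Definition dot u v : R := u.1 * v.1 + u.2 * v.2.

Definition cross u v : R := u.1 * v.2 - u.2 * v.1.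

Definition enorm u : R := Num.sqrt (dot u u).

Definition edist p q : R := enorm (vec p q).

Definition eball p (rho : R) : set (plane R) := [set x | edist p x < rho].

(** Unoriented angle, in [0, pi]. *)
Definition angle u v : R := acos (dot u v / (enorm u * enorm v)).

(** Two-dimensional Lebesgue measure on the Borel sets of the plane. *)
Definition leb2 : set (plane R) -> \bar R :=
  (@lebesgue_measure R \x @lebesgue_measure R)%E.

HB.instance Definition _ := Measure.on leb2.

Definition convex_hull (A : set (R * R)) : set (R * R) :=
  smallest (@convex_set R (R^o * R^o)%type) A.

End Plane.

(** * Designs *)

Section Designs.
Context {R : realType}.

(** [region p] is meaningful for facilities [p] only.  [tour N] lists the
    facilities [x_1, ..., x_N] as a function on ['I_N]; [ordS] and [ord_pred]
    are the cyclic successor and predecessor on ['I_N], so that the indices are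
    taken modulo [N]. *)
Record design := Design {
  facilities : set (plane R) ;
  region : plane R -> set (plane R) ;
  tour : forall N : nat, 'I_N -> plane R ;
  facilities_infinite : infinite_set facilities ;
  facilities_locally_finite :
    forall rho : R, finite_set (facilities `&` eball (0, 0) rho) ;
  region_measurable : forall p, facilities p -> measurable (region p) ;
  region_area_gt0 : forall p, facilities p -> (0 < leb2 (region p))%E ;
  region_area_fin : forall p, facilities p -> (leb2 (region p) < +oo)%E ;
  region_cover : \bigcup_(p in facilities) region p = setT ;
  region_overlap : forall p q, facilities p -> facilities q -> p <> q ->
    leb2 (region p `&` region q) = 0%E ;
  region_voronoi : forall p q x, facilities p -> facilities q -> region p x ->
    edist p x <= edist q x ;
  tour_facilities : forall N (i : 'I_N), facilities (tour i) ;
  tour_injective : forall N, injective (@tour N) ;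
  tour_exhausts : exists rho : nat -> R,
    let U N := \bigcup_(i in [set: 'I_N]) region (tour i) in
    [/\ rho N @[N --> \oo] --> +oo,
        \forall N \near \oo, leb2 (eball (0, 0) (rho N) `\` U N) = 0%E &
        (fine (leb2 (U N `\` eball (0, 0) (rho N))) / fine (leb2 (U N)))
          @[N --> \oo] --> (0 : R)]
}.

Variable D : design.

Definition area (p : plane R) : R := fine (leb2 (region D p)).

(** Distance travelled by the inbound truck attributed to a facility. *)
Definition travel N (i : 'I_N) : R :=
  (edist (tour D (ord_pred i)) (tour D i) +
   edist (tour D i) (tour D (ordS i))) / 2.

(** The integrals, hence the costs, may be infinite since a region of finite
    area need not be bounded. *)
Definition cost_upto (f kappa r : R) (N : nat) : \bar R :=
  ((f / \sum_(i < N) area (tour D i))%:E *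
     (\sum_(i < N)
        (1 + kappa%:E *
             \int[leb2]_(x in region D (tour D i)) (edist (tour D i) x)%:E)) +
   (kappa * r * f / N%:R * \sum_(i < N) travel i)%:E)%E.

Definition cost (f kappa r : R) : \bar R := limn_einf (cost_upto f kappa r).

End Designs.

Arguments design R : clear implicits.

Definition optimal_value {R : realType} (f kappa r : R) : \bar R :=
  ereal_inf [set cost D f kappa r | D in [set: design R]].

(** * The functions [H(n, r, alpha)] and [g(n, r)] *)

Section Gfun.
Context {R : realType}.
Implicit Types n r alpha : R.

Definition alpha_bar n alpha : R := (pi - 2 * alpha) / (n - 2).

Definition logtan (a : R) : R := ln (tan (pi / 4 + a / 2)).

Definition Hfun n r alpha : R :=
  let beta := alpha_bar n alpha in
  sin alpha * cos beta ^+ 2 * logtan beta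
  - cos alpha ^+ 2 * sin beta * logtan alpha
  - r * sin (2 * alpha) * sin beta
  - r * (n - 2) * cos beta * sin beta ^+ 2.

Definition H_root n r alpha : Prop :=
  pi / n <= alpha < pi / 2 /\ Hfun n r alpha = 0.

(** The unique root; [0] if there is no root or if there are several. *)
Definition alpha_star n r : R := xget 0 [set alpha | unique (H_root n r) alpha].

Definition gfun n r : R :=
  let alpha := alpha_star n r in
  let beta := alpha_bar n alpha in
  3 * sin beta * Num.sqrt (sin (2 * alpha) + (n - 2) * cos beta * sin beta)
  / (sin beta + cos beta ^+ 2 * logtan beta + 4 * r * sin beta * cos alpha).

End Gfun.

(** * Cyclic hexagons and their basic triangles

    A hexagon is given by its vertices [w : 'I_6 -> plane R] in counterclockwise
    order; its [j]-th side joins [w j] and [w (ordS j)]. *)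

Section Hexagons.
Context {R : realType}.
Implicit Types (p q : plane R) (w : 'I_6 -> plane R) (A : set (plane R)).

(** Strict convexity: all the other vertices lie strictly to the left of each
    directed side. *)
Definition convex_hexagon w A : Prop :=
  (forall j k : 'I_6, k != j -> k != ordS j ->
     0 < cross (vec (w j) (w (ordS j))) (vec (w j) (w k))) /\
  A = convex_hull (range w).

Definition cyclic_hexagon p w A : Prop :=
  convex_hexagon w A /\
  exists2 rho : R, 0 < rho & forall j, edist p (w j) = rho.

Definition basic_triangle p w (j : 'I_6) : set (plane R) :=
  convex_hull [set p; w j; w (ordS j)].

Definition apex_angle p w (j : 'I_6) : R :=
  angle (vec p (w j)) (vec p (w (ordS j))).

Definition isosceles p w (j : 'I_6) : Prop :=
  edist p (w j) = edist p (w (ordS j)).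

Definition congruent A B p q : Prop :=
  exists phi : plane R -> plane R,
    [/\ forall x y, edist (phi x) (phi y) = edist x y,
        phi p = q & phi @` A = B].

(** The segment from [p] to [q] leaves [p] through the basic triangle on the
    [j]-th side, i.e. it crosses the relative interior of this side. *)
Definition leg_through p q w (j : 'I_6) : Prop :=
  exists s t : R, [/\ 0 < s < 1, 0 < t < 1 &
    (p.1 + s * (q.1 - p.1), p.2 + s * (q.2 - p.2)) =
    ((w j).1 + t * ((w (ordS j)).1 - (w j).1),
     (w j).2 + t * ((w (ordS j)).2 - (w j).2))].

(** The [j]-th basic triangle at the [i]-th stop of the tour is passed through
    by the truck on its way to or from the facility. *)
Definition truck_through (D : design R) N (i : 'I_N) w (j : 'I_6) : Prop :=
  leg_through (tour D i) (tour D (ord_pred i)) w j \/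
  leg_through (tour D i) (tour D (ordS i)) w j.

(** A closed tour must turn somewhere: the truck passes through the triangles
    selected by [S] at all but a vanishing proportion of its stops. *)
Definition truck_passes_through (D : design R)
    (w : plane R -> 'I_6 -> plane R) (S : plane R -> {set 'I_6}) : Prop :=
  (#|[set i : 'I_N |
       `[< forall j, j \in S (tour D i) -> truck_through D i (w (tour D i)) j >]
     ]%SET|%:R / N%:R) @[N --> \oo] --> (1 : R).

End Hexagons.

(* Main.v *)
Require Import Defs.
From mathcomp Require Import all_boot all_order all_algebra.
From mathcomp Require Import all_classical all_reals all_analysis measurable_realfun.
From mathcomp Require Import ring lra zify.

(** The design is an explicit honeycomb.  Let [alpha] be the optimal half apex
    angle and let [beta] be [(pi - 2 alpha) / 4], so that [alpha + 2 beta] is a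
    right angle.  In a circle of radius [rho], two isosceles triangles of half apex
    angle [alpha] and four of half apex angle [beta] make a centrally symmetric
    hexagon with two vertical sides, of half width [c = rho cos alpha].  Its
    translates by the lattice of rows [h = rho + rho sin alpha] apart, of period
    [2 c] and shifted by [c] from one to the next, tile the plane
    ([hexcell_cover]).  As a linear form on a hexagon is largest at a vertex, the
    points of a cell are not closer to another lattice point than to its own
    ([hexagon_voronoi0]); so two cells meet in a part of a line
    ([hexcell_overlap]).

    The area of the hexagon and the integral of the distance to its center are
    found by turning each of the six triangles until its height lies along the
    first axis ([hexsector_wedge]): rotations preserve area, being products of
    shears ([preserves_leb2_rot]), and over the turned triangle Fubini leaves
    elementary integrals ([integral_norm_wedge]), where [log tan] appears.

    With [N] stops the truck serves the lattice points of the largest disc, of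
    radius [n h], that it can, row by row in alternating directions, and spends
    the stops that are left over on the row above.  A leg inside a row has length
    [2 c] and crosses the common vertical side of two cells.  There are [O(n)] other legs; consecutive
    half chords of the disc differ by [O(sqrt n)], so that all but a bounded number
    of these legs have length [O(sqrt n)] and the others [O(n)].  As [N] is of
    order [n ^ 2], the irregular legs and their lengths are negligible
    ([tour_weight_cvg0]), and so is the area between the served region and a disc
    inside it ([tour_ratio_cvg0]).  Hence the cost of the design is
    [f (1 + kappa M) / A + 2 kappa r f c], where [A] and [M] are the area and the
    moment of the hexagon ([cost_hexagonal_design]).

    It remains to choose the angle and the scale.  In terms of
    [chord_ratio t = cos t ^ 2 log tan (pi / 4 + t / 2) / sin t], the equation
    [H(6, r, alpha) = 0] says that
    [sin alpha (chord_ratio beta - chord_ratio alpha)] is [r] times the area of the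
    hexagon of unit circumradius.  Since [chord_ratio] decreases, the left side
    increases with [alpha] while the area does not, so the root is unique; a change
    of sign gives its existence ([alpha_starP]).  At the root,
    [g(6, r) = A ^ (3 / 2) / (M + 2 r c A)], a quantity that does not depend on
    the scale ([gfun_optimal]).  So the cost at area [A] is
    [f / A + kappa f A ^ (1 / 2) / g(6, r)]; at [A ^ (3 / 2) = 2 g(6, r) / kappa]
    the second term is twice the first one, and the cost [3 f / A] is the bound
    ([best_cost]). *)

Import Order.TTheory GRing.Theory Num.Theory.
Import numFieldNormedType.Exports.

Local Open Scope classical_set_scope.
Local Open Scope ring_scope.

Local Notation edist := Defs.edist.

(** * Area-preserving maps of the plane *)
Section AreaPreserving.
Context {R : realType}.
Local Notation mu := (@lebesgue_measure R).

Lemma lebesgue_measure_shift (a : R) (A : set (measurableTypeR R)) :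
  measurable A -> mu ((fun y : measurableTypeR R => y + a) @^-1` A) = mu A.
Proof.
move=> mA.
have mf : measurable_fun setT (fun y : measurableTypeR R => (y + a : measurableTypeR R)).
  exact: measurable_funD.
rewrite -[LHS]/(pushforward mu (fun y : measurableTypeR R => (y + a : measurableTypeR R)) A).
apply/esym/lebesgue_measure_unique => //= _ [[u v]] _ <-.
rewrite /pushforward.
have -> : (fun y : measurableTypeR R => y + a) @^-1` [set` `]u, v]] = [set` `]u - a, v - a]].
  by apply/seteqP; split => y /=; rewrite !in_itv/= ltrBlDr lerBrDr.
rewrite !lebesgue_measure_itv/= !lte_fin.
by rewrite ltrD2r -!EFinB; case: ifP => // _; congr (_%:E); ring.
Qed.

Lemma lebesgue_measure_scale (t : R) (A : set (measurableTypeR R)) :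
  0 < t -> measurable A ->
  (t%:E * mu ((fun y : measurableTypeR R => (t * y)%R) @^-1` A) = mu A)%E.
Proof.
move=> t0 mA.
have mf : measurable_fun setT
    (fun y : measurableTypeR R => ((t * y)%R : measurableTypeR R)).
  exact: measurable_funM.
have t0' : 0 <= t by exact: ltW.
rewrite -[LHS]/(pushforward (mscale (NngNum t0') mu)
  ((fun y : measurableTypeR R => ((t * y)%R : measurableTypeR R))) A).
apply/esym/lebesgue_measure_unique => //= _ [[u v]] _ <-.
rewrite /pushforward /mscale.
have -> : (fun y : measurableTypeR R => (t * y)%R) @^-1` [set` `]u, v]]
   = [set` `](u / t)%R, (v / t)%R]].
  apply/seteqP; split => y /=; rewrite !in_itv/=;
  by rewrite ltr_pdivrMr// ler_pdivlMr// ![y * t]mulrC.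
rewrite [X in (_ * X)%E](lebesgue_measure_itv `](u / t)%R, (v / t)%R]).
rewrite lebesgue_measure_itv /= !lte_fin (ltr_pM2r (x := t^-1)) ?invr_gt0//.
case: ifP => // _; rewrite ?mule0// -!EFinB -EFinM; congr (_%:E).
by field; rewrite gt_eqF.
Qed.

Definition preserves_leb2 (phi : plane R -> plane R) :=
  measurable_fun setT phi /\
  forall A, measurable A -> leb2 (phi @^-1` A) = leb2 A.

Lemma preserves_leb2_comp phi psi :
  preserves_leb2 phi -> preserves_leb2 psi -> preserves_leb2 (phi \o psi).
Proof.
move=> [mphi pphi] [mpsi ppsi]; split; first exact: measurableT_comp.
move=> A mA; rewrite comp_preimage ppsi ?pphi//.
by rewrite -[X in measurable X]setTI; exact: mphi.
Qed.

(** A measure of the plane is determined by its values on rectangles. *)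
Lemma preserves_leb2_swap : preserves_leb2 (fun p => (p.2, p.1)).
Proof.
have mf : measurable_fun setT (fun p : plane R => ((p.2, p.1) : plane R)).
  exact: measurable_fun_pair.
split => // A mA.
rewrite -[LHS]/(pushforward leb2 (fun p : plane R => ((p.2, p.1) : plane R)) A).
apply/esym/(@product_measure_unique _ _ _ _ _ mu mu) => // X Y mX mY; rewrite /pushforward.
transitivity (leb2 (Y `*` X)).
  by congr (leb2 _); apply/seteqP; split => -[x y] /= [].
by rewrite [LHS]product_measure1E//= muleC.
Qed.

(** By Fubini, since a shear translates each vertical section. *)
Lemma preserves_leb2_shear (a b : R) :
  preserves_leb2 (fun p => (p.1, p.2 + (a * p.1 + b))).
Proof.
have mf : measurable_fun setT
    (fun p : plane R => ((p.1, (p.2 + (a * p.1 + b))%R) : plane R)).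
  apply: measurable_fun_pair => //; apply: measurable_funD => //.
  by apply: measurable_funD => //; apply: measurable_funM.
split => // A mA; rewrite /leb2 /product_measure1.
apply: eq_integral => x _ /=.
rewrite -[RHS](@lebesgue_measure_shift (a * x + b)); last exact: measurable_xsection.
by congr (mu _); apply/seteqP; split => y; rewrite /xsection /= !inE.
Qed.

Lemma preserves_leb2_translation (q : plane R) :
  preserves_leb2 (fun p => (p.1 + q.1, p.2 + q.2)).
Proof.
have H b := preserves_leb2_shear 0 b.
have /= := preserves_leb2_comp _ _ preserves_leb2_swap (preserves_leb2_comp _ _ (H q.1)
 (preserves_leb2_comp _ _ preserves_leb2_swap (H q.2))).
congr preserves_leb2; apply/funext => -[x y] /=.
by rewrite !mul0r !add0r.
Qed.

Definition rot (C S : R) (p : plane R) : plane R :=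
  (C * p.1 + S * p.2, - S * p.1 + C * p.2).

Lemma enorm_rot C S p : C ^+ 2 + S ^+ 2 = 1 -> enorm (rot C S p) = enorm p.
Proof.
move=> CS; rewrite /enorm /dot /rot /=; congr Num.sqrt.
by rewrite -[RHS]mul1r -CS; ring.
Qed.

(** A rotation of angle outside [pi Z] is a product of three shears along the
    axes; the half turn is the square of a quarter turn. *)
Lemma preserves_leb2_rot C S : C ^+ 2 + S ^+ 2 = 1 -> preserves_leb2 (rot C S).
Proof.
have key C' S' : C' ^+ 2 + S' ^+ 2 = 1 -> S' != 0 -> preserves_leb2 (rot C' S').
  move=> CS S0.
  have H a := preserves_leb2_shear a 0.
  pose W := preserves_leb2_swap.
  have V a := preserves_leb2_comp _ _ W (preserves_leb2_comp _ _ (H a) W).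
  have /= := preserves_leb2_comp _ _ (V ((1 - C') / S')) (preserves_leb2_comp _ _ (H (- S'))
    (V ((1 - C') / S'))).
  congr preserves_leb2; apply/funext => -[x y] /=; rewrite /rot /=.
  have S2 : C' ^+ 2 = 1 - S' ^+ 2 by rewrite -CS addrK.
  congr pair.
    rewrite !addr0; apply/eqP; rewrite -subr_eq0.
    rewrite (_ : _ - _ = y * (1 - C' ^+ 2 - S' ^+ 2) / S'); last by field.
    by rewrite S2; apply/eqP; field.
  by rewrite !addr0; field.
move=> CS; have [S0|] := eqVneq S 0; last exact: key.
move: CS; rewrite S0 expr0n/= addr0 => /eqP.
rewrite sqrf_eq1 => /orP[/eqP ->|/eqP ->].
  have /= := preserves_leb2_translation (0, 0).
  congr preserves_leb2; apply/funext => -[x y] /=; rewrite /rot /=.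
  by congr pair; ring.
have K : preserves_leb2 (rot 0 1) by apply: key; rewrite ?oner_eq0//; ring.
have /= := preserves_leb2_comp _ _ K K.
congr preserves_leb2; apply/funext => -[x y] /=; rewrite /rot /=.
by congr pair; ring.
Qed.

Lemma preserves_leb2_integral phi (A : set (plane R)) (f : plane R -> \bar R) :
  preserves_leb2 phi -> measurable A -> measurable_fun setT f ->
  (forall p, 0 <= f p)%E ->
  (\int[leb2]_(x in phi @^-1` A) f (phi x) = \int[leb2]_(x in A) f x)%E.
Proof.
move=> [mphi pphi] mA mf f0.
have := @ge0_integral_pushforward _ _ _ _ R phi mphi leb2 A f mA
   (measurable_funTS mf) (fun y _ => f0 y).
move=> <-.
apply: eq_measure_integral => B mB _.
exact: pphi.
Qed.

Lemma leb2_scale (t : R) (A : set (plane R)) : 0 < t -> measurable A ->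
  ((t ^+ 2)%:E * leb2 ((fun p : plane R => (t * p.1, t * p.2)%R) @^-1` A)
    = leb2 A)%E.
Proof.
move=> t0 mA.
have mf : measurable_fun setT
   (fun p : plane R => ((t * p.1, t * p.2)%R : plane R)).
  by apply: measurable_fun_pair; apply: measurable_funM.
have t0' : 0 <= t ^+ 2 by exact: sqr_ge0.
rewrite -[LHS]/(pushforward (mscale (NngNum t0') leb2)
  ((fun p : plane R => ((t * p.1, t * p.2)%R : plane R))) A).
apply/esym/(@product_measure_unique _ _ _ _ _ mu mu) => // X Y mX mY.
rewrite /pushforward /mscale.
transitivity ((t ^+ 2)%:E *
    leb2 (((fun y : measurableTypeR R => (t * y)%R) @^-1` X) `*`
    ((fun y : measurableTypeR R => (t * y)%R) @^-1` Y)))%E.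
  by congr (_ * leb2 _)%E; apply/seteqP; split => -[x y] /= [].
have mt : measurable_fun setT
    (fun y : measurableTypeR R => ((t * y)%R : measurableTypeR R)).
  exact: measurable_funM.
rewrite [X in (_ * X)%E]product_measure1E//; try by rewrite -[X in measurable X]setTI; exact: mt.
have EX := lebesgue_measure_scale t X t0 mX.
have EY := lebesgue_measure_scale t Y t0 mY.
rewrite expr2 EFinM muleACA; congr (_ * _)%E; first exact: EX.
exact: EY.
Qed.

End AreaPreserving.

(** * Area and first moment of a triangle *)
Section WedgeIntegral.
Context {R : realType}.
Local Notation mu := (@lebesgue_measure R).

(** Pointwise forms of the differentiation rules, convenient for closed
    formulas written with a bound variable. *)
Lemma is_derive_addE (f g : R -> R) (x df dg : R) :
  is_derive x (1 : R) f df -> is_derive x (1 : R) g dg ->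
  is_derive x (1 : R) (fun y => f y + g y) (df + dg).
Proof. by move=> Hf Hg; exact: (is_deriveD Hf Hg). Qed.

Lemma is_derive_mulE (f g : R -> R) (x df dg : R) :
  is_derive x (1 : R) f df -> is_derive x (1 : R) g dg ->
  is_derive x (1 : R) (fun y => f y * g y) (df * g x + f x * dg).
Proof.
move=> Hf Hg; apply: (is_derive_eq (is_deriveM Hf Hg)).
by rewrite /GRing.scale /= addrC [g x * _]mulrC.
Qed.

Lemma is_derive_cmulE (c : R) (f : R -> R) (x df : R) :
  is_derive x (1 : R) f df -> is_derive x (1 : R) (fun y => c * f y) (c * df).
Proof. by move=> Hf; exact: (is_deriveZ c Hf). Qed.

Lemma is_derive_expE (f : R -> R) (n : nat) (x df : R) :
  is_derive x (1 : R) f df ->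
  is_derive x (1 : R) (fun y => f y ^+ n) (n%:R * f x ^+ n.-1 * df).
Proof.
move=> Hf; rewrite (_ : (fun y => _) = f ^+ n); first exact: is_deriveX.
by apply/funext => y; rewrite exprfctE.
Qed.

Lemma is_derive_compE (f g : R -> R) (x df dg : R) :
  is_derive (g x) (1 : R) f df -> is_derive x (1 : R) g dg ->
  is_derive x (1 : R) (fun y => f (g y)) (df * dg).
Proof. by move=> Hf Hg; exact: (is_derive1_comp Hf Hg). Qed.

Lemma integral_is_derive (f F : R -> R) (a b : R) : a <= b ->
  continuous f -> (forall x, is_derive x (1 : R) F (f x)) ->
  (\int[mu]_(x in `[a, b]) (f x)%:E = (F b - F a)%:E)%E.
Proof.
move=> + cf dF; rewrite le_eqVlt => /predU1P[<-|ab].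
  by rewrite set_itv1 integral_set1 subrr.
have dF' x : derivable F x 1 by exact: ex_derive.
have cF : continuous F.
  by move=> x; apply: differentiable_continuous; apply/derivable1_diffP.
rewrite (@continuous_FTC2 R f F)//.
- exact: continuous_subspaceT.
- split; first by move=> x _.
  + exact/cvg_at_right_filter/cF.
  + exact/cvg_at_left_filter/cF.
- by move=> x _; rewrite derive1E; exact: derive_val.
Qed.

Lemma measurable_enorm : measurable_fun setT (enorm : plane R -> R).
Proof.
apply: (@measurableT_comp _ _ _ _ _ _ (@Num.sqrt R)).
  by apply: continuous_measurable_fun; exact: sqrt_continuous.
by apply: measurable_funD; apply: measurable_funM.
Qed.

Lemma measurable_lt_set (f g : plane R -> R) : measurable_fun setT f ->
  measurable_fun setT g -> measurable [set p | f p < g p].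
Proof.
move=> mf mg; rewrite -[X in measurable X]setTI.
exact: (measurable_fun_ltr mf mg).
Qed.

Lemma measurable_le_set (f g : plane R -> R) : measurable_fun setT f ->
  measurable_fun setT g -> measurable [set p | f p <= g p].
Proof.
move=> mf mg; rewrite -[X in measurable X]setTI.
exact: (measurable_fun_ler mf mg).
Qed.

Lemma leb2_vertical_line (k : R) : leb2 [set p : plane R | p.1 = k] = 0%E.
Proof.
rewrite (_ : [set p | _] = [set k] `*` setT); last first.
  by apply/seteqP; split => -[x y] /=; tauto.
rewrite [LHS]product_measure1E//.
by rewrite [X in (X * _)%E](lebesgue_measure_set1 k) mul0e.
Qed.

(** A rotation takes the line to a vertical one. *)
Lemma leb2_line (a b k : R) : (a, b) != (0, 0) ->
  leb2 [set p : plane R | a * p.1 + b * p.2 = k] = 0%E.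
Proof.
move=> ab0; pose n := Num.sqrt (a ^+ 2 + b ^+ 2).
have n2 : n ^+ 2 = a ^+ 2 + b ^+ 2 by rewrite sqr_sqrtr// addr_ge0// sqr_ge0.
have n0 : n != 0.
  apply: contra ab0 => /eqP n0; move: n2; rewrite n0 expr0n/= => /esym/eqP.
  by rewrite paddr_eq0 ?sqr_ge0// !sqrf_eq0 xpair_eqE.
have CS : (a / n) ^+ 2 + (b / n) ^+ 2 = 1.
  by rewrite !expr_div_n -mulrDl -n2 divff// sqrf_eq0.
have [_ /(_ [set p : plane R | p.1 = k / n])] := preserves_leb2_rot _ _ CS.
rewrite leb2_vertical_line => <-.
  congr (leb2 _); apply/seteqP; split => -[x y] /= ; rewrite /rot /=.
    by move=> <-; field.
  by move=> H; rewrite -[k](@divfK _ n) // -H; field.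
rewrite (_ : [set p | _] = [set k / n] `*` setT); last first.
  by apply/seteqP; split => -[x y] /=; tauto.
exact: measurableX.
Qed.

(** The triangle with apex at the origin, height [h] along the first axis and
    slopes [-t] and [t] of its sides, without its apex and its upper side, so that
    rotated copies can tile a polygon deprived of its center. *)
Definition wedge (h t : R) : set (plane R) :=
  [set p | [/\ 0 < p.1, p.1 <= h, - t * p.1 <= p.2 & p.2 < t * p.1]].

Lemma measurable_wedge h t : measurable (wedge h t).
Proof.
rewrite (_ : wedge h t = [set p : plane R | (fun=> 0) p < p.1] `&`
  [set p : plane R | p.1 <= (fun=> h) p] `&`
  [set p : plane R | (fun p : plane R => - t * p.1) p <= p.2] `&`
  [set p : plane R | p.2 < (fun p : plane R => t * p.1) p]); last first.
  by apply/seteqP; split => p /=; [case|move=> [[[]]]].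
have mlin k : measurable_fun setT (fun p : plane R => k * p.1) by exact: measurable_funM.
apply: measurableI; last exact: measurable_lt_set.
apply: measurableI; last exact: measurable_le_set.
by apply: measurableI; [exact: measurable_lt_set|exact: measurable_le_set].
Qed.

(** For a function that is homogeneous of degree [k - 1] the hypothesis on the
    vertical sections follows from its case [x = 1]; the value [k = 1] gives the
    area and [k = 2] the first moment. *)
Lemma integral_wedge (f : plane R -> R) (h t c : R) (k : nat) :
  0 <= h -> measurable_fun setT f -> (forall p, 0 <= f p) ->
  (forall x : R, 0 < x ->
    (\int[mu]_(y in `[(- t * x)%R, (t * x)%R]) (f (x, y))%:E = (c * x ^+ k)%R%:E)%E) ->
  (\int[leb2]_(p in wedge h t) (f p)%:E = (c * h ^+ k.+1 / k.+1%:R)%:E)%E.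
Proof.
move=> h0 mf f0 If.
have mfE : measurable_fun setT (EFin \o f) by exact/measurable_EFinP.
rewrite integral_mkcond.
rewrite [LHS](@fubini_tonelli1 _ _ _ _ _ mu mu); last 2 first.
- by apply/(measurable_restrictT _ (measurable_wedge h t)); exact: measurable_funTS.
- by move=> p; rewrite patchE; case: ifP => // _; rewrite lee_fin.
transitivity (\int[mu]_(x in `]0%R, h]) (c * x ^+ k)%R%:E)%E.
  rewrite [RHS]integral_mkcond; apply: eq_integral => x _.
  rewrite /fubini_F [RHS]patchE.
  case: ifPn; rewrite ?inE ?notin_setE /= in_itv/=.
    move=> /andP[x0 xh]; rewrite -If// -integral_itv_bndo_bndc; last first.
      apply: measurable_funTS.
      by apply/measurable_EFinP; apply: (measurableT_comp mf); exact: measurable_fun_pair.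
    rewrite [RHS]integral_mkcond; apply: eq_integral => y _.
    rewrite !patchE !mem_setE; congr (if _ then _ else _).
    apply/asboolP/idP => /=; rewrite in_itv /=.
      by move=> [_ _ -> ->].
    by move=> /andP[].
  move=> xh; apply: integral0_eq => y _; rewrite patchE ifF//.
  by apply/negbTE; rewrite notin_setE /= => -[x0 xh' _ _]; apply: xh; rewrite x0.
rewrite integral_itv_obnd_cbnd; last first.
  by apply/measurable_EFinP; apply: measurable_funM.
have dF (x : R) : is_derive x (1 : R) (fun x : R => c / k.+1%:R * x ^+ k.+1) (c * x ^+ k).
  apply: (is_derive_eq (is_derive_cmulE _ _ _ _ (is_derive_expE _ _ _ _ (is_derive_id _ _)))).
  rewrite mulr1 mulrA divfK ?pnatr_eq0//.
rewrite (integral_is_derive _ _ _ _ h0 _ dF).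
  by rewrite expr0n /= mulr0 subr0 mulrAC.
move=> x; apply: cvgM; first exact: cvg_cst.
exact: exprn_continuous.
Qed.

Lemma leb2_wedge h t : 0 <= h -> 0 <= t -> leb2 (wedge h t) = (t * h ^+ 2)%:E.
Proof.
move=> h0 t0; rewrite -[LHS]mul1e -integral_cst; last exact: measurable_wedge.
rewrite (@integral_wedge (fun=> 1) h t (2 * t) 1) //.
  by congr (_%:E); field.
move=> x x0; rewrite integral_cst//= mul1e lebesgue_measure_itv /= lte_fin.
case: ifPn => [_|]; first by rewrite -EFinB; congr (_%:E); ring.
rewrite -leNgt => tx; have -> : t = 0; last by rewrite mulr0 mul0r.
apply: le_anti; rewrite t0 andbT.
have : 2 * (t * x) <= 0 by lra.
by rewrite pmulr_rle0// pmulr_lle0.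
Qed.

Lemma is_derive_norm_primitive (x y : R) : 0 < x ->
  is_derive y (1 : R)
   (fun y => (y * Num.sqrt (x ^+ 2 + y ^+ 2) +
              x ^+ 2 * ln (y + Num.sqrt (x ^+ 2 + y ^+ 2))) / 2)
   (Num.sqrt (x ^+ 2 + y ^+ 2)).
Proof.
move=> x0; set q := fun y : R => x ^+ 2 + y ^+ 2.
have q0 z : 0 < q z by rewrite ltr_pwDl ?sqr_ge0 ?exprn_gt0.
set n := fun y => Num.sqrt (q y).
have n0 z : 0 < n z by rewrite sqrtr_gt0.
have n2 z : n z ^+ 2 = q z by rewrite sqr_sqrtr// ltW.
have yn0 : 0 < y + n y.
  have : `|y| < n y.
    by rewrite -ltr_sqr ?nnegrE ?(ltW (n0 _))// n2 /q real_normK ?num_real// ltrDr exprn_gt0.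
  by have := ler_norm (- y); rewrite normrN; lra.
have dq : is_derive y (1 : R) q (2 * y).
  apply: (is_derive_eq (is_derive_addE _ _ _ _ _ (is_derive_cst _ _ _)
    (is_derive_expE _ 2 _ _ (is_derive_id _ _)))).
  by rewrite add0r mulr1 expr1.
have dn : is_derive y (1 : R) n (y / n y).
  have := is_derive_compE _ q _ _ _ (is_derive1_sqrt (q0 y)) dq.
  move/is_derive_eq; apply.
  by rewrite -/(n y); field; rewrite gt_eqF.
have dyn : is_derive y (1 : R) (fun z => z + n z) (1 + y / n y).
  exact: (is_derive_addE _ _ _ _ _ (is_derive_id _ _) dn).
have dl : is_derive y (1 : R) (fun z => ln (z + n z)) ((y + n y)^-1 * (1 + y / n y)).
  exact: (is_derive_compE _ (fun z => z + n z) _ _ _ (is_derive1_ln yn0) dyn).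
have dF := is_derive_mulE _ _ _ _ _ (is_derive_addE _ _ _ _ _
  (is_derive_mulE _ _ _ _ _ (is_derive_id _ _) dn) (is_derive_cmulE (x ^+ 2) _ _ _ dl))
  (is_derive_cst (2^-1 : R) y 1).
apply: (is_derive_eq dF) => /=; rewrite -/(n y).
have -> : x ^+ 2 = n y ^+ 2 - y ^+ 2 by rewrite n2 /q addrK.
by field; rewrite !gt_eqF.
Qed.

(** The half-angle formula for the angle [b + pi / 2]. *)
Lemma tan_quarter_half (b : R) : - (pi / 2) < b < pi / 2 ->
  tan (pi / 4 + b / 2) = (1 + sin b) / cos b.
Proof.
move=> /andP[b1 b2]; set u := pi / 4 + b / 2.
have pi0 := pi_gt0 R.
have su0 : 0 < sin u by apply: sin_gt0_pihalf; apply/andP; split; rewrite /u; lra.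
have cu0 : 0 < cos u by apply: cos_gt0_pihalf; apply/andP; split; rewrite /u; lra.
have bu : b + pi / 2 = u *+ 2 by rewrite /u mulr2n; field.
have -> : sin b = 1 - 2 * cos u ^+ 2.
  by rewrite -[LHS]opprK -cosDpihalf bu cos_mulr2n -mulr_natl; ring.
have -> : cos b = 2 * (cos u * sin u).
  by rewrite -sinDpihalf bu sin_mulr2n -mulr_natl.
have -> : cos u ^+ 2 = 1 - sin u ^+ 2 by exact: cos2sin2.
by rewrite /tan; field; rewrite !gt_eqF.
Qed.

Lemma logtanE (b : R) : - (pi / 2) < b < pi / 2 ->
  logtan b = ln ((1 + sin b) / cos b).
Proof. by move=> hb; rewrite /logtan tan_quarter_half. Qed.

(** At the ends of the section at [x] the distance to the apex is [x / cos b];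
    the difference of the two logarithms in the primitive is then twice
    [ln ((1 + sin b) / cos b)], which is [logtan b]. *)
Lemma integral_norm_wedge (h b : R) : 0 <= h -> 0 <= b < pi / 2 ->
  (\int[leb2]_(p in wedge h (tan b)) (enorm p)%:E =
   (h ^+ 3 / 3 * (sin b / cos b ^+ 2 + logtan b))%:E)%E.
Proof.
move=> h0 /andP[b0 b1].
have pi0 := pi_gt0 R.
have hb : - (pi / 2) < b < pi / 2 by apply/andP; split; lra.
have cb : 0 < cos b by exact: cos_gt0_pihalf.
have sb : 0 <= sin b by apply: sin_ge0_pi; apply/andP; split; lra.
rewrite (@integral_wedge _ h (tan b) (sin b / cos b ^+ 2 + logtan b) 2) //.
- by congr (_%:E); rewrite mulrC; field; rewrite gt_eqF.
- exact: measurable_enorm.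
- by move=> p; exact: sqrtr_ge0.
move=> x x0; set t := tan b.
have t0 : 0 <= t by rewrite divr_ge0// ltW.
have tx : - t * x <= t * x by rewrite mulNr -subr_ge0 opprK addr_ge0// mulr_ge0// ltW.
have dF y := is_derive_norm_primitive x y x0.
transitivity (\int[mu]_(y in `[(- t * x)%R, (t * x)%R])
   (Num.sqrt (x ^+ 2 + y ^+ 2))%:E)%E.
  by apply: eq_integral => y _; rewrite /enorm /dot /= !expr2.
rewrite (integral_is_derive _ _ _ _ tx _ dF); last first.
  move=> y; apply: continuous_comp; last exact: sqrt_continuous.
  by apply: cvgD; [exact: cvg_cst|exact: exprn_continuous].
congr (_%:E).
have n1 : Num.sqrt (x ^+ 2 + (t * x) ^+ 2) = x / cos b.
  have -> : x ^+ 2 + (t * x) ^+ 2 = (x / cos b) ^+ 2.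
    rewrite /t /tan; transitivity (x ^+ 2 * (cos b ^+ 2 + sin b ^+ 2) / cos b ^+ 2).
      by field; rewrite gt_eqF.
    by rewrite cos2Dsin2 mulr1 expr_div_n.
  by rewrite sqrtr_sqr ger0_norm// divr_ge0// ltW.
have n2 : Num.sqrt (x ^+ 2 + (- t * x) ^+ 2) = x / cos b.
  by rewrite mulNr sqrrN.
rewrite n1 n2 logtanE//.
have s1 : 0 < 1 - sin b.
  by rewrite subr_gt0 lt_neqAle sin_le1 andbT; apply/eqP => s1;
    move: (cos2Dsin2 b); rewrite s1; have := exprn_gt0 2 cb; lra.
have l1 : ln (t * x + x / cos b) = ln x + ln ((1 + sin b) / cos b).
  rewrite -lnM ?posrE// ?divr_gt0//; first by congr ln; rewrite /t /tan; field; rewrite gt_eqF.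
  by lra.
have l2 : ln (- t * x + x / cos b) = ln x - ln ((1 + sin b) / cos b).
  rewrite -ln_div ?posrE// ?divr_gt0//; last by lra.
  congr ln; rewrite /t /tan.
  transitivity (x * (1 - sin b) / cos b); first by field; rewrite gt_eqF.
  have c2 : cos b ^+ 2 = (1 - sin b) * (1 + sin b) by rewrite cos2sin2; ring.
  transitivity (x * ((1 - sin b) * (1 + sin b)) / ((1 + sin b) * cos b)).
    by field; rewrite !gt_eqF//; lra.
  by rewrite -c2; field; rewrite !gt_eqF//; lra.
by rewrite l1 l2 /t /tan; field; rewrite gt_eqF.
Qed.

End WedgeIntegral.

(** * Convex hulls *)
Section ConvexHull.
Context {R : realType}.

Lemma convex_setP (A : set (R * R)) :
  @convex_set R (R^o * R^o)%type A <->
  forall x y (l : R), 0 <= l <= 1 -> A x -> A y ->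
    A (l * x.1 + (1 - l) * y.1, l * x.2 + (1 - l) * y.2).
Proof.
split=> [cA x y l /andP[l0 l1] Ax Ay|cA x y l].
  have := cA x y (Itv01 l0 l1); rewrite !inE; exact.
rewrite !inE => Ax Ay; apply: (cA x y l%:num) => //.
by apply/andP; split.
Qed.

Lemma convex_hull_convex (A : set (R * R)) :
  @convex_set R (R^o * R^o)%type (convex_hull A).
Proof.
apply/convex_setP => x y l l01 Ax Ay B [cB AB].
by move/convex_setP: (cB); apply=> //; [exact: Ax|exact: Ay].
Qed.

(** Two successive convex combinations: of [p + a] with [p], and of the result
    with [p + b]. *)
Lemma convex_triangle (A : set (R * R)) (p a b : R * R) (l m : R) :
  @convex_set R (R^o * R^o)%type A -> A p ->
  A (p.1 + a.1, p.2 + a.2) -> A (p.1 + b.1, p.2 + b.2) ->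
  0 <= l -> 0 <= m -> l + m <= 1 ->
  A (p.1 + (l * a.1 + m * b.1), p.2 + (l * a.2 + m * b.2)).
Proof.
move=> /convex_setP cA Ap Aa Ab l0 m0 lm.
have [m1|m1] := eqVneq m 1.
  have -> : l = 0 by lra.
  by rewrite m1 !mul0r !add0r !mul1r.
have m1' : 0 < 1 - m by rewrite subr_gt0 lt_neqAle m1 /=; lra.
have /cA H : 0 <= l / (1 - m) <= 1.
  by rewrite divr_ge0 ?(ltW m1')//= ler_pdivrMr// mul1r; lra.
have /cA H' : 0 <= m <= 1 by apply/andP; split => //; lra.
have := H' _ _ Ab (H _ _ Aa Ap); rewrite /=.
congr A; congr pair; by field; rewrite gt_eqF.
Qed.

End ConvexHull.

(** * The cyclic hexagon *)
Section Hexagon.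
Context {R : realType}.
(** [rho] is the circumradius, [sg] and [gm] are the sine and the cosine of the
    half apex angle [beta] of the four equal triangles.  As [alpha + 2 beta] is a
    right angle, the remaining half apex angle [alpha] has cosine [2 sg gm] and
    sine [gm ^ 2 - sg ^ 2]. *)
Variables (rho sg gm : R).

(** Half the width of the hexagon, half the length of its two vertical sides, and
    the sum of this half length and of the circumradius, which is the distance of
    two consecutive rows when hexagons tile the plane. *)
Definition hexc : R := 2 * rho * sg * gm.
Definition hexs : R := rho * (gm ^+ 2 - sg ^+ 2).
Definition hexh : R := 2 * rho * gm ^+ 2.

Definition hexagon : set (plane R) :=
  [set p | `|p.1| <= hexc /\ sg * `|p.1| + gm * `|p.2| <= gm * rho].

(** The vertices in counterclockwise order, from the lower end of the right side;
    the triangles on the vertical sides [0] and [3] have half apex angle [alpha]. *)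
Definition hexvertex (n : nat) : plane R :=
  match n with
  | 0 => (hexc, - hexs) | 1 => (hexc, hexs) | 2 => (0, rho)
  | 3 => (- hexc, hexs) | 4 => (- hexc, - hexs) | _ => (0, - rho)
  end.

Definition hexvertices (p : plane R) (j : 'I_6) : plane R :=
  (p.1 + (hexvertex j).1, p.2 + (hexvertex j).2).

Definition hexcell (p : plane R) : set (plane R) := [set x | hexagon (vec p x)].

Hypotheses (rho0 : 0 < rho) (sg0 : 0 < sg) (sg_gm : sg < gm)
  (sg2gm2 : sg ^+ 2 + gm ^+ 2 = 1).

Let gm0 : 0 < gm. Proof. exact: lt_trans sg_gm. Qed.
Local Notation c := hexc.
Local Notation s := hexs.
Local Notation h := hexh.

Lemma hexc_gt0 : 0 < c. Proof. by rewrite /hexc !mulr_gt0. Qed.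

Lemma hexs_gt0 : 0 < s.
Proof. by rewrite /hexs mulr_gt0// subr_gt0 ltr_sqr ?nnegrE ?ltW. Qed.

Lemma hexh_gt0 : 0 < h. Proof. by rewrite /hexh !mulr_gt0// exprn_gt0. Qed.

Lemma hexhE : h = rho + s.
Proof.
transitivity (rho * (sg ^+ 2 + gm ^+ 2) + s); last by rewrite sg2gm2 mulr1.
by rewrite /hexh /hexs; ring.
Qed.

Lemma hexs_lt : s < rho.
Proof.
rewrite /hexs gtr_pMr//; have := exprn_gt0 2 sg0.
by move: sg2gm2; lra.
Qed.

Lemma hexcs : c ^+ 2 + s ^+ 2 = rho ^+ 2.
Proof.
transitivity (rho ^+ 2 * (sg ^+ 2 + gm ^+ 2) ^+ 2); last by rewrite sg2gm2 expr1n mulr1.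
by rewrite /hexc /hexs; ring.
Qed.

Lemma sg_hexc : sg * c = gm * (rho - s).
Proof.
transitivity (gm * (rho * (sg ^+ 2 + gm ^+ 2) - s)); last by rewrite sg2gm2 mulr1.
by rewrite /hexc /hexs; ring.
Qed.

Lemma hexagonP (p : plane R) : hexagon p <->
  [/\ - c <= p.1, p.1 <= c & [/\ sg * p.1 + gm * p.2 <= gm * rho,
   sg * p.1 - gm * p.2 <= gm * rho, - (sg * p.1) + gm * p.2 <= gm * rho &
   - (sg * p.1) - gm * p.2 <= gm * rho]].
Proof.
rewrite /hexagon /= ler_norml; split.
  move=> [/andP[-> ->] H]; split => //.
  have Hx := ler_norm (sg * p.1); have Hx' := ler_norm (- (sg * p.1)).
  have Hy := ler_norm (gm * p.2); have Hy' := ler_norm (- (gm * p.2)).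
  rewrite normrN normrM (gtr0_norm sg0) in Hx Hx'.
  rewrite normrM (gtr0_norm gm0) in Hy.
  rewrite normrN normrM (gtr0_norm gm0) in Hy'.
  by split; lra.
move=> [-> -> [H1 H2 H3 H4]]; split => //.
by case: (ger0P p.1) => _; case: (ger0P p.2) => _; lra.
Qed.

Lemma hexagon_convex (p : plane R) : @convex_set R (R^o * R^o)%type (hexcell p).
Proof.
apply/convex_setP => x y l /andP[l0 l1].
have l1' : 0 <= 1 - l by rewrite subr_ge0.
have key k a b e : a <= k -> b <= k -> e = l * a + (1 - l) * b -> e <= k.
  move=> ak bk ->; have := ler_wpM2l l0 ak; have := ler_wpM2l l1' bk; lra.
move=> /hexagonP[x1 x2 [x3 x4 x5 x6]] /hexagonP[y1 y2 [y3 y4 y5 y6]].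
apply/hexagonP; rewrite /vec /=; rewrite /vec /= in x1 x2 x3 x4 x5 x6 y1 y2 y3 y4 y5 y6.
split; [| |split].
- rewrite lerNl; rewrite lerNl in x1; rewrite lerNl in y1.
  by apply: (key _ _ _ _ x1 y1); ring.
- by apply: (key _ _ _ _ x2 y2); ring.
- by apply: (key _ _ _ _ x3 y3); ring.
- by apply: (key _ _ _ _ x4 y4); ring.
- by apply: (key _ _ _ _ x5 y5); ring.
- by apply: (key _ _ _ _ x6 y6); ring.
Qed.

Lemma hexcell_vertex p j : hexcell p (hexvertices p j).
Proof.
have c0 := hexc_gt0; have s0 := hexs_gt0; have sc := sg_hexc.
have gr : 0 < gm * rho by rewrite mulr_gt0.
have gs : 0 < gm * s by rewrite mulr_gt0.
have gsr : gm * s < gm * rho by rewrite ltr_pM2l// hexs_lt.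
rewrite /hexcell /vec /hexvertices /= !(addrAC _ (_ : R) (- _)) !subrr !add0r.
by apply/hexagonP; case: j => -[|[|[|[|[|[|//]]]]]] ? /=; split;
  try split; try lra.
Qed.

Lemma hexcell_center p : hexcell p p.
Proof.
apply/hexagonP; rewrite /vec /= !subrr; have := hexc_gt0.
have gr : 0 < gm * rho by rewrite mulr_gt0.
by split; try split; lra.
Qed.

(** Every point of the hexagon lies in the triangle whose sector contains it; the
    sectors are told apart by the signs of [u] and of [c v - s u], [c v + s u]. *)
Lemma hexagon_sector (u v : R) : hexagon (u, v) ->
  exists j : 'I_6, exists l m, [/\ 0 <= l, 0 <= m, l + m <= 1,
   u = l * (hexvertex j).1 + m * (hexvertex (ordS j)).1 &
   v = l * (hexvertex j).2 + m * (hexvertex (ordS j)).2].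
Proof.
move=> /hexagonP[/= u1 u2 [H1 H2 H3 H4]].
have c0 := hexc_gt0; have s0 := hexs_gt0; have sc := sg_hexc.
have cs2 : 0 < 2 * c * s by apply: mulr_gt0 => //; apply: mulr_gt0.
have cr : 0 < c * rho by rewrite mulr_gt0.
have side (a b : R) : sg * a + gm * b <= gm * rho -> (rho - s) * a + c * b <= c * rho.
  move=> ab; rewrite -(ler_pM2l gm0).
  have -> : gm * ((rho - s) * a + c * b) = c * (sg * a + gm * b).
    by rewrite mulrDr mulrA -sc; ring.
  by have := ler_wpM2l (ltW c0) ab; rewrite mulrCA.
have {}H1 := side _ _ H1.
have {}H2 : (rho - s) * u + c * (- v) <= c * rho by apply: side; lra.
have {}H3 : (rho - s) * (- u) + c * v <= c * rho by apply: side; lra.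
have {}H4 : (rho - s) * (- u) + c * (- v) <= c * rho by apply: side; lra.
have sum (l m d : R) : 0 < d -> l + m <= d -> l / d + m / d <= 1.
  by move=> d0 lm; rewrite -mulrDl ler_pdivrMr// mul1r.
have cu (a : R) : a / c = (a * rho) / (c * rho) by field; rewrite !gt_eqF.
have cne : c != 0 by rewrite gt_eqF.
have sne : s != 0 by rewrite gt_eqF.
have rne : rho != 0 by rewrite gt_eqF.
have cs u' : `|u'| <= c -> s * u' * 2 <= 2 * c * s.
  move=> uc; have := ler_wpM2l (ltW s0) (le_trans (ler_norm u') uc); lra.
have [u0|u0] := leP 0 u; have [A|A] := leP (c * v) (s * u);
   have [B|B] := leP 0 (c * v + s * u).
- exists (@Ordinal 6 0 isT), ((s * u - c * v) / (2 * c * s)), ((s * u + c * v) / (2 * c * s)) => /=.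
  split; [apply: divr_ge0; lra|apply: divr_ge0; lra| |field|field].
  + by apply: sum => //; have := cs u; rewrite ger0_norm// => /(_ u2); lra.
  + by rewrite ?cne ?sne ?rne.
  + by rewrite ?cne ?sne ?rne.
- exists (@Ordinal 6 5 isT), (- (c * v + s * u) / (c * rho)), (u / c) => /=.
  split; [apply: divr_ge0; lra|apply: divr_ge0; lra| |field|field].
  + by rewrite cu; apply: sum => //; lra.
  + by rewrite ?cne ?sne ?rne.
  + by rewrite ?cne ?sne ?rne.
- exists (@Ordinal 6 1 isT), (u / c), ((c * v - s * u) / (c * rho)) => /=.
  split; [apply: divr_ge0; lra|apply: divr_ge0; lra| |field|field].
  + by rewrite cu; apply: sum => //; lra.
  + by rewrite ?cne ?sne ?rne.
  + by rewrite ?cne ?sne ?rne.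
- have : 0 <= s * u by rewrite mulr_ge0// ltW.
  by lra.
- have : 0 < s * - u by rewrite mulr_gt0// oppr_gt0.
  by lra.
- exists (@Ordinal 6 4 isT), (- u / c), ((s * u - c * v) / (c * rho)) => /=.
  split; [apply: divr_ge0; lra|apply: divr_ge0; lra| |field|field].
  + by rewrite cu; apply: sum => //; lra.
  + by rewrite ?cne ?sne ?rne.
  + by rewrite ?cne ?sne ?rne.
- exists (@Ordinal 6 2 isT), ((c * v + s * u) / (c * rho)), (- u / c) => /=.
  split; [apply: divr_ge0; lra|apply: divr_ge0; lra| |field|field].
  + by rewrite cu; apply: sum => //; lra.
  + by rewrite ?cne ?sne ?rne.
  + by rewrite ?cne ?sne ?rne.
- exists (@Ordinal 6 3 isT), ((- (s * u) + c * v) / (2 * c * s)),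
    ((- (s * u) - c * v) / (2 * c * s)) => /=.
  split; [apply: divr_ge0; lra|apply: divr_ge0; lra| |field|field].
  + apply: sum => //; have := cs (- u); rewrite gtr0_norm ?oppr_gt0// => H.
    have {}H := H (ltac:(lra)); lra.
  + by rewrite ?cne ?sne ?rne.
  + by rewrite ?cne ?sne ?rne.
Qed.

Lemma convex_contains_hexcell (A : set (plane R)) p x :
  @convex_set R (R^o * R^o)%type A -> hexcell p x -> A p ->
  (forall j, A (hexvertices p j)) -> A x.
Proof.
move=> cA /hexagon_sector[j [l [m [l0 m0 lm /= Hu Hv]]]] Ap Aw.
have := convex_triangle _ _ _ _ _ _ cA Ap (Aw j) (Aw (ordS j)) l0 m0 lm.
by rewrite -Hu -Hv !(addrC p.1) !(addrC p.2) !subrK -surjective_pairing.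
Qed.

Lemma hexcell_hull p : hexcell p = convex_hull (range (hexvertices p)).
Proof.
apply/seteqP; split => x; last first.
  move=> /(_ (hexcell p)); apply; split; first exact: hexagon_convex.
  by move=> _ [j _ <-]; exact: hexcell_vertex.
have Aw j : convex_hull (range (hexvertices p)) (hexvertices p j).
  by apply: sub_gen_smallest; exists j.
have cA := @convex_hull_convex R (range (hexvertices p)).
move=> px; apply: (convex_contains_hexcell _ _ _ cA px) => //.
(* the center is the midpoint of two opposite vertices *)
have /convex_setP /(_ _ _ 2^-1) := cA.
move=> /(_ (hexvertices p (@Ordinal 6 2 isT)) (hexvertices p (@Ordinal 6 5 isT))) H.
have := H _ (Aw _) (Aw _); rewrite /hexvertices /=.
have -> : 2^-1 * (p.1 + 0) + (1 - 2^-1) * (p.1 + 0) = p.1 by field.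
have -> : 2^-1 * (p.2 + rho) + (1 - 2^-1) * (p.2 - rho) = p.2 by field.
by rewrite -surjective_pairing; apply; apply/andP; split; lra.
Qed.

Lemma hexcell_triangles p :
  hexcell p = \bigcup_(j in [set: 'I_6]) basic_triangle p (hexvertices p) j.
Proof.
apply/seteqP; split => x; last first.
  move=> [j _] /(_ (hexcell p)); apply; split; first exact: hexagon_convex.
  move=> y [[->|->]|->]; first exact: hexcell_center.
    exact: hexcell_vertex.
  exact: hexcell_vertex.
move=> /hexagon_sector[j [l [m [l0 m0 lm /= Hu Hv]]]]; exists j => //.
have gen y : [set p; hexvertices p j; hexvertices p (ordS j)] y ->
    basic_triangle p (hexvertices p) j y by exact: sub_gen_smallest.
have := convex_triangle _ p (hexvertex j) (hexvertex (ordS j)) l m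
  (@convex_hull_convex R _) (gen p _) (gen _ _) (gen _ _) l0 m0 lm.
rewrite -Hu -Hv !(addrC p.1) !(addrC p.2) !subrK -surjective_pairing; apply.
- by left; left.
- by left; right; rewrite /hexvertices addrC [X in (_, X)]addrC.
- by right; rewrite /hexvertices addrC [X in (_, X)]addrC.
Qed.

Lemma edist_hexvertices p j : edist p (hexvertices p j) = rho.
Proof.
rewrite /edist /enorm /vec /hexvertices /dot /= ![_ + _ - _]addrAC !subrr !add0r.
rewrite -!expr2 -[RHS](gtr0_norm rho0) -sqrtr_sqr; congr Num.sqrt.
by case: j => -[|[|[|[|[|[|//]]]]]] ? /=;
  rewrite ?sqrrN ?hexcs// expr0n /= add0r.
Qed.

Lemma hexcell_convex_hexagon p : convex_hexagon (hexvertices p) (hexcell p).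
Proof.
split; last exact: hexcell_hull.
move=> j k kj kSj.
have c0 := hexc_gt0; have s0 := hexs_gt0.
have sr : 0 < rho - s by rewrite subr_gt0 hexs_lt.
have H1 := mulr_gt0 c0 s0; have H2 := mulr_gt0 c0 rho0; have H3 := mulr_gt0 c0 sr.
rewrite /cross /vec /hexvertices /=.
have E (a b z : R) : z + a - (z + b) = a - b by ring.
rewrite !E.
case: j kj kSj => -[|[|[|[|[|[|//]]]]]] ?; case: k => -[|[|[|[|[|[|//]]]]]] ? //= _ _;
  lra.
Qed.

Lemma hexcell_cyclic p : cyclic_hexagon p (hexvertices p) (hexcell p).
Proof.
split; first exact: hexcell_convex_hexagon.
by exists rho => // j; exact: edist_hexvertices.
Qed.

End Hexagon.

(** * The hexagon as a union of six rotated triangles *)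
Section Sectors.
Context {R : realType}.

(** Six half-open sectors that partition the punctured plane; the boundary rays
    lie on the lines [z = 0], [w = z] and [w = - z]. *)
Definition sector (j : nat) (z w : R) : Prop :=
  match j with
  | 0 => 0 <= w + z /\ 0 < z - w
  | 1 => 0 <= w - z /\ 0 < z
  | 2 => 0 <= - z /\ 0 < w + z
  | 3 => 0 <= - w - z /\ 0 < w - z
  | 4 => 0 <= z - w /\ 0 < - z
  | _ => 0 <= z /\ 0 < - w - z
  end.

Lemma sector_cover (z w : R) : z != 0 \/ w != 0 ->
  [\/ sector 0 z w, sector 1 z w | [\/ sector 2 z w, sector 3 z w, sector 4 z w | sector 5 z w]].
Proof.
move=> W.
have [z0|z0|z0] := ltgtP z 0; have [a0|a0|a0] := ltgtP (w + z) 0;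
have [b0|b0|b0] := ltgtP (w - z) 0; rewrite /sector;
  try (by apply: Or31; split; lra); try (by apply: Or32; split; lra);
  try (by apply: Or33; apply: Or41; split; lra);
  try (by apply: Or33; apply: Or42; split; lra);
  try (by apply: Or33; apply: Or43; split; lra);
  try (by apply: Or33; apply: Or44; split; lra);
  by case: W => /eqP W; exfalso; apply: W; lra.
Qed.

Lemma sector_disjoint (i j : nat) (z w : R) : (i < 6)%N -> (j < 6)%N ->
  sector i z w -> sector j z w -> i = j.
Proof.
case: i => [|[|[|[|[|[|//]]]]]] _; case: j => [|[|[|[|[|[|//]]]]]] _ //=;
  by move=> [H1 H2] [H3 H4]; exfalso; lra.
Qed.

Lemma sector_neq0 (j : nat) : ~ sector j 0 0.
Proof. by case: j => [|[|[|[|[|j]]]]] /= [H1 H2]; lra. Qed.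

End Sectors.

Section HexagonSectors.
Context {R : realType}.
Variables (rho sg gm : R).
Hypotheses (rho0 : 0 < rho) (sg0 : 0 < sg) (sg_gm : sg < gm)
  (sg2gm2 : sg ^+ 2 + gm ^+ 2 = 1).

Let gm0 : 0 < gm. Proof. exact: lt_trans sg_gm. Qed.
Local Notation c := (hexc rho sg gm).
Local Notation s := (hexs rho sg gm).
Local Notation hexagon := (hexagon rho sg gm).

Let c0 : 0 < c. Proof. exact: hexc_gt0. Qed.
Let s0 : 0 < s. Proof. exact: hexs_gt0. Qed.
Let sr : s < rho. Proof. exact: hexs_lt. Qed.

(** In the form on the right [rho], [c] and [s] only occur in products with the
    coordinates and with each other; the sectors and the rows of the lattice are
    described by the same products, so that linear arithmetic compares them. *)
Lemma slanted_sideE (a b : R) :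
  (sg * a + gm * b <= gm * rho) = (rho * a - s * a + c * b <= c * rho).
Proof.
rewrite -(ler_pM2l c0) -(ler_pM2l gm0 (_ + _)).
congr (_ <= _); last by rewrite mulrCA.
rewrite -mulrBl [RHS]mulrDr [gm * (_ * a)]mulrA -(sg_hexc rho sg gm sg2gm2); ring.
Qed.

Lemma hexagon_scaledP (x y : R) : hexagon (x, y) <->
  [/\ - (c * rho) <= rho * x, rho * x <= c * rho &
   [/\ rho * x - s * x + c * y <= c * rho, rho * x - s * x - c * y <= c * rho,
      - (rho * x - s * x) + c * y <= c * rho &
      - (rho * x - s * x) - c * y <= c * rho]].
Proof.
have sgn1 (a b : R) : sg * a - gm * b = sg * a + gm * (- b) by ring.
have sgn2 (a b : R) : - (sg * a) + gm * b = sg * (- a) + gm * b by ring.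
have sgn3 (a b : R) : - (sg * a) - gm * b = sg * (- a) + gm * (- b) by ring.
apply: (iff_trans (hexagonP _ _ _ sg0 sg_gm _)) => /=.
rewrite sgn1 sgn2 sgn3 !slanted_sideE !mulrN.
have -> : (- (c * rho) <= rho * x) = (- c <= x) by rewrite -mulNr [_ * rho]mulrC ler_pM2l.
have -> : (rho * x <= c * rho) = (x <= c) by rewrite [c * rho]mulrC ler_pM2l.
by rewrite !opprK; split => -[? ? [H1 H2 H3 H4]]; (do 2?split=> //); lra.
Qed.

(** The sector between the rays through the vertices [j] and [j + 1], the first
    ray included and the second one excluded. *)
Definition hexsector (j : nat) : set (plane R) :=
  [set p | sector j (s * p.1) (c * p.2)].

(** The outer unit normals of the six sides. *)
Definition hexrot (j : nat) : R * R :=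
  match j with
  | 0 => (1, 0) | 1 => (sg, gm) | 2 => (- sg, gm)
  | 3 => (- 1, 0) | 4 => (- sg, - gm) | _ => (sg, - gm)
  end.

(** The basic triangles, turned so that the normal of the outer side lies along
    the first axis. *)
Definition hexwedge (j : nat) : set (plane R) :=
  match j with
  | 0 | 3 => wedge c (s / c) | _ => wedge (gm * rho) (sg / gm)
  end.

Lemma hexrot_norm j : (hexrot j).1 ^+ 2 + (hexrot j).2 ^+ 2 = 1.
Proof.
by case: j => [|[|[|[|[|j]]]]] /=; rewrite ?sqrrN ?expr1n ?expr0n ?addr0.
Qed.

Lemma wedgeP (H t : R) (p : plane R) : 0 < t ->
  wedge H t p <-> [/\ p.1 <= H, 0 <= p.2 + t * p.1 & 0 < t * p.1 - p.2].
Proof.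
move=> t0; rewrite /wedge /=; split=> [[H1 H2 H3 H4]|[H1 H2 H3]].
  by split => //; lra.
split=> //; try lra.
by have : 0 < t * p.1 by [lra]; rewrite pmulr_rgt0.
Qed.

(** Inside a sector the inequality of the side that it faces implies those of the
    other five sides. *)
Lemma hexsector_wedge j :
  hexagon `&` hexsector j = rot (hexrot j).1 (hexrot j).2 @^-1` hexwedge j.
Proof.
apply/seteqP.
suff H p : (hexagon `&` hexsector j) p <->
    hexwedge j (rot (hexrot j).1 (hexrot j).2 p).
  by split => p /H.
case: p => x y.
have cne : c != 0 by rewrite gt_eqF.
have gne : gm != 0 by rewrite gt_eqF.
have rne : rho != 0 by rewrite gt_eqF.
have t1 : 0 < s / c by rewrite divr_gt0.
have t2 : 0 < sg / gm by rewrite divr_gt0.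
have g2 : gm ^+ 2 = 1 - sg ^+ 2 by rewrite -sg2gm2; ring.
have gr0 : 0 < gm * rho by rewrite mulr_gt0.
have P1 (a : R) : (0 <= a / c) = (0 <= a) by rewrite pmulr_lge0// invr_gt0.
have P2 (a : R) : (0 < a / c) = (0 < a) by rewrite pmulr_lgt0// invr_gt0.
have P3 (a : R) : (0 <= a / (gm * rho)) = (0 <= a) by rewrite pmulr_lge0// invr_gt0.
have P4 (a : R) : (0 < a / (gm * rho)) = (0 < a) by rewrite pmulr_lgt0// invr_gt0.
have P5 (a : R) : (0 <= a / gm) = (0 <= s * a).
  by rewrite pmulr_lge0 ?invr_gt0// pmulr_rge0.
have P6 (a : R) : (0 < a / gm) = (0 < s * a).
  by rewrite pmulr_lgt0 ?invr_gt0// pmulr_rgt0.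
have X0 (a : R) : (a <= c) = (rho * a <= c * rho) by rewrite [c * rho]mulrC ler_pM2l.
have sx : [\/ 0 < s * x /\ s * x <= rho * x, s * x = 0 /\ rho * x = 0 |
    s * x < 0 /\ rho * x <= s * x].
  have [x0|x0|<-] := ltgtP 0 x.
  - by apply: Or31; rewrite mulr_gt0// ler_wpM2r// ltW.
  - by apply: Or33; rewrite pmulr_rlt0// ler_wnM2r// ltW.
  - by apply: Or32; rewrite !mulr0.
rewrite /setI /= /hexsector /=.
case: j => [|[|[|[|[|j]]]]]; (apply: (iff_trans _ (iff_sym (wedgeP _ _ _ _))); [|by []]);
  rewrite /rot /=.
- have -> : - 0 * x + 1 * y + s / c * (1 * x + 0 * y) = (c * y + s * x) / c by field.
  have -> : s / c * (1 * x + 0 * y) - (- 0 * x + 1 * y) = (s * x - c * y) / c by field.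
  have -> : 1 * x + 0 * y = x by ring.
  rewrite P1 P2 X0; split=> [[/hexagon_scaledP[H1 H2 [H3 H4 H5 H6]] [H7 H8]]|[H1 H2 H3]].
    by split.
  split; last by split; lra.
  by apply/hexagon_scaledP; case: sx => -[S1 S2]; split; try split; lra.
- have -> : - gm * x + sg * y + sg / gm * (sg * x + gm * y) = (c * y - s * x) / (gm * rho).
    by rewrite /hexs /hexc; field; rewrite ?gne ?rne.
  have -> : sg / gm * (sg * x + gm * y) - (- gm * x + sg * y) = x / gm.
    by rewrite -[X in _ = X / _]mul1r -sg2gm2; field.
  rewrite P3 P6 slanted_sideE; split=> [[/hexagon_scaledP[H1 H2 [H3 H4 H5 H6]] [H7 H8]]|[H1 H2 H3]].
    by split.
  split; last by split; lra.
  by apply/hexagon_scaledP; case: sx => -[S1 S2]; split; try split; lra.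
- have -> : - gm * x + - sg * y + sg / gm * (- sg * x + gm * y) = (- x) / gm.
    by rewrite -[X in _ = (- X) / _]mul1r -sg2gm2; field.
  have -> : sg / gm * (- sg * x + gm * y) - (- gm * x + - sg * y) = (c * y + s * x) / (gm * rho).
    by rewrite /hexs /hexc; field; rewrite ?gne ?rne.
  have -> : - sg * x = sg * - x by ring.
  rewrite P5 P4 slanted_sideE !mulrN; split=> [[/hexagon_scaledP[H1 H2 [H3 H4 H5 H6]] [H7 H8]]|[H1 H2 H3]].
    by split => //; lra.
  split; last by split; lra.
  by apply/hexagon_scaledP; case: sx => -[S1 S2]; split; try split; lra.
- have -> : - 0 * x + - 1 * y + s / c * (- 1 * x + 0 * y) = (- (c * y) - s * x) / c by field.
  have -> : s / c * (- 1 * x + 0 * y) - (- 0 * x + - 1 * y) = (c * y - s * x) / c by field.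
  have -> : - 1 * x + 0 * y = - x by ring.
  rewrite P1 P2 X0 mulrN; split=> [[/hexagon_scaledP[H1 H2 [H3 H4 H5 H6]] [H7 H8]]|[H1 H2 H3]].
    by split => //; lra.
  split; last by split; lra.
  by apply/hexagon_scaledP; case: sx => -[S1 S2]; split; try split; lra.
- have -> : - - gm * x + - sg * y + sg / gm * (- sg * x + - gm * y) = (s * x - c * y) / (gm * rho).
    by rewrite /hexs /hexc; field; rewrite ?gne ?rne.
  have -> : sg / gm * (- sg * x + - gm * y) - (- - gm * x + - sg * y) = (- x) / gm.
    by rewrite -[X in _ = (- X) / _]mul1r -sg2gm2; field.
  have -> : - sg * x + - gm * y = sg * - x + gm * - y by ring.
  rewrite P3 P6 slanted_sideE !mulrN; split=> [[/hexagon_scaledP[H1 H2 [H3 H4 H5 H6]] [H7 H8]]|[H1 H2 H3]].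
    by split => //; lra.
  split; last by split; lra.
  by apply/hexagon_scaledP; case: sx => -[S1 S2]; split; try split; lra.
- have -> : - - gm * x + sg * y + sg / gm * (sg * x + - gm * y) = x / gm.
    by rewrite -[X in _ = X / _]mul1r -sg2gm2; field.
  have -> : sg / gm * (sg * x + - gm * y) - (- - gm * x + sg * y) = (- (c * y) - s * x) / (gm * rho).
    by rewrite /hexs /hexc; field; rewrite ?gne ?rne.
  have -> : sg * x + - gm * y = sg * x + gm * - y by ring.
  rewrite P5 P4 slanted_sideE !mulrN; split=> [[/hexagon_scaledP[H1 H2 [H3 H4 H5 H6]] [H7 H8]]|[H1 H2 H3]].
    by split => //; lra.
  split; last by split; lra.
  by apply/hexagon_scaledP; case: sx => -[S1 S2]; split; try split; lra.
Qed.

End HexagonSectors.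

(** * Area, first moment and angles of the hexagon *)
Section HexagonArea.
Context {R : realType}.
Variables (rho sg gm : R).
Hypotheses (rho0 : 0 < rho) (sg0 : 0 < sg) (sg_gm : sg < gm)
  (sg2gm2 : sg ^+ 2 + gm ^+ 2 = 1).

Local Notation c := (hexc rho sg gm).
Local Notation s := (hexs rho sg gm).
Local Notation h := (hexh rho gm).
Local Notation hexagon := (hexagon rho sg gm).
Local Notation hexcell := (hexcell rho sg gm).
Local Notation hexsector := (hexsector rho sg gm).
Local Notation hexrot := (hexrot sg gm).
Local Notation hexwedge := (hexwedge rho sg gm).

Let c0 : 0 < c. Proof. exact: hexc_gt0. Qed.
Let s0 : 0 < s. Proof. exact: hexs_gt0. Qed.
Let gm0 : 0 < gm. Proof. exact: lt_trans sg_gm. Qed.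

Lemma measurable_hexagon : measurable hexagon.
Proof.
have mnorm (k : plane R -> R) : measurable_fun setT k ->
    measurable_fun setT (fun p => `|k p|).
  by move=> mk; exact: (measurableT_comp _ mk).
apply: measurableI; apply: measurable_le_set => //.
  exact: mnorm.
by apply: measurable_funD; apply: measurable_funM => //; exact: mnorm.
Qed.

Lemma measurable_hexwedge j : measurable (hexwedge j).
Proof. by case: j => [|[|[|[|j]]]]; exact: measurable_wedge. Qed.

Lemma measurable_hexsector j : measurable (hexagon `&` hexsector j).
Proof.
rewrite hexsector_wedge// -[X in measurable X]setTI.
have [mrot _] := preserves_leb2_rot _ _ (hexrot_norm _ _ sg2gm2 j).
by apply: mrot => //; exact: measurable_hexwedge.
Qed.

Lemma leb2_set1 (p : plane R) : leb2 [set p] = 0%E.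
Proof.
have mp : measurable ([set p] : set (plane R)).
  rewrite (_ : [set p] = [set p.1] `*` [set p.2]); first exact: measurableX.
  by apply/seteqP; split => -[x y] /=; [move=> <-|case: p => a b /= [-> ->]].
apply: (subset_measure0 mp _ _ (leb2_vertical_line p.1)).
  rewrite (_ : [set p | _] = [set p.1] `*` setT); first exact: measurableX.
  by apply/seteqP; split => -[x y] /=; tauto.
by move=> x ->.
Qed.

(** Up to its center the hexagon is the disjoint union of its six sectors, and
    the rotations that take them to wedges preserve the area and [f]. *)
Lemma integral_hexagon (f : plane R -> R) : measurable_fun setT f ->
  (forall p, 0 <= f p) -> (forall j p, f (rot (hexrot j).1 (hexrot j).2 p) = f p) ->
  (\int[leb2]_(p in hexagon) (f p)%:E =
   \sum_(j <- iota 0 6) \int[leb2]_(p in hexwedge j) (f p)%:E)%E.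
Proof.
move=> mf f0 frot.
have mfE D : measurable_fun D (EFin \o f).
  by apply: measurable_funTS; exact/measurable_EFinP.
have mO : measurable ([set (0, 0)] : set (plane R)).
  rewrite (_ : [set _] = [set 0] `*` [set 0]); first exact: measurableX.
  by apply/seteqP; split => -[x y] /= [-> ->].
rewrite (ge0_negligible_integral mO measurable_hexagon (mfE _) _ (leb2_set1 _)); last first.
  by move=> p _; rewrite lee_fin.
have -> : hexagon `\ (0, 0) = \big[setU/set0]_(j <- iota 0 6) (hexagon `&` hexsector j).
  rewrite -bigcup_seq; apply/seteqP; split => -[x y] /=.
    move=> [Hxy N].
    have sc0 (k a : R) : 0 < k -> (k * a == 0) = (a == 0).
      by move=> k0; rewrite mulf_eq0 gt_eqF.
    have /sector_cover : s * x != 0 \/ c * y != 0.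
      have [x0|x0] := eqVneq x 0; last by left; rewrite sc0.
      have [y0|y0] := eqVneq y 0; last by right; rewrite sc0.
      by case: N; rewrite x0 y0.
    case=> [H|H|[H|H|H|H]]; [exists 0%N|exists 1%N|exists 2|exists 3|exists 4|exists 5] => //.
  move=> [j _ [Hxy Sj]]; split => // -[x0 y0].
  by move: Sj; rewrite /hexsector /= x0 y0 !mulr0 => /sector_neq0.
rewrite ge0_integral_bigsetU //.
- apply: eq_bigr => j _; rewrite hexsector_wedge//.
  have prot := preserves_leb2_rot _ _ (hexrot_norm _ _ sg2gm2 j).
  have f0E p : (0 <= (f p)%:E)%E by rewrite lee_fin.
  rewrite -[RHS](preserves_leb2_integral _ _ (EFin \o f) prot
     (measurable_hexwedge j) (mfE _) f0E).
  by apply: eq_integral => p _ /=; rewrite frot.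
- by move=> j; exact: measurable_hexsector.
- have lt6 k : [set` iota 0 6] k -> (k < 6)%N by rewrite /mkset mem_iota.
  apply/trivIsetP => i j /lt6 i6 /lt6 j6 ij; apply/seteqP; split => // -[x y] [[_ +] [_ +]].
  move=> Si Sj.
  by move: ij; rewrite (sector_disjoint _ _ _ _ i6 j6 Si Sj) eqxx.
- by move=> p _; rewrite lee_fin.
Qed.

Lemma leb2_hexagon : leb2 hexagon = (2 * c * h)%:E.
Proof.
rewrite -[LHS]mul1e -integral_cst; last exact: measurable_hexagon.
rewrite (integral_hexagon (fun=> 1)) // !big_cons big_nil /=.
have t1 : 0 <= s / c by rewrite divr_ge0 ?ltW.
have t2 : 0 <= sg / gm by rewrite divr_ge0 ?ltW.
have gr : 0 <= gm * rho by rewrite mulr_ge0 ?ltW.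
have W H t : 0 <= H -> 0 <= t ->
    (\int[leb2]_(p in wedge H t) 1 = (t * H ^+ 2)%:E :> \bar R)%E.
  move=> H0 t0; rewrite integral_cst; last exact: measurable_wedge.
  by rewrite mul1e [LHS]leb2_wedge.
rewrite !W ?(ltW c0)// adde0 -!EFinD; congr (_%:E).
rewrite (hexhE rho sg gm sg2gm2).
transitivity (2 * c * s + 2 * (2 * rho * sg * gm) * rho).
  by field; rewrite !gt_eqF.
by rewrite -/c; ring.
Qed.

End HexagonArea.

Section HexagonTrigo.
Context {R : realType}.
Variables (rho alpha beta : R).
Hypotheses (rho0 : 0 < rho) (beta0 : 0 < beta) (betapi : beta < pi / 4)
  (alphaE : alpha = pi / 2 - 2 * beta).

Lemma cos_alpha : cos alpha = 2 * sin beta * cos beta.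
Proof.
rewrite alphaE -cosN opprB cosBpihalf mulr_natl sin_mulr2n -mulr_natl; ring.
Qed.

Lemma sin_alpha : sin alpha = cos beta ^+ 2 - sin beta ^+ 2.
Proof.
rewrite alphaE -[LHS]opprK -sinN opprB sinBpihalf opprK mulr_natl cos_mulr2n.
by rewrite -mulr_natl sin2cos2; ring.
Qed.

Lemma hexc_cos : hexc rho (sin beta) (cos beta) = rho * cos alpha.
Proof. by rewrite cos_alpha /hexc; ring. Qed.

Lemma hexs_sin : hexs rho (sin beta) (cos beta) = rho * sin alpha.
Proof. by rewrite sin_alpha. Qed.

Lemma sin_beta_gt0 : 0 < sin beta.
Proof.
have pi0 := pi_gt0 R; have b0 := beta0; have b1 := betapi.
by apply: sin_gt0_pihalf; apply/andP; split; lra.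
Qed.

Lemma sin_lt_cos_beta : sin beta < cos beta.
Proof.
have pi0 := pi_gt0 R; have b0 := beta0; have b1 := betapi; have aE := alphaE.
rewrite -subr_gt0 -(@pmulr_rgt0 _ (cos beta + sin beta)); last first.
  rewrite addr_gt0 ?sin_beta_gt0//; apply: cos_gt0_pihalf; apply/andP; split; lra.
have -> : (cos beta + sin beta) * (cos beta - sin beta) = sin alpha.
  by rewrite sin_alpha; ring.
by apply: sin_gt0_pihalf; apply/andP; split; lra.
Qed.

Lemma sin2Dcos2 : sin beta ^+ 2 + cos beta ^+ 2 = 1.
Proof. by rewrite addrC cos2Dsin2. Qed.

(** The integral over the hexagon of the distance to its center: two triangles of
    half angle [alpha] and height [rho * cos alpha], and four of half angle [beta]
    and height [rho * cos beta]. *)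
Definition hexmoment : R :=
  rho ^+ 3 / 3 * (2 * (cos alpha * sin alpha + cos alpha ^+ 3 * logtan alpha) +
                  4 * (cos beta * sin beta + cos beta ^+ 3 * logtan beta)).

Lemma integral_norm_hexagon :
  (\int[leb2]_(p in hexagon rho (sin beta) (cos beta)) (enorm p)%:E =
   hexmoment%:E)%E.
Proof.
have pi0 := pi_gt0 R; have b0 := beta0; have b1 := betapi; have aE := alphaE.
have c0 := hexc_gt0 _ _ _ rho0 sin_beta_gt0 sin_lt_cos_beta.
have cb0 : 0 < cos beta by exact: lt_trans sin_beta_gt0 sin_lt_cos_beta.
have ca0 : 0 < cos alpha by move: c0; rewrite hexc_cos pmulr_rgt0.
rewrite (integral_hexagon rho (sin beta) (cos beta) rho0 sin_beta_gt0
  sin_lt_cos_beta sin2Dcos2) //.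
- rewrite !big_cons big_nil /= hexc_cos hexs_sin.
  have -> : rho * sin alpha / (rho * cos alpha) = tan alpha.
    by rewrite /tan; field; rewrite !gt_eqF.
  have H1 : 0 <= rho * cos alpha by rewrite mulr_ge0 ?ltW.
  have H2 : 0 <= cos beta * rho by rewrite mulr_ge0 ?ltW.
  have H3 : 0 <= alpha < pi / 2 by apply/andP; split; lra.
  have H4 : 0 <= beta < pi / 2 by apply/andP; split; lra.
  rewrite -/(tan beta) !integral_norm_wedge//.
  rewrite adde0 -!EFinD; congr (_%:E); rewrite /hexmoment.
  by field; rewrite !gt_eqF.
- exact: measurable_enorm.
- by move=> p; exact: sqrtr_ge0.
- by move=> j p; rewrite enorm_rot// hexrot_norm// sin2Dcos2.
Qed.

Lemma hexcell_preimage sg gm (p : plane R) : hexcell rho sg gm p =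
  (fun x : plane R => (x.1 + (- p.1), x.2 + (- p.2))) @^-1` (hexagon rho sg gm).
Proof. by []. Qed.

Lemma measurable_hexcell (p : plane R) :
  measurable (hexcell rho (sin beta) (cos beta) p).
Proof.
have [mt _] := preserves_leb2_translation (- p.1, - p.2).
rewrite hexcell_preimage -[X in measurable X]setTI; apply: mt => //.
exact: measurable_hexagon.
Qed.

Lemma leb2_hexcell (p : plane R) :
  leb2 (hexcell rho (sin beta) (cos beta) p) =
  (2 * hexc rho (sin beta) (cos beta) * hexh rho (cos beta))%:E.
Proof.
have [_ pt] := preserves_leb2_translation (- p.1, - p.2).
rewrite -(leb2_hexagon _ _ _ rho0 sin_beta_gt0 sin_lt_cos_beta sin2Dcos2).
by rewrite -(pt _ (measurable_hexagon _ _ _)) hexcell_preimage.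
Qed.

Lemma integral_edist_hexcell (p : plane R) :
  (\int[leb2]_(x in hexcell rho (sin beta) (cos beta) p) (edist p x)%:E =
   hexmoment%:E)%E.
Proof.
have pt := preserves_leb2_translation (- p.1, - p.2).
rewrite -integral_norm_hexagon.
have mE : measurable_fun setT (EFin \o enorm : plane R -> \bar R).
  by apply/measurable_EFinP; exact: measurable_enorm.
have E0 (x : plane R) : (0 <= (EFin \o enorm) x)%E by rewrite /= lee_fin; exact: sqrtr_ge0.
by rewrite -[RHS](preserves_leb2_integral _ _ _ pt (measurable_hexagon _ _ _) mE E0).
Qed.

Lemma hexcell_apex_angle (p : plane R) (j : 'I_6) :
  apex_angle p (hexvertices rho (sin beta) (cos beta) p) j =
  if j \in [set @Ordinal 6 0 isT; @Ordinal 6 3 isT]%SET then 2 * alpha else 2 * beta.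
Proof.
have pi0 := pi_gt0 R; have b0 := beta0; have b1 := betapi; have aE := alphaE.
rewrite /apex_angle /angle -![enorm (vec _ _)]/(edist _ _).
rewrite !edist_hexvertices//; try exact: sin2Dcos2.
rewrite /hexvertices /vec /dot /= ![_ + _ - _]addrAC !subrr !add0r.
have r0 : rho != 0 by rewrite gt_eqF.
have c2a : cos (2 * alpha) = cos alpha ^+ 2 - sin alpha ^+ 2.
  by rewrite mulr_natl cos_mulr2n -mulr_natl sin2cos2; ring.
have c2b : cos (2 * beta) = sin alpha.
  by rewrite sin_alpha mulr_natl cos_mulr2n -mulr_natl sin2cos2; ring.
have Ka : acos (cos (2 * alpha)) = 2 * alpha.
  by apply: cosK; rewrite in_itv /=; apply/andP; split; lra.
have Kb : acos (cos (2 * beta)) = 2 * beta.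
  by apply: cosK; rewrite in_itv /=; apply/andP; split; lra.
rewrite !inE -!val_eqE /=.
case: j => -[|[|[|[|[|[|//]]]]]] ? /=; rewrite ?hexc_cos ?hexs_sin.
- by rewrite -[RHS]Ka c2a; congr acos; field.
- by rewrite -[RHS]Kb c2b; congr acos; field.
- by rewrite -[RHS]Kb c2b; congr acos; field.
- by rewrite -[RHS]Ka c2a; congr acos; field.
- by rewrite -[RHS]Kb c2b; congr acos; field.
- by rewrite -[RHS]Kb c2b; congr acos; field.
Qed.

End HexagonTrigo.

(** * The honeycomb and its lattice of centers *)
Section Lattice.
Context {R : realType}.
Variables (rho sg gm : R).
Hypotheses (rho0 : 0 < rho) (sg0 : 0 < sg) (sg_gm : sg < gm)
  (sg2gm2 : sg ^+ 2 + gm ^+ 2 = 1).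

Let gm0 : 0 < gm. Proof. exact: lt_trans sg_gm. Qed.
Local Notation c := (hexc rho sg gm).
Local Notation s := (hexs rho sg gm).
Local Notation h := (hexh rho gm).
Local Notation hexagon := (hexagon rho sg gm).
Local Notation hexcell := (hexcell rho sg gm).

Let c0 : 0 < c. Proof. exact: hexc_gt0. Qed.
Let h0 : 0 < h. Proof. exact: (hexh_gt0 _ sg). Qed.
Let s0 : 0 < s. Proof. exact: hexs_gt0. Qed.
Let sr : s < rho. Proof. exact: hexs_lt. Qed.

(** The horizontal rows [j] of the lattice are [h] apart and shifted by half a
    period [c] from one to the next. *)
Definition lattice_point (i j : int) : plane R :=
  (c * (2 * i%:~R + j%:~R), h * j%:~R).

Definition lattice : set (plane R) := [set lattice_point i j | i in setT & j in setT].

Lemma lattice_point_in i j : lattice (lattice_point i j).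
Proof. by exists i => //; exists j. Qed.

Lemma lattice_point_inj i j i' j' :
  lattice_point i j = lattice_point i' j' -> i = i' /\ j = j'.
Proof.
move=> [/(mulfI (lt0r_neq0 c0)) H1 /(mulfI (lt0r_neq0 h0)) H2].
move/eqP : (H2); rewrite eqr_int => /eqP jj; split => //.
move: H1; rewrite H2 => /addIr /(mulfI (lt0r_neq0 (ltr0n R 2))) => /eqP.
by rewrite eqr_int => /eqP.
Qed.

Lemma infinite_lattice : infinite_set lattice.
Proof.
pose f (n : nat) := lattice_point n%:Z 0.
have fI : {in [set: nat] &, injective f}.
  by move=> m n _ _ /lattice_point_inj[[->]].
move=> fin; apply: infinite_nat; rewrite -(eq_finite_set (inj_card_eq fI)).
by apply: sub_finite_set fin => _ [n _ <-]; exact: lattice_point_in.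
Qed.

Lemma norm_coord_le_enorm (u : plane R) : `|u.1| <= enorm u /\ `|u.2| <= enorm u.
Proof.
rewrite -!sqrtr_sqr /enorm /dot -!expr2.
by split; apply: ler_wsqrtr; rewrite ?lerDl ?lerDr sqr_ge0.
Qed.

Lemma lattice_locally_finite (t : R) : finite_set (lattice `&` eball (0, 0) t).
Proof.
pose M := Num.bound (`|t| / h + `|t| / c).
pose ints := [seq k%:Z - M%:Z | k <- iota 0 (M + M).+1].
have intsP (i : int) : `|i%:~R : R| <= M%:R -> i \in ints.
  rewrite -intr_norm -[M%:R]/(M%:Z%:~R) ler_int ler_norml => /andP[H1 H2].
  apply/mapP; exists (absz (i + M%:Z)); last by lia.
  by rewrite mem_iota /=; lia.
apply: (@sub_finite_set _ _ [set lattice_point i j | i in [set` ints] & j in [set` ints]]);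
  last by apply: finite_image2.
move=> _ [[i _ [j _ <-]]]; rewrite /eball /= => ht.
have [H1 H2] := norm_coord_le_enorm (vec (0, 0) (lattice_point i j)).
have {}H1 := le_lt_trans H1 ht; have {}H2 := le_lt_trans H2 ht.
move: H1 H2; rewrite /vec /lattice_point /= !subr0 (normrM c) (normrM h) (gtr0_norm c0) (gtr0_norm h0).
rewrite -!ltr_pdivlMl// ![_^-1 * t]mulrC => H1 H2.
have tt := ler_norm t.
have t1 : t / c <= `|t| / c by rewrite ler_pM2r ?invr_gt0.
have t2 : t / h <= `|t| / h by rewrite ler_pM2r ?invr_gt0.
have t3 : 0 <= `|t| / c by rewrite divr_ge0// ltW.
have t4 : 0 <= `|t| / h by rewrite divr_ge0// ltW.
have MB : `|t| / h + `|t| / c < M%:R.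
  by apply: archi_boundP; rewrite addr_ge0.
have tri : 2 * `|i%:~R : R| <= `|2 * i%:~R + j%:~R| + `|j%:~R : R|.
  have := ler_normB (2 * i%:~R + j%:~R) (j%:~R : R).
  by rewrite addrK normrM ger0_norm.
have i0 := normr_ge0 (i%:~R : R).
by exists i; [apply: intsP; lra|exists j => //; apply: intsP; lra].
Qed.

(** The coordinates [2 i + j] and [j] are integers of the same parity. *)
Lemma lattice_parity (i j : int) (a b : R) :
  a = `|2 * i%:~R + j%:~R| -> b = `|j%:~R| ->
  [/\ 0 <= a ^+ 2 - 2 * a + b, 0 <= b ^+ 2 - b &
      2 * b <= b ^+ 2 \/ (b = 1 /\ 1 <= a ^+ 2)].
Proof.
pose m := absz (2 * i + j); pose n := absz j.
have -> : `|2 * i%:~R + j%:~R| = m%:R :> R.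
  by rewrite -[m%:R]/(m%:Z%:~R) abszE intr_norm rmorphD rmorphM.
have -> : `|j%:~R| = n%:R :> R by rewrite -[n%:R]/(n%:Z%:~R) abszE intr_norm.
move=> -> ->.
have H1 : (2 * m <= m ^ 2 + n)%N.
  case: (posnP m) => [->//|m0]; case: (ltnP 1 m) => m1.
    by apply: leq_trans (leq_addr _ _); rewrite expnS expn1 leq_mul2r m1 orbT.
  have -> : m = 1%N by lia.
  by have : (0 < n)%N; lia.
have H2 : (n <= n ^ 2)%N.
  by case: (posnP n) => [->//|n0]; rewrite expnS expn1 leq_pmull.
have H3 : (2 * n <= n ^ 2)%N \/ (n = 1%N /\ (1 <= m ^ 2)%N).
  case: (ltnP 1 n) => n1; first by left; rewrite expnS expn1 leq_mul2r n1 orbT.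
  case: (posnP n) => [->|n0]; first by left.
  right; split; first by lia.
  by rewrite expn_gt0; lia.
split.
- by rewrite -(ler_nat R) natrD natrM natrX in H1; lra.
- by rewrite -(ler_nat R) natrX in H2; lra.
- case: H3 => [H3|[-> H3]]; [left|right].
    by rewrite -(ler_nat R) natrM natrX in H3.
  by rewrite -(ler_nat R) natrX in H3.
Qed.

(** A linear form on the hexagon is largest at a vertex, so the comparison with
    the lattice point of coordinates [(c a, h b)] reduces to the vertices
    [(c, s)] and [(0, rho)]. *)
Lemma hexagon_voronoi0 (x y : R) (i j : int) : hexagon (x, y) ->
  enorm (x, y) <= edist (lattice_point i j) (x, y).
Proof.
move=> [/= xc xy].
rewrite /edist /enorm; apply: ler_wsqrtr; rewrite /dot /vec /lattice_point /=.
set A := 2 * i%:~R + j%:~R; set B := j%:~R : R.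
have [H1 H2 H3] := lattice_parity i j `|A| `|B| erefl erefl.
suff K : 2 * (`|x| * (c * `|A|) + `|y| * (h * `|B|)) <= (c * `|A|) ^+ 2 + (h * `|B|) ^+ 2.
  have N1 : x * (c * A) <= `|x| * (c * `|A|).
    by apply: le_trans (ler_norm _) _; rewrite normrM (normrM c) (gtr0_norm c0).
  have N2 : y * (h * B) <= `|y| * (h * `|B|).
    by apply: le_trans (ler_norm _) _; rewrite normrM (normrM h) (gtr0_norm h0).
  rewrite (exprMn 2 c) (exprMn 2 h) !real_normK ?num_real// in K.
  have E : (x - c * A) * (x - c * A) + (y - h * B) * (y - h * B) =
    x * x + y * y + (c ^+ 2 * A ^+ 2 + h ^+ 2 * B ^+ 2) - 2 * (x * (c * A) + y * (h * B)).
    by ring.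
  by rewrite E; lra.
set a := `|A| in H1 H2 H3 *; set b := `|B| in H1 H2 H3 *.
have a0 : 0 <= a by exact: normr_ge0.
have b0 : 0 <= b by exact: normr_ge0.
pose t := `|x| / c.
have t0 : 0 <= t by rewrite divr_ge0// ltW.
have t1 : t <= 1 by rewrite ler_pdivrMr// mul1r.
have xt : `|x| = c * t by rewrite /t; field; rewrite gt_eqF.
have yt : `|y| <= (1 - t) * rho + t * s.
  rewrite -(ler_pM2l gm0); apply: (@le_trans _ _ (gm * rho - sg * `|x|)).
    by rewrite lerBrDr addrC.
  by rewrite xt mulrA (sg_hexc rho sg gm sg2gm2) le_eqVlt; apply/orP; left; apply/eqP; ring.
have s2 : 0 < sg ^+ 2 by rewrite exprn_gt0.
have g2 : 0 < gm ^+ 2 by rewrite exprn_gt0.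
have sg2 : sg ^+ 2 < gm ^+ 2 by rewrite ltr_sqr ?nnegrE ?ltW.
have v1 : 2 * (sg ^+ 2 * a) + (gm ^+ 2 - sg ^+ 2) * b <= sg ^+ 2 * a ^+ 2 + gm ^+ 2 * b ^+ 2.
  have := mulr_ge0 (ltW s2) H1; have := mulr_ge0 (ltW g2) H2; lra.
have v2 : b <= sg ^+ 2 * a ^+ 2 + gm ^+ 2 * b ^+ 2.
  have nn := mulr_ge0 (ltW s2) (sqr_ge0 a).
  have half : 1 <= 2 * gm ^+ 2 by have := sg2gm2; lra.
  case: H3 => [H3|[-> H3]].
    have := ler_wpM2l (ltW g2) H3; have := ler_wpM2r b0 half; lra.
  have := ler_wpM2l (ltW s2) H3; have := sg2gm2; lra.
have E1 : (c * a) ^+ 2 + (h * b) ^+ 2 =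
    2 * rho * h * (sg ^+ 2 * a ^+ 2 + gm ^+ 2 * b ^+ 2).
  by rewrite /hexc /hexh; ring.
have rh : 0 < 2 * rho * h by rewrite mulr_gt0// mulr_gt0.
have w1 := ler_wpM2l (mulr_ge0 t0 (ltW rh)) v1.
have w2 : 0 <= 1 - t by rewrite subr_ge0.
have {}w2 := ler_wpM2l (mulr_ge0 w2 (ltW rh)) v2.
have w3 : `|y| * (h * b) <= ((1 - t) * rho + t * s) * (h * b).
  by apply: ler_wpM2r => //; rewrite mulr_ge0// ltW.
rewrite xt E1.
have E2 : 2 * (c * t * (c * a)) + 2 * (((1 - t) * rho + t * s) * (h * b)) =
   t * (2 * rho * h) * (2 * (sg ^+ 2 * a) + (gm ^+ 2 - sg ^+ 2) * b) +
   (1 - t) * (2 * rho * h) * b.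
  by rewrite /hexc /hexh /hexs; ring.
rewrite mulrDr; apply: (@le_trans _ _ (2 * (c * t * (c * a)) + 2 * (((1 - t) * rho + t * s) * (h * b)))).
  by rewrite lerD2l ler_pM2l.
rewrite E2; apply: le_trans (lerD w1 w2) _.
by rewrite -mulrDl -mulrDl [t + _]addrC subrK mul1r.
Qed.

Lemma lattice_point_sub i j i' j' (x : plane R) :
  vec (lattice_point i j) x = vec (lattice_point (i - i') (j - j'))
   (vec (lattice_point i' j') x).
Proof.
by rewrite /vec /lattice_point /= !rmorphB /=; congr pair; ring.
Qed.

Lemma hexcell_voronoi (p q x : plane R) : lattice p -> lattice q -> hexcell p x ->
  edist p x <= edist q x.
Proof.
move=> [i' _ [j' _ <-]] [i _ [j _ <-]] Hx.
rewrite [leRHS]/Defs.edist (lattice_point_sub i j i' j').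
exact: hexagon_voronoi0.
Qed.

(** The overlap lies on the perpendicular bisector of [p] and [q]. *)
Lemma hexcell_overlap (p q : plane R) : lattice p -> lattice q -> p <> q ->
  measurable (hexcell p) -> measurable (hexcell q) ->
  leb2 (hexcell p `&` hexcell q) = 0%E.
Proof.
move=> lp lq pq mp mq.
pose L := [set x : plane R | (2 * (q.1 - p.1)) * x.1 + (2 * (q.2 - p.2)) * x.2 =
   q.1 ^+ 2 + q.2 ^+ 2 - (p.1 ^+ 2 + p.2 ^+ 2)].
have L0 : leb2 L = 0%E.
  apply: leb2_line; apply/negP => /eqP[/eqP].
  rewrite mulf_eq0 pnatr_eq0/= subr_eq0 => /eqP E1 /eqP.
  rewrite mulf_eq0 pnatr_eq0/= subr_eq0 => /eqP E2.
  by apply: pq; case: p E1 E2 {lp mp L} => a b; case: q {lq mq} => a' b' /= -> ->.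
apply: (subset_measure0 _ _ _ L0).
- exact: measurableI.
- rewrite (_ : L = (fun x : plane R => 2 * (q.1 - p.1) * x.1 + 2 * (q.2 - p.2) * x.2) @^-1`
    [set q.1 ^+ 2 + q.2 ^+ 2 - (p.1 ^+ 2 + p.2 ^+ 2)]); last by [].
  rewrite -[X in measurable X]setTI.
  have : measurable_fun setT
    (fun x : plane R => 2 * (q.1 - p.1) * x.1 + 2 * (q.2 - p.2) * x.2).
    by apply: measurable_funD; apply: measurable_funM.
  by apply => //; exact: measurable_set1.
- move=> x [px qx].
  have : edist p x = edist q x.
    by apply/le_anti/andP; split; exact: hexcell_voronoi.
  rewrite /Defs.edist /enorm /dot /vec /=.
  have sq (a b : R) : 0 <= a * a + b * b by rewrite -!expr2 addr_ge0// sqr_ge0.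
  move=> /(congr1 (fun z : R => z ^+ 2)); rewrite !sqr_sqrtr// /L /= => E.
  apply/eqP; rewrite -subr_eq0; apply/eqP.
  transitivity (((x.1 - p.1) * (x.1 - p.1) + (x.2 - p.2) * (x.2 - p.2)) -
     ((x.1 - q.1) * (x.1 - q.1) + (x.2 - q.2) * (x.2 - q.2))); first by ring.
  by rewrite E subrr.
Qed.

(** A point between two consecutive rows that is too high for the cell of the
    lower row lies in a cell of the upper row, because the upper boundary of one
    row of cells is the lower boundary of the next one. *)
Lemma hexcell_cover (x : plane R) : exists i j : int, hexcell (lattice_point i j) x.
Proof.
case: x => x y.
pose j := Num.floor (y / h).
pose i := Num.floor ((x - c * j%:~R) / (2 * c) + 2^-1).
have /andP[j1 j2] := floor_itv (y / h); rewrite -/j in j1 j2.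
have /andP[i1 i2] := floor_itv ((x - c * j%:~R) / (2 * c) + 2^-1); rewrite -/i in i1 i2.
rewrite intrD in j2; rewrite intrD in i2.
pose u := x - c * (2 * i%:~R + j%:~R); pose v := y - h * j%:~R.
have cc : 0 < 2 * c by rewrite mulr_gt0.
have v0 : 0 <= v by rewrite /v subr_ge0 mulrC -ler_pdivlMr.
have vh : v < h.
  by rewrite /v ltrBlDl -[X in _ + X]mulr1 -mulrDr mulrC -ltr_pdivrMr.
have u1 : - c <= u.
  move: i1; rewrite -lerBlDr ler_pdivlMr// /u; lra.
have u2 : u < c.
  move: i2; rewrite -ltrBrDr ltr_pdivrMr// /u; lra.
have hE := hexhE rho sg gm sg2gm2.
have r0 := rho0; have srr := sr; have ss0 := s0; have cp := c0.
have ur1 : - (c * rho) <= rho * u.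
  by rewrite -mulNr [_ * rho]mulrC ler_pM2l.
have ur2 : rho * u <= c * rho.
  by rewrite [c * rho]mulrC ler_pM2l// ltW.
have ch : c * h = c * rho + c * s by rewrite hE; ring.
have cv : 0 <= c * v by rewrite mulr_ge0// ltW.
have cvh : c * v <= c * h by rewrite ler_pM2l// ltW.
have us : [\/ 0 <= s * u /\ s * u <= rho * u | s * u <= 0 /\ rho * u <= s * u].
  have [u0|u0] := leP 0 u; [left|right].
    by rewrite mulr_ge0 ?(ltW ss0)// ler_wpM2r// ltW.
  by rewrite pmulr_rle0// ler_wnM2r// ltW.
have us1 : s * u <= c * s by rewrite mulrC ler_pM2r// ltW.
have us2 : - (c * s) <= s * u by rewrite -mulNr [_ * s]mulrC ler_pM2l.
have cs0 : 0 <= c * s by rewrite mulr_ge0 ?(ltW cp) ?(ltW ss0).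
have csr : c * s <= c * rho by rewrite ler_pM2l// ltW.
have rs : 0 <= rho - s by rewrite subr_ge0 ltW.
have ru1 := ler_wpM2l rs (ltW u2).
have ru2 := ler_wpM2l rs u1.
have [low|high] := leP (`|rho * u - s * u| + c * v) (c * rho).
  exists i, j; apply/hexagon_scaledP => //.
  rewrite -/u -/v; have := low; case: us => -[S1 S2].
    rewrite ger0_norm; last by lra.
    by split; try split; lra.
  rewrite ler0_norm; last by lra.
  by split; try split; lra.
case: us high => -[S1 S2]; [rewrite ger0_norm; last by lra|rewrite ler0_norm; last by lra]; move=> high.
  exists i, (j + 1); apply/hexagon_scaledP => //=.
  rewrite intrD.
  have -> : x - c * (2 * i%:~R + (j%:~R + 1)) = u - c by rewrite /u; ring.
  have -> : y - h * (j%:~R + 1) = v - h by rewrite /v; ring.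
  by split; try split; lra.
exists (i - 1), (j + 1); apply/hexagon_scaledP => //=.
rewrite !intrD.
have -> : x - c * (2 * (i%:~R + (-1)%:~R) + (j%:~R + 1)) = u + c by rewrite /u; ring.
have -> : y - h * (j%:~R + 1) = v - h by rewrite /v; ring.
by split; try split; lra.
Qed.

End Lattice.

(** * Euclidean discs *)
Section Disc.
Context {R : realType}.
Implicit Types u v p : plane R.

Lemma enorm_ge0 u : 0 <= enorm u. Proof. exact: sqrtr_ge0. Qed.

Lemma enorm_sqr u : enorm u ^+ 2 = u.1 ^+ 2 + u.2 ^+ 2.
Proof. by rewrite /enorm /dot -!expr2 sqr_sqrtr// addr_ge0// sqr_ge0. Qed.

Lemma enorm_triangle u v : enorm (u.1 + v.1, u.2 + v.2) <= enorm u + enorm v.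
Proof.
rewrite -ler_sqr ?nnegrE ?addr_ge0 ?enorm_ge0//.
rewrite sqrrD !enorm_sqr /=.
have CS : u.1 * v.1 + u.2 * v.2 <= enorm u * enorm v.
  apply: le_trans (ler_norm _) _.
  rewrite -ler_sqr ?nnegrE ?normr_ge0 ?mulr_ge0 ?enorm_ge0//.
  rewrite real_normK ?num_real// exprMn !enorm_sqr -subr_ge0.
  rewrite (_ : _ - _ = (u.1 * v.2 - u.2 * v.1) ^+ 2); last by ring.
  exact: sqr_ge0.
rewrite -subr_ge0 (_ : _ - _ = 2 * (enorm u * enorm v - (u.1 * v.1 + u.2 * v.2))).
  by rewrite mulr_ge0// subr_ge0.
by rewrite -mulr_natl; ring.
Qed.

Lemma enorm_le_add (a b : R) : enorm (a, b) <= `|a| + `|b|.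
Proof.
rewrite -ler_sqr ?nnegrE ?addr_ge0 ?enorm_ge0 ?normr_ge0// enorm_sqr /=.
rewrite sqrrD !real_normK ?num_real//.
have : 0 <= `|a| * `|b| by rewrite mulr_ge0.
by rewrite -mulr_natl; lra.
Qed.

Lemma edist_triangle p q x : edist p x <= edist p q + edist q x.
Proof.
apply: le_trans (enorm_triangle (vec p q) (vec q x)).
rewrite le_eqVlt; apply/orP; left; apply/eqP.
by rewrite /Defs.edist /vec /=; congr enorm; congr pair; ring.
Qed.

Lemma edist_sym p q : edist p q = edist q p.
Proof. by rewrite /Defs.edist /enorm /dot /vec /=; congr Num.sqrt; ring. Qed.

Lemma edist_le_norm p q : edist p q <= enorm p + enorm q.
Proof.
have := edist_triangle p (0, 0) q.
rewrite (edist_sym p (0, 0)) /Defs.edist {2 3}/vec /= !subr0.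
by rewrite -!surjective_pairing.
Qed.

Lemma measurable_eball (t : R) : measurable (eball (0, 0) t : set (plane R)).
Proof.
rewrite (_ : eball _ _ = [set x | enorm x < (fun=> t) x]).
  by apply: measurable_lt_set => //; exact: measurable_enorm.
by apply/seteqP; split => -[x y]; rewrite /eball /= /Defs.edist /vec /= !subr0.
Qed.

Definition unit_disc_area : R := fine (leb2 (eball (0, 0) 1 : set (plane R))).

Lemma leb2_square (a b : R) : a <= b ->
  leb2 ([set` `[a, b]] `*` [set` `[a, b]] : set (plane R)) = ((b - a) ^+ 2)%:E.
Proof.
move=> ab; rewrite [LHS]product_measure1E//.
rewrite ![X in (X * _)%E](lebesgue_measure_itv `[a, b]) /= lte_fin.
rewrite [X in (_ * X)%E](lebesgue_measure_itv `[a, b]) /= lte_fin.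
case: ifPn => [_|]; first by rewrite -EFinB -EFinM expr2.
rewrite -leNgt => ba; have -> : a = b by apply/le_anti; rewrite ab ba.
by rewrite mule0 subrr expr0n.
Qed.

Lemma unit_disc_areaE : leb2 (eball (0, 0) 1 : set (plane R)) = unit_disc_area%:E.
Proof.
rewrite fineK// ge0_fin_numE ?measure_ge0//.
apply: (@le_lt_trans _ _ (leb2 ([set` `[(- 1), 1]] `*` [set` `[(- 1), 1]] : set (plane R)))).
  apply: le_measure; rewrite ?inE.
  - exact: measurable_eball.
  - exact: measurableX.
  - move=> [x y]; rewrite /eball /= => H.
    have [H1 H2] := norm_coord_le_enorm (vec (0, 0) (x, y)).
    have {}H1 := ltW (le_lt_trans H1 H); have {}H2 := ltW (le_lt_trans H2 H).
    by move: H1 H2; rewrite /vec /= !subr0 !in_itv/= !ler_norml.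
by rewrite leb2_square ?ltry// lerN1y.
Qed.

Lemma unit_disc_area_gt0 : 0 < unit_disc_area.
Proof.
rewrite -lte_fin -unit_disc_areaE.
apply: (@lt_le_trans _ _ (leb2 ([set` `[0, 2^-1]] `*` [set` `[0, 2^-1]] : set (plane R)))).
  rewrite leb2_square ?invr_ge0// lte_fin subr0 exprn_gt0//.
apply: le_measure; rewrite ?inE.
- exact: measurableX.
- exact: measurable_eball.
- move=> [x y] /=; rewrite !in_itv/= => -[/andP[x0 x1] /andP[y0 y1]].
  rewrite /eball /Defs.edist /vec /= !subr0.
  rewrite -[ltRHS](sqrtr1 R) ltr_sqrt// /dot /=.
  have := ler_pM x0 x0 x1 x1; have := ler_pM y0 y0 y1 y1; lra.
Qed.

(** By scaling from the unit disc. *)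
Lemma leb2_eball (t : R) : 0 <= t ->
  leb2 (eball (0, 0) t : set (plane R)) = (unit_disc_area * t ^+ 2)%:E.
Proof.
rewrite le_eqVlt => /predU1P[<-|t0].
  rewrite (_ : eball _ _ = set0) ?measure0 ?expr0n ?mulr0//.
  by apply/seteqP; split => x //=; rewrite /eball /= ltNge enorm_ge0.
rewrite -(leb2_scale _ _ t0 (measurable_eball t)).
transitivity ((t ^+ 2)%:E * unit_disc_area%:E)%E; last by rewrite -EFinM mulrC.
rewrite -unit_disc_areaE; congr (_ * leb2 _)%E.
apply/seteqP; split => -[x y]; rewrite /eball /Defs.edist /vec /= !subr0.
all: have -> : enorm (t * x, t * y) = t * enorm (x, y).
1,3: apply/eqP; rewrite -(eqrXn2 (n := 2)) ?mulr_ge0 ?enorm_ge0 ?(ltW t0)//; 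
  by apply/eqP; rewrite exprMn !enorm_sqr /=; ring.
all: by rewrite -{2}[t]mulr1 ltr_pM2l.
Qed.

End Disc.

(** * Unions of cells *)
Section CellUnion.
Context {R : realType}.
Variables (rho beta : R).
Hypotheses (rho0 : 0 < rho) (beta0 : 0 < beta) (betapi : beta < pi / 4).
Local Notation sg := (sin beta).
Local Notation gm := (cos beta).
Local Notation c := (hexc rho sg gm).
Local Notation h := (hexh rho gm).
Local Notation point := (fun p : int * int => lattice_point rho sg gm p.1 p.2).
Local Notation cell := (fun p => hexcell rho sg gm (point p)).

Definition cells (t : seq (int * int)) : set (plane R) := \bigcup_(p in [set` t]) cell p.

Let mcell p : measurable (cell p). Proof. exact: measurable_hexcell. Qed.

Lemma cells_cons p t : cells (p :: t) = cell p `|` cells t.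
Proof.
apply/seteqP; split => x.
  by move=> [q /=]; rewrite inE => /predU1P[->|qt] Hq; [left|right; exists q].
move=> [Hp|[q qt Hq]]; first by exists p => //=; rewrite inE eqxx.
by exists q => //=; move: qt => /= qt; rewrite inE qt orbT.
Qed.

Lemma measurable_cells t : measurable (cells t).
Proof. by apply: fin_bigcup_measurable => // p _; exact: mcell. Qed.

Lemma leb2_cells t : uniq t -> leb2 (cells t) = ((size t)%:R * (2 * c * h))%:E.
Proof.
elim: t => [_|p t IH /= /andP[pt ut]].
  by rewrite /cells set_nil bigcup_set0 measure0 mul0r.
rewrite cells_cons.
have I0 : leb2 (cell p `&` cells t) = 0%E.
  elim: t pt {ut IH} => [_|q t IH]; first by rewrite /cells set_nil bigcup_set0 setI0 measure0.
  rewrite inE negb_or => /andP[pq pt]; rewrite cells_cons setIUr.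
  apply/eqP; rewrite -measure_le0.
  have m1 : measurable (cell p `&` cell q) by exact: measurableI.
  have m2 : measurable (cell p `&` cells t).
    by apply: measurableI => //; exact: measurable_cells.
  apply: (le_trans (measureU2 leb2 m1 m2)).
  have H1 : leb2 (cell p `&` cell q) = 0%E.
    apply: hexcell_overlap => //; try exact: lattice_point_in.
    - exact: sin_beta_gt0.
    - exact: sin_lt_cos_beta.
    - exact: sin2Dcos2.
    - move=> /lattice_point_inj H; move/eqP : pq; apply.
      have [//|//|//|E1 E2] := H.
        exact: sin_beta_gt0.
      exact: sin_lt_cos_beta.
      by case: p q E1 E2 {pt H m1 m2 IH} => [? ?] [? ?] /= -> ->.
  by rewrite [X in (X + _)%E]H1 [X in (_ + X)%E](IH pt) adde0.
have mt := measurable_cells t.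
have -> : cell p `|` cells t = cell p `|` (cells t `\` cell p).
  by apply/seteqP; split => x /=; have [px|px] := pselect (cell p x); tauto.
rewrite measureU //; last 2 first.
  by apply: measurableD.
  by apply/seteqP; split => x //= [? []].
have := measureDI leb2 mt (mcell p).
rewrite (setIC _ (cell p)) [X in (_ + X)%E]I0 adde0 => <-.
rewrite [X in (_ + X)%E]IH// [X in (X + _)%E](leb2_hexcell rho _ beta rho0 beta0 betapi erefl).
rewrite -EFinD; congr (_%:E).
by rewrite -(addn1 (size t)) natrD; ring.
Qed.

End CellUnion.

(** * Weights of closed paths *)
Section PathWeight.
Context {R : realType} {T : Type}.
Variable w : T -> T -> R.

Fixpoint path_weight (x : T) (t : seq T) : R :=
  if t is y :: t' then w x y + path_weight y t' else 0.

Lemma path_weight_cat x t1 t2 :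
  path_weight x (t1 ++ t2) = path_weight x t1 + path_weight (last x t1) t2.
Proof. by elim: t1 x => [x|y t1 IH x] /=; rewrite ?add0r// IH addrA. Qed.

Lemma path_weight_map0 (f : nat -> T) (a b : nat) :
  (forall l, w (f l) (f l.+1) = 0) ->
  path_weight (f a) [seq f l | l <- iota a.+1 b] = 0.
Proof. by move=> w0; elim: b a => //= b IH a; rewrite w0 IH addr0. Qed.

Lemma last_map_iota (f : nat -> T) (a b : nat) :
  last (f a) [seq f l | l <- iota a.+1 b] = f (a + b)%N.
Proof. by elim: b a => [a|b IH a] /=; rewrite ?addn0// IH addSnnS. Qed.

(** Rows that are free of charge inside cost only the jumps between them. *)
Lemma path_weight_rows (f : nat -> nat -> T) (len : nat -> nat) (B : R) x (a b : nat) :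
  (forall k l, w (f k l) (f k l.+1) = 0) -> 0 <= B ->
  (forall k, (a <= k)%N -> (k.+1 < a + b)%N -> w (f k (len k)) (f k.+1 0%N) <= B) ->
  path_weight x (flatten [seq [seq f k l | l <- iota 0 (len k).+1] | k <- iota a b])
    <= (if b is 0 then 0 else w x (f a 0%N)) + b%:R * B.
Proof.
move=> w0 B0; elim: b a x => [a x _|b IH a x jump] /=; first by rewrite mul0r addr0.
rewrite path_weight_cat path_weight_map0// add0r last_map_iota add0n lerD2l.
have /IH H : forall k, (a.+1 <= k)%N -> (k.+1 < a.+1 + b)%N ->
    w (f k (len k)) (f k.+1 0%N) <= B.
  by move=> k ak kb; apply: jump; [exact: ltnW|rewrite addnS -addSn].
apply: le_trans (H _) _; rewrite -[b.+1]addn1 natrD mulrDl mul1r [leRHS]addrC lerD2r.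
case: b {IH H} jump => [//|b] jump; apply: jump => //.
by rewrite !addnS !ltnS leq_addr.
Qed.

Lemma sum_cyclic_weight (x : T) (t : seq T) (N : nat) (f : 'I_N -> T) :
  size t = N -> (forall i, f i = nth x t i) ->
  \sum_(i < N) w (f (ord_pred i)) (f i) = path_weight (last x t) t.
Proof.
move=> sz fE.
have K y u : path_weight y u = \sum_(i < size u) w (nth x (y :: u) i) (nth x u i).
  elim: u y => [y|z u IH y] /=; first by rewrite big_ord0.
  by rewrite big_ord_recl /= IH.
rewrite K; case: N f sz fE => [|N] f sz fE; first by rewrite sz !big_ord0.
rewrite sz; apply: eq_bigr => i _; rewrite !fE; congr (w _ _).
case: i => -[|i] iN /=; first by rewrite modn_small// -nth_last sz.
by rewrite modnDr modn_small// ltnW.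
Qed.

End PathWeight.

(** * The boustrophedon tour of a disc *)
Section Tour.
Context {R : realType}.
Variables (rho sg gm : R).
Local Notation c := (hexc rho sg gm).
Local Notation h := (hexh rho gm).

(** The half length, in steps of [2 c] and rounded up, of the chord of height [h j]
    in a disc of radius [h n]. *)
Definition row_half (n : nat) (j : int) : nat :=
  (Num.truncn (h / (2 * c) * Num.sqrt (n%:R ^+ 2 - j%:~R ^+ 2))).+1.

(** The [l]-th stop in the row [k - n], where odd rows are run backwards; the
    shift by [j %/ 2] recentres the skew row. *)
Definition row_stop (n k l : nat) : int * int :=
  let j := k%:Z - n%:Z in
  let m := row_half n j in
  ((if odd k then m%:Z - l%:Z else l%:Z - m%:Z) - (j %/ 2)%Z, j).

Definition row_len (n k : nat) : nat := (2 * row_half n (k%:Z - n%:Z))%N.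

Definition disc_tour (n : nat) : seq (int * int) :=
  flatten [seq [seq row_stop n k l | l <- iota 0 (row_len n k).+1]
          | k <- iota 0 (2 * n)].

(** The stops left over when a disc is full go along the row above it. *)
Definition top_row (n e : nat) : seq (int * int) :=
  [seq (l%:Z, n%:Z) | l <- iota 0 e].

Lemma disc_tour_in n i j : - n%:Z <= j < n%:Z ->
  `|i + (j %/ 2)%Z| <= (row_half n j)%:Z -> (i, j) \in disc_tour n.
Proof.
move=> /andP[j1 j2] im; set m := row_half n j in im.
pose k := absz (j + n%:Z).
have kj : k%:Z - n%:Z = j by rewrite /k; lia.
apply/flattenP; exists [seq row_stop n k l | l <- iota 0 (row_len n k).+1].
  by apply: map_f; rewrite mem_iota /k; lia.
pose i' := i + (j %/ 2)%Z.
apply/mapP; exists (if odd k then absz (m%:Z - i') else absz (i' + m%:Z)).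
  rewrite mem_iota /= add0n ltnS /row_len kj -/m.
  by case: ifP => _; rewrite /i'; move: im; rewrite ler_norml => /andP[]; lia.
rewrite /row_stop kj -/m; congr pair.
move: im; rewrite ler_norml -/i' => /andP[im1 im2].
have -> : i = i' - (j %/ 2)%Z by rewrite /i' addrK.
by congr (_ - _); case: (odd k); lia.
Qed.

Lemma disc_tourP n p : p \in disc_tour n -> exists k l,
  [/\ (k < 2 * n)%N, (l <= row_len n k)%N & p = row_stop n k l].
Proof.
move=> /flattenP[_ /mapP[k kn ->] /mapP[l ln ->]].
exists k, l; split => //; first by move: kn; rewrite mem_iota.
by move: ln; rewrite mem_iota /= add0n ltnS.
Qed.

Lemma row_stop_inj n k l l' : row_stop n k l = row_stop n k l' -> l = l'.
Proof. by rewrite /row_stop => -[/addIr]; case: ifP => _; lia. Qed.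

Lemma uniq_disc_tour n : uniq (disc_tour n).
Proof.
pose row k := [seq row_stop n k l | l <- iota 0 (row_len n k).+1].
suff H b a : uniq (flatten [seq row k | k <- iota a b]) by exact: H.
elim: b a => [//|b IH a].
rewrite -[flatten _]/(row a ++ flatten [seq row k | k <- iota a.+1 b]).
rewrite cat_uniq IH andbT; apply/andP; split.
  by rewrite map_inj_uniq ?iota_uniq// => l l'; exact: row_stop_inj.
apply/hasPn => p /flattenP[_ /mapP[k + ->] /mapP[l _ ->]].
rewrite mem_iota => /andP[ak _]; apply/negP => /mapP[l' _].
by rewrite /row_stop => -[_]; lia.
Qed.

Lemma uniq_top_row n e : uniq (top_row n e).
Proof. by rewrite map_inj_uniq ?iota_uniq// => l l' -[]; lia. Qed.

Lemma top_row_disjoint n e p : p \in top_row n e -> p \notin disc_tour n.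
Proof.
move=> /mapP[l _ ->]; apply/negP => /disc_tourP[k [l' [kn _]]].
by rewrite /row_stop => -[_]; lia.
Qed.

Lemma size_disc_tour_ge n : (2 * n <= size (disc_tour n))%N.
Proof.
pose row k := [seq row_stop n k l | l <- iota 0 (row_len n k).+1].
suff H b a : (b <= size (flatten [seq row k | k <- iota a b]))%N by exact: H.
elim: b a => [//|b IH a].
rewrite -[flatten _]/(row a ++ flatten [seq row k | k <- iota a.+1 b]).
by rewrite size_cat size_map size_iota -[b.+1]add1n leq_add.
Qed.

(** The largest radius whose disc can be served by [N] stops; the bound [N] on the
    radius is harmless since a disc of radius [n] has at least [2 n] stops. *)
Definition disc_radius (N : nat) : nat :=
  \max_(n < N.+1 | (size (disc_tour n) <= N)%N) n.

Lemma disc_radius_le N : (size (disc_tour (disc_radius N)) <= N)%N.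
Proof.
have P0 : (size (disc_tour (ord0 : 'I_N.+1)) <= N)%N by [].
by rewrite /disc_radius (bigop.bigmax_eq_arg ord0)//; case: arg_maxnP.
Qed.

Lemma disc_radius_max N n : (size (disc_tour n) <= N)%N -> (n <= disc_radius N)%N.
Proof.
move=> nN; have n1 : (n < N.+1)%N by have := size_disc_tour_ge n; lia.
exact: (@leq_bigmax_cond _ (fun n : 'I_N.+1 => (size (disc_tour n) <= N)%N)
  (fun n : 'I_N.+1 => n : nat) (Ordinal n1)).
Qed.

Lemma disc_radius_lt N : (N < size (disc_tour (disc_radius N).+1))%N.
Proof. by rewrite ltnNge; apply/negP => /disc_radius_max; rewrite ltnn. Qed.

Definition tour_list (N : nat) : seq (int * int) :=
  let n := disc_radius N in
  disc_tour n ++ top_row n (N - size (disc_tour n)).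

Lemma size_tour_list N : size (tour_list N) = N.
Proof. by rewrite size_cat size_map size_iota subnKC// disc_radius_le. Qed.

Lemma uniq_tour_list N : uniq (tour_list N).
Proof.
rewrite cat_uniq uniq_disc_tour uniq_top_row andbT /=.
by apply/hasPn => p; exact: top_row_disjoint.
Qed.

End Tour.

(** * Geometry of the tour *)
Lemma row_index_bounds (n k : nat) : (k < 2 * n)%N ->
  - n%:Z <= k%:Z - n%:Z /\ k%:Z - n%:Z < n%:Z.
Proof. by lia. Qed.

Lemma sub_doubleZ (m : nat) : m%:Z - (2 * m)%N%:Z = - m%:Z.
Proof. by lia. Qed.

Lemma double_subZ (m : nat) : (2 * m)%N%:Z - m%:Z = m%:Z.
Proof. by lia. Qed.

Section TourGeometry.
Context {R : realType}.
Variables (rho sg gm : R).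
Hypotheses (rho0 : 0 < rho) (sg0 : 0 < sg) (sg_gm : sg < gm)
  (sg2gm2 : sg ^+ 2 + gm ^+ 2 = 1).
Local Notation c := (hexc rho sg gm).
Local Notation h := (hexh rho gm).
Local Notation point := (fun p : int * int => lattice_point rho sg gm p.1 p.2).
Local Notation row_half := (row_half rho sg gm).
Local Notation row_stop := (row_stop rho sg gm).
Local Notation row_len := (row_len rho sg gm).
Local Notation disc_tour := (disc_tour rho sg gm).

Let c0 : 0 < c. Proof. exact: hexc_gt0. Qed.
Let h0 : 0 < h. Proof. exact: (hexh_gt0 _ sg). Qed.
Let gm0 : 0 < gm. Proof. exact: lt_trans sg_gm. Qed.

Lemma edist0 (p : plane R) : edist (0, 0) p = enorm p.
Proof. by case: p => x y; rewrite /Defs.edist /vec /= !subr0. Qed.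

Lemma hexcell_radius (p x : plane R) : hexcell rho sg gm p x -> edist p x <= c + rho.
Proof.
move=> [H1 H2]; apply: le_trans (enorm_le_add _ _) _; apply: lerD => //.
rewrite -(ler_pM2l gm0); apply: le_trans H2; rewrite lerDr.
by rewrite mulr_ge0 ?(ltW sg0).
Qed.

Lemma enorm_widen (x y a b : R) : 0 <= a -> 0 <= b -> `|x| <= a + b ->
  enorm (x, y) <= enorm (a, y) + b.
Proof.
move=> a0 b0 xab.
rewrite -ler_sqr ?nnegrE ?addr_ge0 ?enorm_ge0// sqrrD !enorm_sqr /=.
have [aE _] := norm_coord_le_enorm ((a, y) : plane R).
rewrite /= ger0_norm// in aE.
have H1 : x ^+ 2 <= (a + b) ^+ 2.
  by rewrite -real_normK ?num_real// ler_sqr ?nnegrE ?addr_ge0.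
have H2 := ler_wpM2r b0 aE.
by rewrite -mulr_natl; lra.
Qed.

(** The abscissa of a recentred lattice point, in units of [c]. *)
Lemma recentred_abscissa (i j : int) : exists e : R, 0 <= e <= 1 /\
  2 * (i - (j %/ 2)%Z)%:~R + j%:~R = 2 * i%:~R + e :> R.
Proof.
exists (j - 2 * (j %/ 2)%Z)%:~R; split; last by rewrite !rmorphB rmorphM /=; ring.
by rewrite -[0]/(0%:~R) -[1]/(1%:~R) !ler_int; lia.
Qed.

Definition half_chord (n : nat) (j : int) : R := Num.sqrt (n%:R ^+ 2 - j%:~R ^+ 2).

Let q0 : 0 < h / (2 * c). Proof. by rewrite divr_gt0// mulr_gt0. Qed.

Lemma row_half_itv n j :
  h / (2 * c) * half_chord n j < (row_half n j)%:R <= h / (2 * c) * half_chord n j + 1.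
Proof.
have a0 : 0 <= h / (2 * c) * half_chord n j.
  by rewrite mulr_ge0 ?sqrtr_ge0// ltW.
have /andP[H1 H2] := truncn_itv a0.
by rewrite /row_half H2 /= -natr1 lerD2r.
Qed.

Lemma sqr_half_chord n j : `|j| <= n%:Z -> half_chord n j ^+ 2 = n%:R ^+ 2 - j%:~R ^+ 2.
Proof.
move=> jn; rewrite sqr_sqrtr// subr_ge0 -[X in X <= _]real_normK ?num_real//.
by rewrite ler_sqr ?nnegrE// -intr_norm -[n%:R]/(n%:Z%:~R) ler_int.
Qed.

Lemma row_stopE n k l : (l <= row_len n k)%N -> exists i j : int,
  [/\ j = k%:Z - n%:Z, `|i| <= (row_half n j)%:Z & row_stop n k l = (i - (j %/ 2)%Z, j)].
Proof.
rewrite /row_len => lk; rewrite /row_stop; set j := k%:Z - n%:Z in lk *.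
set m := row_half n j in lk *.
exists (if odd k then m%:Z - l%:Z else l%:Z - m%:Z), j; split => //.
by case: (odd k); lia.
Qed.

Lemma disc_tour_norm n p : p \in disc_tour n -> enorm (point p) <= n%:R * h + 3 * c.
Proof.
move=> /disc_tourP[k [l [kn lk ->]]].
have [i [j [jE im ->]]] := row_stopE _ _ _ lk.
have [e [/andP[e0 e1] E]] := recentred_abscissa i j.
rewrite /lattice_point /= E.
have jn : `|j| <= n%:Z by lia.
have hc0 : 0 <= half_chord n j by exact: sqrtr_ge0.
have im' : `|i%:~R : R| <= h / (2 * c) * half_chord n j + 1.
  have /andP[_] := row_half_itv n j; apply: le_trans.
  by rewrite -intr_norm -[(row_half n j)%:R]/((row_half n j)%:Z%:~R) ler_int.
have X : `|c * (2 * i%:~R + e)| <= h * half_chord n j + 3 * c.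
  rewrite normrM (gtr0_norm c0); have -> : h * half_chord n j + 3 * c =
      c * (2 * (h / (2 * c) * half_chord n j + 1) + 1) by field; rewrite gt_eqF.
  rewrite ler_pM2l//; apply: le_trans (ler_normD _ _) _.
  rewrite normrM (ger0_norm e0) (ger0_norm (ler0n R 2)); lra.
apply: le_trans (enorm_widen _ _ _ _ _ _ X) _.
- by rewrite mulr_ge0// ltW.
- by rewrite mulr_ge0// ltW.
have nh0 : 0 <= n%:R * h := mulr_ge0 (ler0n _ _) (ltW h0).
rewrite lerD2r -ler_sqr ?nnegrE ?enorm_ge0//.
by rewrite enorm_sqr /= !exprMn (sqr_half_chord _ _ jn); lra.
Qed.

(** A point of the disc lies in a cell whose center is at distance at most [c + rho]
    from it; this center is in the disc of radius [h n], and the rounding up of the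
    rows makes up for the recentring. *)
Lemma disc_tour_covers n t : t + (c + rho) <= n%:R * h ->
  eball (0, 0) t `<=` \bigcup_(p in [set` disc_tour n]) hexcell rho sg gm (point p).
Proof.
move=> tn x xt.
have [i [j Hx]] := hexcell_cover _ _ _ rho0 sg0 sg_gm sg2gm2 x.
exists (i, j) => //=; set p := lattice_point rho sg gm i j in Hx.
have pn : enorm p < n%:R * h.
  rewrite -edist0; apply: le_lt_trans (edist_triangle _ x _) _.
  rewrite (edist_sym x); have := hexcell_radius _ _ Hx; move: xt; rewrite /eball /=.
  by move=> H1 H2; apply: lt_le_trans tn; exact: ltr_leD.
have [_] := norm_coord_le_enorm p.
rewrite /p /= normrM (gtr0_norm h0) => H.
have jn : `|j| < n%:Z.
  rewrite -(ltr_int R) intr_norm -(ltr_pM2l h0); apply: le_lt_trans H _.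
  by rewrite mulrC.
have nh0 : 0 <= n%:R * h by rewrite mulr_ge0// ltW.
have X : `|2 * i%:~R + j%:~R| <= h / c * half_chord n j.
  have hc0 : 0 <= h / c * half_chord n j.
    by apply: mulr_ge0; [apply: divr_ge0; exact: ltW|exact: sqrtr_ge0].
  rewrite -ler_sqr ?nnegrE//.
  rewrite [leRHS]exprMn (sqr_half_chord _ _ (ltW jn)).
  rewrite real_normK ?num_real// -(ler_pM2l (exprn_gt0 2 c0)).
  have -> : c ^+ 2 * ((h / c) ^+ 2 * (n%:R ^+ 2 - j%:~R ^+ 2)) =
     (n%:R * h) ^+ 2 - (h * j%:~R) ^+ 2 by field; rewrite gt_eqF.
  rewrite lerBrDr -exprMn; have := enorm_sqr p; rewrite /p /lattice_point /= => <-.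
  by rewrite ler_sqr ?nnegrE ?enorm_ge0// ltW.
apply: disc_tour_in => //.
  by move: jn; rewrite ltr_norml => /andP[/ltW -> ->].
have [e [/andP[e0 e1] E]] := recentred_abscissa (i + (j %/ 2)%Z) j.
rewrite addrK in E; rewrite E in X.
have /andP[m1 _] := row_half_itv n j.
rewrite -ltzD1 -(ltr_int R) intr_norm [X in _ < X]intrD.
have -> : (row_half n j)%:Z%:~R = (row_half n j)%:R :> R by [].
set i' := (i + _)%:~R in X *.
have : 2 * `|i'| <= `|2 * i' + e| + e.
  have := ler_normB (2 * i' + e) e; rewrite addrK normrM (ger0_norm e0).
  by rewrite (ger0_norm (ler0n R 2)).
have : h / c * half_chord n j = 2 * (h / (2 * c) * half_chord n j).
  by field; rewrite gt_eqF.
lra.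
Qed.

Lemma disc_tour_within n x :
  (\bigcup_(p in [set` disc_tour n]) hexcell rho sg gm (point p)) x ->
  eball (0, 0) (n%:R * h + (4 * c + rho + 1)) x.
Proof.
move=> [p /= /disc_tour_norm pn /hexcell_radius px]; rewrite /eball /=.
apply: le_lt_trans (edist_triangle _ (point p) _) _.
rewrite edist0; by have := lerD pn px; lra.
Qed.

Definition adjacent (p q : int * int) : bool :=
  (q.2 == p.2) && (`|q.1 - p.1| == 1).

(** A weight that vanishes on the legs between neighbours in a row and that is at
    least, on any other leg, both one and the absolute difference of the length and of [2 c]; its
    sum over a tour thus bounds at once the number of irregular legs and the
    deviation of the length from [2 c] per leg. *)
Definition leg_weight (p q : int * int) : R :=
  if adjacent p q then 0 else 1 + 2 * c + edist (point p) (point q).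

Lemma edist_ge0 (p q : plane R) : 0 <= edist p q. Proof. exact: sqrtr_ge0. Qed.

Lemma leg_weight_ge0 p q : 0 <= leg_weight p q.
Proof.
rewrite /leg_weight; case: ifP => // _.
by rewrite !addr_ge0 ?edist_ge0// mulr_ge0// ltW.
Qed.

Lemma leg_weight_ge1 p q : (~~ adjacent p q)%:R <= leg_weight p q.
Proof.
rewrite /leg_weight; case: ifP => //= _.
by rewrite -addrA lerDl addr_ge0 ?edist_ge0// mulr_ge0// ltW.
Qed.

Lemma leg_weight_length p q : `|edist (point p) (point q) - 2 * c| <= leg_weight p q.
Proof.
have dist_ge0 := edist_ge0 (point p) (point q); have cp := c0.
rewrite /leg_weight; case: ifP => [/andP[/eqP H2 /eqP H1]|_]; last first.
  by rewrite ler_norml; apply/andP; split; lra.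
suff -> : edist (point p) (point q) = 2 * c by rewrite subrr normr0.
have c2 : 0 <= 2 * c by lra.
apply/eqP; rewrite -(eqrXn2 (n := 2))//.
rewrite enorm_sqr /vec /lattice_point /= H2 subrr expr0n addr0.
have -> : c * (2 * q.1%:~R + p.2%:~R) - c * (2 * p.1%:~R + p.2%:~R) =
   2 * c * (q.1 - p.1)%:~R by rewrite rmorphB /=; ring.
rewrite exprMn -[X in _ * X]real_normK ?num_real// -intr_norm H1.
by rewrite expr1n mulr1.
Qed.

Lemma leg_weight_le p q : leg_weight p q <= 1 + 2 * c + edist (point p) (point q).
Proof.
rewrite /leg_weight; case: ifP => // _.
by rewrite !addr_ge0 ?edist_ge0// mulr_ge0// ltW.
Qed.

Lemma leg_weight_row n k l : leg_weight (row_stop n k l) (row_stop n k l.+1) = 0.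
Proof.
rewrite /leg_weight ifT// /adjacent /row_stop /= eqxx /=.
by case: (odd k); apply/eqP; lia.
Qed.

Lemma leg_weight_top n l : leg_weight (l%:Z, n%:Z) (l.+1%:Z, n%:Z) = 0.
Proof. by rewrite /leg_weight ifT// /adjacent /= eqxx /=; apply/eqP; lia. Qed.

(** Square roots of numbers of difference [d] differ by at most the square root of
    [d], and the radicands for [j] and [j + 1] differ by [2 j + 1]. *)
Lemma half_chord_step n j : - n%:Z <= j -> j < n%:Z ->
  `|half_chord n j - half_chord n (j + 1)| <= 2 * Num.sqrt n%:R.
Proof.
move=> j1 j2.
have jn : `|j| <= n%:Z by lia.
have jn1 : `|j + 1| <= n%:Z by lia.
have sqrt_sub (a b : R) : 0 <= a -> 0 <= b -> (a - b) ^+ 2 <= `|a ^+ 2 - b ^+ 2|.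
  move=> a0 b0; have -> : a ^+ 2 - b ^+ 2 = (a - b) * (a + b) by ring.
  rewrite normrM (ger0_norm (addr_ge0 a0 b0)) -real_normK ?num_real// expr2.
  apply: ler_wpM2l => //; rewrite ler_norml; apply/andP; split; lra.
rewrite -ler_sqr ?nnegrE ?normr_ge0 ?mulr_ge0 ?sqrtr_ge0//.
rewrite real_normK ?num_real// exprMn sqr_sqrtr//.
apply: le_trans (sqrt_sub _ _ (sqrtr_ge0 _) (sqrtr_ge0 _)) _.
rewrite (sqr_half_chord _ _ jn) (sqr_half_chord _ _ jn1).
have -> : n%:R ^+ 2 - j%:~R ^+ 2 - (n%:R ^+ 2 - (j + 1)%:~R ^+ 2) = (2 * j + 1)%:~R :> R.
  by rewrite !rmorphD rmorphM /=; ring.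
have -> : 2 ^+ 2 * n%:R = (4 * n%:Z)%:~R :> R by rewrite rmorphM /=; ring.
by rewrite -intr_norm ler_int; lia.
Qed.

(** A row ends on the side on which the next one begins, so that the jump is
    governed by the difference of the two half lengths. *)
Lemma leg_weight_jump n k : (k.+1 < 2 * n)%N ->
  leg_weight (row_stop n k (row_len n k)) (row_stop n k.+1 0) <=
  (1 + 5 * c + h) + 2 * h * Num.sqrt n%:R.
Proof.
move=> kn; apply: le_trans (leg_weight_le _ _) _.
set j := k%:Z - n%:Z.
have j1E : k.+1%:Z - n%:Z = j + 1 by rewrite /j; lia.
rewrite /row_len /row_stop j1E -/j.
set m := row_half n j; set m' := row_half n (j + 1).
have [e [/andP[e0 e1] E]] := recentred_abscissa
  (if odd k then m%:Z - (2 * m)%N%:Z else (2 * m)%N%:Z - m%:Z) j.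
have [e' [/andP[e'0 e'1] E']] := recentred_abscissa
  (if odd k.+1 then m'%:Z - 0%:Z else 0%:Z - m'%:Z) (j + 1).
rewrite /lattice_point /= E E'.
have mm : `|m%:R - m'%:R : R| <= h / (2 * c) * (2 * Num.sqrt n%:R) + 1.
  have /andP[] := row_half_itv n j; have /andP[] := row_half_itv n (j + 1).
  have : `|half_chord n j - half_chord n (j + 1)| <= 2 * Num.sqrt n%:R.
    have [j1 j2] := row_index_bounds _ _ (ltnW kn).
    exact: half_chord_step.
  rewrite -(ler_pM2l q0) -/m -/m' => H1 H2 H3 H4 H5.
  have H6 := ler_norm (h / (2 * c) * (half_chord n j - half_chord n (j + 1))).
  have H7 := ler_norm (- (h / (2 * c) * (half_chord n j - half_chord n (j + 1)))).
  rewrite normrN normrM (gtr0_norm q0) in H7; rewrite normrM (gtr0_norm q0) in H6.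
  by rewrite ler_norml; apply/andP; split; lra.
have X : `|c * (2 * (if odd k.+1 then m'%:Z - 0%:Z else 0%:Z - m'%:Z)%:~R + e') -
    c * (2 * (if odd k then m%:Z - (2 * m)%N%:Z else (2 * m)%N%:Z - m%:Z)%:~R + e)| <=
    2 * h * Num.sqrt n%:R + 3 * c.
  have -> : 2 * h * Num.sqrt n%:R + 3 * c =
     c * (2 * (h / (2 * c) * (2 * Num.sqrt n%:R) + 1) + 1) by field; rewrite gt_eqF.
  rewrite -mulrBr normrM (gtr0_norm c0) ler_pM2l//.
  set z := (if odd k.+1 then _ else _)%:~R; set z' := (if odd k then _ else _)%:~R.
  have zz : `|z - z'| = `|m%:R - m'%:R : R|.
    rewrite /z /z' /=; case: (odd k) => /=.
      by rewrite sub_doubleZ sub0r !rmorphN /= opprK addrC.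
    by rewrite double_subZ subr0 /= distrC.
  have -> : 2 * z + e' - (2 * z' + e) = 2 * (z - z') + (e' - e) by ring.
  apply: le_trans (ler_normD _ _) _; rewrite normrM zz (ger0_norm (ler0n R 2)).
  apply: lerD; first by rewrite ler_pM2l.
  by rewrite ler_norml; apply/andP; split; lra.
have Y : `|h * (j + 1)%:~R - h * j%:~R| = h.
  by rewrite intrD mulrDr addrAC subrr add0r mulr1 gtr0_norm.
have := enorm_le_add (c * (2 * (if odd k.+1 then m'%:Z - 0%:Z else 0%:Z - m'%:Z)%:~R + e') -
    c * (2 * (if odd k then m%:Z - (2 * m)%N%:Z else (2 * m)%N%:Z - m%:Z)%:~R + e))
   (h * (j + 1)%:~R - h * j%:~R).
rewrite Y /Defs.edist /vec /=; lra.
Qed.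

Lemma top_row_norm n e p : p \in top_row n e ->
  enorm (point p) <= c * (2 * e%:R + n%:R) + h * n%:R.
Proof.
move=> /mapP[l + ->]; rewrite mem_iota add0n => /andP[_ le].
rewrite /lattice_point /=; apply: le_trans (enorm_le_add _ _) _.
rewrite normrM (gtr0_norm c0) normrM (gtr0_norm h0).
rewrite !ger0_norm ?addr_ge0 ?mulr_ge0 ?ler0n//.
rewrite lerD2r ler_pM2l// lerD2r ler_pM2l// ler_nat; exact: ltnW.
Qed.

(** The first term counts the jumps from a row of the disc to the next one; the
    second one is for the legs that join the disc and the top row to each other and
    close the tour, which are at most [2 M] long. *)
Lemma tour_weight n e M x0 :
  (forall p, p \in disc_tour n ++ top_row n e -> enorm (point p) <= M) -> 0 <= M ->
  let t := disc_tour n ++ top_row n e in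
  path_weight leg_weight (last x0 t) t <=
    (2 * n)%:R * ((1 + 5 * c + h) + 2 * h * Num.sqrt n%:R) + 2 * (1 + 2 * c + 2 * M).
Proof.
move=> tM M0 /=; set t := disc_tour n ++ top_row n e.
have K0 : 0 <= 1 + 2 * c + 2 * M by have := c0; lra.
have wM p q : p \in t -> q \in t -> leg_weight p q <= 1 + 2 * c + 2 * M.
  move=> /tM pM /tM qM; apply: le_trans (leg_weight_le _ _) _.
  by have := edist_le_norm (point p) (point q); lra.
rewrite path_weight_cat.
have B0 : 0 <= (1 + 5 * c + h) + 2 * h * Num.sqrt n%:R.
  have := mulr_ge0 (ltW h0) (sqrtr_ge0 (n%:R : R)); have := c0; have := h0; lra.
have lastt : t <> [::] -> last x0 t \in t by case: (t) => // y t' _; exact: (mem_last y t').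
have H1 : path_weight leg_weight (last x0 t) (disc_tour n) <=
    (1 + 2 * c + 2 * M) + (2 * n)%:R * ((1 + 5 * c + h) + 2 * h * Num.sqrt n%:R).
  apply: le_trans (path_weight_rows _ _ _ _ _ _ _ (leg_weight_row n) B0 _) _.
    by move=> k _; rewrite add0n; exact: leg_weight_jump.
  rewrite lerD2r; case E : (2 * n)%N => [//|b].
  have F : row_stop n 0 0 \in t.
    rewrite mem_cat /disc_tour E; apply/orP; left; apply/flattenP.
    by eexists; [apply: mem_head|apply: mem_head].
  by apply: wM => //; apply: lastt; move: F; case: (t).
have H2 : path_weight leg_weight (last (last x0 t) (disc_tour n)) (top_row n e) <=
    1 + 2 * c + 2 * M.
  case: e @t tM wM lastt H1 => [//|e] t tM wM lastt _.
  rewrite /top_row -[iota 0 e.+1]/(0%N :: iota 1 e) map_cons.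
  rewrite -[path_weight _ _ _]/(leg_weight (last (last x0 t) (disc_tour n)) (0%:Z, n%:Z) +
    path_weight leg_weight (0%:Z, n%:Z) [seq (l%:Z, n%:Z) | l <- iota 1 e]).
  rewrite (path_weight_map0 leg_weight (fun l => (l%:Z, n%:Z)) 0)//; last exact: leg_weight_top.
  rewrite addr0; have top0 : (0%:Z, n%:Z) \in t by rewrite mem_cat mem_head orbT.
  apply: wM => //.
  have : last x0 t \in t by apply: lastt; move: top0; case: (t).
  case dE : (disc_tour n) => [//|y s] _.
  by rewrite -[last _ (y :: s)]/(last y s) mem_cat dE (mem_last y s).
by apply: le_trans (lerD H1 H2) _; lra.
Qed.

End TourGeometry.

(** * Asymptotics of the tour *)
Section TourAsymptotics.
Context {R : realType}.
Variables (rho beta : R).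
Hypotheses (rho0 : 0 < rho) (beta0 : 0 < beta) (betapi : beta < pi / 4).
Local Notation sg := (sin beta).
Local Notation gm := (cos beta).
Local Notation c := (hexc rho sg gm).
Local Notation h := (hexh rho gm).
Local Notation point := (fun p : int * int => lattice_point rho sg gm p.1 p.2).
Local Notation disc_tour := (disc_tour rho sg gm).
Local Notation disc_radius := (disc_radius rho sg gm).
Local Notation tour_list := (tour_list rho sg gm).
Local Notation leg_weight := (leg_weight rho sg gm).
Local Notation cells := (cells rho beta).
Local Notation A := (2 * c * h).
Local Notation margin := (4 * c + rho + 1).
Local Notation disc := (fun t => eball (0, 0) t : set (plane R)).
Local Notation v := (@unit_disc_area R).

Let sg0 : 0 < sg. Proof. exact: sin_beta_gt0. Qed.
Let sg_gm : sg < gm. Proof. exact: sin_lt_cos_beta. Qed.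
Let c0 : 0 < c. Proof. exact: hexc_gt0. Qed.
Let h0 : 0 < h. Proof. exact: (hexh_gt0 _ sg). Qed.
Let A0 : 0 < A. Proof. by apply: mulr_gt0 => //; apply: mulr_gt0. Qed.
Let margin0 : 0 < margin.
Proof. by have := c0; have := rho0; lra. Qed.

(** The cells visited in a disc overlap in null sets only and lie in a slightly
    larger disc. *)
Lemma disc_count_upper n :
  (size (disc_tour n))%:R * A <= v * (n%:R * h + margin) ^+ 2.
Proof.
have nh0 : 0 <= n%:R * h := mulr_ge0 (ler0n _ _) (ltW h0).
have m0 := margin0.
rewrite -lee_fin -leb2_cells//; last exact: uniq_disc_tour.
rewrite -leb2_eball; last by lra.
apply: le_measure; rewrite ?inE.
- exact: measurable_cells.
- exact: measurable_eball.
- by move=> x; exact: disc_tour_within.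
Qed.

Lemma disc_covered n (t : seq (int * int)) : {subset disc_tour n <= t} ->
  disc (n%:R * h - margin) `<=` cells t.
Proof.
move=> nt x /(disc_tour_covers rho sg gm rho0 sg0 sg_gm (sin2Dcos2 beta) n) [].
  by have := c0; lra.
by move=> p /= pn px; exists p => //=; exact: nt.
Qed.

Lemma disc_count_lower n : margin <= n%:R * h ->
  v * (n%:R * h - margin) ^+ 2 <= (size (disc_tour n))%:R * A.
Proof.
move=> nm; rewrite -lee_fin -leb2_cells//; last exact: uniq_disc_tour.
rewrite -leb2_eball; last by rewrite subr_ge0.
apply: le_measure; rewrite ?inE.
- exact: measurable_eball.
- exact: measurable_cells.
- exact: disc_covered.
Qed.

Lemma leb2_tour_cells N : leb2 (cells (tour_list N)) = (N%:R * A)%:E.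
Proof. by rewrite leb2_cells// ?uniq_tour_list// size_tour_list. Qed.

Lemma tour_area_upper N :
  N%:R * A <= v * ((disc_radius N).+1%:R * h + margin) ^+ 2.
Proof.
apply: le_trans (disc_count_upper _); rewrite ler_pM2r// ler_nat ltnW//.
exact: disc_radius_lt.
Qed.

Lemma tour_covers_disc N :
  disc ((disc_radius N)%:R * h - margin) `<=` cells (tour_list N).
Proof. by apply: disc_covered => p pn; rewrite mem_cat pn. Qed.

(** Beyond [large_radius] the discs are large compared with the margin. *)
Definition large_radius : nat := (Num.truncn (2 * margin / h)).+1.

Lemma large_radiusP n : (large_radius <= n)%N ->
  1 <= n%:R :> R /\ 2 * margin <= n%:R * h.
Proof.
move=> ln; split; first by rewrite ler1n; apply: leq_trans ln.
rewrite -ler_pdivrMr//; apply: ltW; apply: lt_le_trans (truncnS_gt _) _.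
by rewrite ler_nat.
Qed.

Definition excess_const : R := 3 * (h + 2 * margin) * h.

(** The area of the first [N] cells lies between those of two discs whose radii
    differ by a constant. *)
Lemma area_excess n : (large_radius <= n)%N ->
  (n.+1%:R * h + margin) ^+ 2 - (n%:R * h - margin) ^+ 2 <= excess_const * n%:R.
Proof.
move=> /large_radiusP[n1 nm]; rewrite -natr1.
have -> : ((n%:R + 1) * h + margin) ^+ 2 - (n%:R * h - margin) ^+ 2 =
   (h + 2 * margin) * h * (2 * n%:R + 1) by ring.
have -> : excess_const * n%:R = (h + 2 * margin) * h * (3 * n%:R).
  by rewrite /excess_const; ring.
apply: ler_wpM2l; last by lra.
by apply: mulr_ge0; [have := h0; have := margin0; lra|exact: ltW].
Qed.

Lemma disc_area_lower n : (large_radius <= n)%N ->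
  h ^+ 2 / 4 * n%:R ^+ 2 <= (n%:R * h - margin) ^+ 2.
Proof.
move=> /large_radiusP[n1 nm].
have -> : h ^+ 2 / 4 * n%:R ^+ 2 = (n%:R * h / 2) ^+ 2 by field.
have nh0 : 0 <= n%:R * h := mulr_ge0 (ler0n _ _) (ltW h0).
by rewrite ler_sqr ?nnegrE; lra.
Qed.

Lemma tour_area_lower N : (large_radius <= disc_radius N)%N ->
  v * (h ^+ 2 / 4 * (disc_radius N)%:R ^+ 2) <= N%:R * A.
Proof.
move=> ln; have [n1 nm] := large_radiusP _ ln.
apply: (@le_trans _ _ (v * ((disc_radius N)%:R * h - margin) ^+ 2)).
  by rewrite ler_pM2l ?unit_disc_area_gt0//; exact: disc_area_lower.
apply: le_trans (disc_count_lower _ _) _; first by have := margin0; lra.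
by rewrite ler_pM2r// ler_nat disc_radius_le.
Qed.

Lemma disc_radius_unbounded M : \forall N \near \oo, (M <= disc_radius N)%N.
Proof.
by exists (size (disc_tour M)) => //= N; exact: disc_radius_max.
Qed.

Lemma cvg0_inv_sqrt_radius (f : nat -> R) (K : R) :
  (forall N, (large_radius <= disc_radius N)%N ->
     0 <= f N <= K / Num.sqrt (disc_radius N)%:R) ->
  f N @[N --> \oo] --> (0 : R).
Proof.
move=> fK; apply/cvgrPdist_le => e e0.
pose M := maxn large_radius (Num.truncn ((K / e) ^+ 2)).+1.
have := disc_radius_unbounded M; apply: filterS => N MN.
have ln : (large_radius <= disc_radius N)%N by apply: leq_trans MN; exact: leq_maxl.
have /andP[f0 fN] := fK _ ln.
rewrite sub0r normrN ger0_norm//; apply: le_trans fN _.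
have [n1 _] := large_radiusP _ ln.
have s0 : 0 < Num.sqrt (disc_radius N)%:R :> R by rewrite sqrtr_gt0; lra.
rewrite ler_pdivrMr// mulrC -ler_pdivrMr//.
apply: le_trans (ler_norm _) _; rewrite -sqrtr_sqr ler_wsqrtr//.
apply: ltW; apply: lt_le_trans (truncnS_gt _) _; rewrite ler_nat.
by apply: leq_trans MN; exact: leq_maxr.
Qed.

Lemma sqrt_nat_facts (n : nat) : 1 <= n%:R :> R ->
  let s := Num.sqrt n%:R : R in [/\ 1 <= s, n%:R = s ^+ 2 & s <= s ^+ 2].
Proof.
move=> n1 s; have s2 : s ^+ 2 = n%:R by rewrite sqr_sqrtr.
have s1 : 1 <= s by rewrite -[leLHS](sqrtr1 R) ler_wsqrtr.
by split => //; rewrite expr2 ler_peMr//; lra.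
Qed.

(** The excess is of area [O(n)], against a disc of area of order [n ^ 2]. *)
Lemma tour_ratio_cvg0 :
  (fine (leb2 (cells (tour_list N) `\` disc ((disc_radius N)%:R * h - margin))) /
     fine (leb2 (cells (tour_list N)))) @[N --> \oo] --> (0 : R).
Proof.
apply: (@cvg0_inv_sqrt_radius _ (4 * excess_const / h ^+ 2)) => N ln.
have [n1 nm] := large_radiusP _ ln.
set n := disc_radius N in ln n1 nm *.
have [s1 ns ss] := sqrt_nat_facts _ n1; set s := Num.sqrt _ in s1 ns ss *.
have a0 : 0 <= n%:R * h - margin by have := margin0; lra.
have md := measurable_eball (n%:R * h - margin).
have mc := measurable_cells rho beta (tour_list N).
have -> : fine (leb2 (cells (tour_list N) `\` disc (n%:R * h - margin))) =
    N%:R * A - v * (n%:R * h - margin) ^+ 2.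
  rewrite measureD//; last by rewrite [X in (X < _)%E]leb2_tour_cells ltry.
  have -> : cells (tour_list N) `&` disc (n%:R * h - margin) = disc (n%:R * h - margin).
    by apply/setIidr; exact: tour_covers_disc.
  transitivity (fine ((N%:R * A)%:E - (v * (n%:R * h - margin) ^+ 2)%:E)); last by [].
  by congr (fine (_ - _)); [exact: leb2_tour_cells|exact: leb2_eball].
rewrite leb2_tour_cells /=.
have v0 := @unit_disc_area_gt0 R.
have L1 := tour_area_lower _ ln; rewrite -/n in L1.
have L2 : v * (n%:R * h - margin) ^+ 2 <= N%:R * A.
  apply: le_trans (disc_count_lower _ _) _; first by have := margin0; lra.
  by rewrite ler_pM2r// ler_nat disc_radius_le.
have U := tour_area_upper N; rewrite -/n in U.
have E := ler_wpM2l (ltW v0) (area_excess _ ln).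
have n2 : 0 < n%:R ^+ 2 :> R by rewrite exprn_gt0//; lra.
have h2 : 0 < h ^+ 2 by rewrite exprn_gt0.
have S0 : 0 < N%:R * A.
  by apply: lt_le_trans L1; apply: mulr_gt0 => //; apply: mulr_gt0 => //; apply: divr_gt0.
rewrite divr_ge0 ?(ltW S0) ?subr_ge0//= ler_pdivrMr//.
have s0 : 0 < s by lra.
have ex0 : 0 < excess_const.
  rewrite /excess_const; apply: mulr_gt0 => //; have := h0; have := margin0; lra.
apply: (@le_trans _ _ (v * (excess_const * n%:R))).
  by rewrite mulrBr in E; lra.
have K0 : 0 <= 4 * excess_const / h ^+ 2 / s.
  apply: divr_ge0; last exact: ltW.
  by apply: divr_ge0; [apply: mulr_ge0 => //|]; exact: ltW.
apply: le_trans (ler_wpM2l K0 L1).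
have -> : 4 * excess_const / h ^+ 2 / s * (v * (h ^+ 2 / 4 * n%:R ^+ 2)) =
   v * (excess_const * (n%:R ^+ 2 / s)) by field; rewrite !gt_eqF.
rewrite ler_pM2l// ler_pM2l// ler_pdivlMr// expr2 ler_pM2l; last by lra.
by rewrite ns.
Qed.

Definition tour_weight_total N : R :=
  path_weight leg_weight (last (0, 0) (tour_list N)) (tour_list N).

(** There are [O(n)] jumps of length [O(sqrt n)] and two legs of length [O(n)],
    against a number of stops of order [n ^ 2]. *)
Lemma tour_weight_cvg0 : (tour_weight_total N / N%:R) @[N --> \oo] --> (0 : R).
Proof.
have v0 := @unit_disc_area_gt0 R.
have ex0 : 0 < excess_const.
  rewrite /excess_const; apply: mulr_gt0 => //; have := h0; have := margin0; lra.
pose e := v * excess_const / A.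
have e0 : 0 < e by rewrite divr_gt0// mulr_gt0.
pose K := (2 * (1 + 5 * c + h) + 4 * h) + 2 * (1 + 2 * c + 2 * (2 * h + 3 * c + c * (2 * e + 1))).
have K0 : 0 <= K.
  have := mulr_gt0 c0 e0; have := c0; have := h0; rewrite /K; lra.
apply: (@cvg0_inv_sqrt_radius _ (K * (4 * A / (v * h ^+ 2)))) => N ln.
have [n1 nm] := large_radiusP _ ln.
set n := disc_radius N in ln n1 nm *.
have [s1 ns ss] := sqrt_nat_facts _ n1; set s := Num.sqrt _ in s1 ns ss *.
have s0 : 0 < s by lra.
have h2 : 0 < h ^+ 2 by rewrite exprn_gt0.
have n2 : 0 < n%:R ^+ 2 :> R by rewrite exprn_gt0//; lra.
have L1 := tour_area_lower _ ln; rewrite -/n in L1.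
have S0 : 0 < N%:R * A.
  by apply: lt_le_trans L1; apply: mulr_gt0 => //; apply: mulr_gt0 => //; apply: divr_gt0.
have N0 : 0 < N%:R :> R by move: S0; rewrite pmulr_lgt0.
(* the top row is short, since the next disc would not fit *)
pose E := (N - size (disc_tour n))%N.
have E1 : E%:R <= e * n%:R.
  rewrite -(ler_pM2r A0); have -> : e * n%:R * A = v * (excess_const * n%:R).
    by rewrite /e mulrAC divfK ?gt_eqF// mulrA.
  rewrite natrB ?disc_radius_le// mulrBl.
  have L2 : v * (n%:R * h - margin) ^+ 2 <= (size (disc_tour n))%:R * A.
    by apply: disc_count_lower; have := margin0; lra.
  have U := tour_area_upper N; rewrite -/n in U.
  have := ler_wpM2l (ltW v0) (area_excess _ ln); rewrite mulrBr; lra.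
pose M := n%:R * h + 3 * c + (c * (2 * E%:R + n%:R) + h * n%:R).
have cE : 0 <= c * (2 * E%:R + n%:R).
  by apply: mulr_ge0; [exact: ltW|have := ler0n R E; lra].
have hn : 0 <= h * n%:R by rewrite mulr_ge0// ltW.
have M0 : 0 <= M by rewrite /M; have := c0; lra.
have W : tour_weight_total N <= (2 * n)%:R * ((1 + 5 * c + h) + 2 * h * s) + 2 * (1 + 2 * c + 2 * M).
  apply: tour_weight => // p; rewrite mem_cat => /orP[pn|pn].
    have H : enorm (point p) <= n%:R * h + 3 * c by exact: disc_tour_norm.
    by rewrite /M; lra.
  have H : enorm (point p) <= c * (2 * E%:R + n%:R) + h * n%:R by exact: top_row_norm pn.
  have nh : 0 <= n%:R * h by rewrite mulrC.
  by rewrite /M; have := c0; lra.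
have M1 : M <= (2 * h + c + 2 * c * e) * n%:R + 3 * c.
  rewrite /M; have := ler_wpM2l (ltW c0) E1; lra.
have W0 : 0 <= tour_weight_total N.
  rewrite /tour_weight_total; elim: (tour_list N) (last _ _) => //= y t IH x.
  by rewrite addr_ge0 ?leg_weight_ge0.
have s3 : s ^+ 2 <= s ^+ 3.
  by rewrite [leRHS]exprS ler_peMl// ltW// exprn_gt0.
have {}W : tour_weight_total N <= K * s ^+ 3.
  apply: (le_trans W); rewrite natrM ns.
  have one : 1 <= s ^+ 3 by lra.
  have Q1 : (2 * (1 + 5 * c + h)) * s ^+ 2 <= (2 * (1 + 5 * c + h)) * s ^+ 3.
    by apply: ler_wpM2l => //; have := c0; have := h0; lra.
  have Q2 : (4 * (2 * h + c + 2 * c * e)) * s ^+ 2 <= (4 * (2 * h + c + 2 * c * e)) * s ^+ 3.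
    by apply: ler_wpM2l => //; have := c0; have := h0; have := mulr_gt0 c0 e0; lra.
  have Q3 : (2 + 16 * c) * 1 <= (2 + 16 * c) * s ^+ 3.
    by apply: ler_wpM2l => //; have := c0; lra.
  rewrite ns in M1.
  have Z : 2 * s ^+ 2 * (1 + 5 * c + h + 2 * h * s) =
    (2 * (1 + 5 * c + h)) * s ^+ 2 + 4 * h * s ^+ 3 by ring.
  rewrite Z; apply: (@le_trans _ _ ((2 * (1 + 5 * c + h)) * s ^+ 2 + 4 * h * s ^+ 3 +
     (2 + 4 * c + 4 * ((2 * h + c + 2 * c * e) * s ^+ 2 + 3 * c)))); first by lra.
  apply: (@le_trans _ _ ((2 * (1 + 5 * c + h)) * s ^+ 3 + 4 * h * s ^+ 3 +
     (4 * (2 * h + c + 2 * c * e)) * s ^+ 3 + (2 + 16 * c) * s ^+ 3)); first by lra.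
  by rewrite le_eqVlt; apply/orP; left; apply/eqP; rewrite /K; ring.
rewrite divr_ge0 ?(ltW N0)//= ler_pdivrMr//; apply: (le_trans W).
have -> : K * (4 * A / (v * h ^+ 2)) / s * N%:R = K * (4 * A / (v * h ^+ 2) * s^-1 * N%:R).
  by rewrite !mulrA.
apply: ler_wpM2l => //.
have Ns : v * h ^+ 2 * s ^+ 4 / (4 * A) <= N%:R.
  rewrite ler_pdivrMr; last exact: mulr_gt0.
  have -> : v * h ^+ 2 * s ^+ 4 = 4 * (v * (h ^+ 2 / 4 * n%:R ^+ 2)).
    by rewrite ns; field.
  by lra.
have P0 : 0 <= 4 * A / (v * h ^+ 2) * s^-1.
  have vh : 0 < v * h ^+ 2 by exact: mulr_gt0.
  have A4 : 0 < 4 * A by exact: mulr_gt0.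
  by apply: mulr_ge0; [apply: divr_ge0; exact: ltW|rewrite invr_ge0 ltW].
apply: le_trans (ler_wpM2l P0 Ns).
rewrite le_eqVlt; apply/orP; left; apply/eqP.
by field; rewrite ?gt_eqF.
Qed.

End TourAsymptotics.

(** * The optimal apex angle *)
Section OptimalAngle.
Context {R : realType}.
Implicit Types (t a b r : R).

Let pi0 : 0 < pi :> R. Proof. exact: pi_gt0. Qed.

Lemma is_derive_logtan t : - (pi / 2) < t < pi / 2 -> is_derive t (1 : R) logtan (cos t)^-1.
Proof.
move=> /andP[t0 t1]; have p0 := pi0; set u := pi / 4 + t / 2.
have su0 : 0 < sin u by apply: sin_gt0_pihalf; apply/andP; split; rewrite /u; lra.
have cu0 : 0 < cos u by apply: cos_gt0_pihalf; apply/andP; split; rewrite /u; lra.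
have tu0 : 0 < tan u by rewrite divr_gt0.
have du : is_derive t (1 : R) (fun x => pi / 4 + x / 2) 2^-1.
  apply: (is_derive_eq (is_derive_addE _ _ _ _ _ (is_derive_cst (pi / 4 : R) t 1)
    (is_derive_mulE _ _ _ _ _ (is_derive_id t (1 : R)) (is_derive_cst (2^-1 : R) t 1)))).
  by rewrite /= mulr0 addr0 add0r mul1r.
have cu : cos u != 0 by rewrite gt_eqF.
have dt := is_derive_compE (@tan R) (fun x => pi / 4 + x / 2) _ _ _ (is_derive_tan cu) du.
have := is_derive_compE (@ln R) (fun x => tan (pi / 4 + x / 2)) _ _ _ (is_derive1_ln tu0) dt.
move/is_derive_eq; apply; rewrite -/u.
have -> : cos t = 2 * (cos u * sin u).
  have tu : t + pi / 2 = u *+ 2 by rewrite /u mulr2n; field.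
  by rewrite -sinDpihalf tu sin_mulr2n -mulr_natl.
by rewrite /tan; field; rewrite !gt_eqF.
Qed.

Lemma sin_cos_gt0 t : 0 < t < pi / 2 -> 0 < sin t /\ 0 < cos t.
Proof.
have p0 := pi0; move=> /andP[t0 t1]; split.
  by apply: sin_gt0_pihalf; rewrite t0.
by apply: cos_gt0_pihalf; apply/andP; split; lra.
Qed.

Lemma logtan0 : logtan 0 = 0 :> R.
Proof.
by rewrite logtanE ?sin0 ?cos0 ?addr0 ?divr1 ?ln1//; have p0 := pi0; apply/andP; split; lra.
Qed.

Lemma continuous_at_is_derive (f : R -> R) (x d : R) :
  is_derive x (1 : R) f d -> {for x, continuous f}.
Proof.
by move=> H; apply: differentiable_continuous; apply/derivable1_diffP; exact: ex_derive.
Qed.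

Lemma is_derive_continuous_itv (f df : R -> R) a b :
  (forall x, a <= x <= b -> is_derive x (1 : R) f (df x)) ->
  {within `[a, b], continuous f}.
Proof.
move=> H; apply: continuous_in_subspaceT => x; rewrite inE /= in_itv /= => xab.
exact: continuous_at_is_derive (H x xab).
Qed.

Lemma sin_le_logtan t : 0 < t < pi / 2 -> sin t <= logtan t.
Proof.
move=> /andP[t0 t1]; have p0 := pi0.
have d x : 0 <= x <= t ->
    is_derive x (1 : R) (fun x => logtan x - sin x) ((cos x)^-1 - cos x).
  move=> /andP[x0 xt]; apply: is_deriveB.
  by apply: is_derive_logtan; apply/andP; split; lra.
have dI x : x \in `]0, t[ ->
    is_derive x (1 : R) (fun x => logtan x - sin x) ((cos x)^-1 - cos x).
  by rewrite in_itv /= => /andP[x0 xt]; apply: d; rewrite !ltW.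
have [x + ] := MVT t0 dI (is_derive_continuous_itv _ _ _ _ d).
rewrite in_itv /= => /andP[x0 xt]; rewrite logtan0 sin0 !subr0 => E.
rewrite -subr_ge0 E mulr_ge0 ?(ltW t0)// subr_ge0.
have [_ cx] : 0 < sin x /\ 0 < cos x by apply: sin_cos_gt0; apply/andP; split; lra.
by rewrite -[leRHS]div1r ler_pdivlMr//; have := cos_le1 x; nra.
Qed.

Lemma logtan_le t : 0 < t < pi / 2 -> logtan t <= 2 / cos t.
Proof.
move=> tt; have p0 := pi0; have [st ct] := sin_cos_gt0 _ tt.
have /andP[t0 t1] := tt.
rewrite logtanE; last by apply/andP; split; lra.
have q0 : 0 < (1 + sin t) / cos t by rewrite divr_gt0//; lra.
apply: le_trans (ltW (ln_sublinear q0)) _; rewrite ler_pM2r ?invr_gt0//.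
by have := sin_le1 t; lra.
Qed.

Definition chord_ratio t : R := cos t ^+ 2 * logtan t / sin t.

(** The derivative has the sign of [sin t - (1 + sin t ^ 2) logtan t], which is
    negative since [logtan t] is at least [sin t]. *)
Lemma chord_ratio_decr a b : 0 < a -> a < b -> b < pi / 2 ->
  chord_ratio b < chord_ratio a.
Proof.
move=> a0 ab b1; have p0 := pi0.
pose df x : R := cos x * (sin x - (1 + sin x ^+ 2) * logtan x) / sin x ^+ 2.
have d x : a <= x <= b -> is_derive x (1 : R) chord_ratio (df x).
  move=> /andP[ax xb].
  have [sx cx] : 0 < sin x /\ 0 < cos x by apply: sin_cos_gt0; apply/andP; split; lra.
  have sx0 : sin x != 0 by rewrite gt_eqF.
  have dl : is_derive x (1 : R) logtan (cos x)^-1.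
    by apply: is_derive_logtan; apply/andP; split; lra.
  have d1 := is_derive_mulE _ _ _ _ _ (is_derive_expE _ 2 _ _ (is_derive_cos x)) dl.
  have dV : is_derive x (1 : R) (fun y => (sin y)^-1) (- (sin x) ^- 2 * cos x).
    by apply: (is_derive_eq (is_deriveV sx0 (is_derive_sin x))).
  apply: (is_derive_eq (is_derive_mulE _ _ _ _ _ d1 dV)).
  have c2 : cos x ^+ 2 = 1 - sin x ^+ 2 by exact: cos2sin2.
  rewrite /df /=; transitivity (cos x * (sin x * (1 - 2 * sin x * logtan x) -
     cos x ^+ 2 * logtan x) / sin x ^+ 2); first by field; rewrite !gt_eqF.
  by rewrite c2; field; rewrite gt_eqF.
have dI x : x \in `]a, b[ -> is_derive x (1 : R) chord_ratio (df x).
  by rewrite in_itv /= => /andP[ax xb]; apply: d; rewrite !ltW.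
have [x + E] := MVT ab dI (is_derive_continuous_itv _ _ _ _ d).
rewrite in_itv /= => /andP[ax xb].
have [sx cx] : 0 < sin x /\ 0 < cos x by apply: sin_cos_gt0; apply/andP; split; lra.
rewrite -subr_lt0 E pmulr_llt0 ?subr_gt0// /df.
rewrite pmulr_llt0 ?invr_gt0 ?exprn_gt0// pmulr_rlt0// subr_lt0.
have L : sin x <= logtan x by apply: sin_le_logtan; apply/andP; split; lra.
have s2 : 0 < sin x ^+ 2 by rewrite exprn_gt0.
have l0 : 0 < logtan x by lra.
by have := mulr_gt0 s2 l0; lra.
Qed.

Lemma sin_pi6 : sin (pi / 6) = 2^-1 :> R.
Proof.
have p0 := pi0.
have s0 : 0 < sin (pi / 6) :> R by apply: sin_gt0_pihalf; apply/andP; split; lra.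
have E : sin (pi / 6) = 1 - 2 * sin (pi / 6) ^+ 2 :> R.
  have -> : 1 - 2 * sin (pi / 6) ^+ 2 = cos ((pi / 6) *+ 2) :> R.
    by rewrite cos_mulr2n cos2sin2 -mulr_natl; ring.
  have -> : (pi / 6) *+ 2 = - (pi / 6 - pi / 2) :> R by rewrite mulr2n; field.
  by rewrite cosN cosBpihalf.
have /eqP : (2 * sin (pi / 6) - 1) * (sin (pi / 6) + 1) = 0 :> R by move: E; lra.
rewrite mulf_eq0 => /orP[/eqP|/eqP]; lra.
Qed.

Lemma sin_ge_half t : pi / 6 <= t < pi / 2 -> 2^-1 <= sin t.
Proof.
move=> /andP[t0 t1]; have p0 := pi0; rewrite -sin_pi6.
rewrite leNgt ltr_sin -?leNgt// in_itv /=; apply/andP; split; lra.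
Qed.

(** Half the area of the hexagon of unit circumradius decreases from the regular
    hexagon on; its square is a polynomial in the sine. *)
Lemma hexagon_area_decr a b : pi / 6 <= a -> a < b -> b < pi / 2 ->
  cos b * (1 + sin b) <= cos a * (1 + sin a).
Proof.
move=> a0 ab b1; have p0 := pi0.
have sa : 2^-1 <= sin a by apply: sin_ge_half; apply/andP; split; lra.
have sb : 2^-1 <= sin b by apply: sin_ge_half; apply/andP; split; lra.
have [_ ca] : 0 < sin a /\ 0 < cos a by apply: sin_cos_gt0; apply/andP; split; lra.
have [_ cb] : 0 < sin b /\ 0 < cos b by apply: sin_cos_gt0; apply/andP; split; lra.
have sab : sin a <= sin b.
  by rewrite leNgt ltr_sin -?leNgt ?(ltW ab)// in_itv /=; apply/andP; split; lra.
have qa : 0 <= cos a * (1 + sin a) by rewrite mulr_ge0//; lra.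
have qb : 0 <= cos b * (1 + sin b) by rewrite mulr_ge0//; lra.
rewrite -ler_sqr ?nnegrE// !exprMn !cos2sin2 -subr_ge0.
set x := sin a in sa sab *; set y := sin b in sb sab *.
have -> : (1 - x ^+ 2) * (1 + x) ^+ 2 - (1 - y ^+ 2) * (1 + y) ^+ 2 =
  (y - x) * (2 * (x ^+ 2 + x * y + y ^+ 2) + (x + y) * (x ^+ 2 + y ^+ 2) - 2) by ring.
apply: mulr_ge0; first by lra.
have xx : 2^-1 * 2^-1 <= x * x by apply: ler_pM.
have yy : 2^-1 * 2^-1 <= y * y by apply: ler_pM.
have xy : 2^-1 * 2^-1 <= x * y by apply: ler_pM.
have z : 1 * (2^-1 * 2^-1 + 2^-1 * 2^-1) <= (x + y) * (x ^+ 2 + y ^+ 2).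
  by rewrite !expr2; apply: ler_pM; lra.
by rewrite !expr2 in z *; lra.
Qed.

(** The last factor is the area of the hexagon of unit circumradius. *)
Lemma Hfun6E r t : 0 < t < pi / 2 -> let b := alpha_bar 6 t in
  Hfun 6 r t = sin b * (sin t * (chord_ratio b - chord_ratio t) -
                        r * (2 * (cos t * (1 + sin t)))).
Proof.
move=> tt b; have p0 := pi0; have /andP[t0 t1] := tt.
have [st ct] := sin_cos_gt0 _ tt.
have bE : b = (pi / 2 - t) / 2 by rewrite /b /alpha_bar; field.
have [sb cb] : 0 < sin b /\ 0 < cos b.
  by apply: sin_cos_gt0; rewrite bE; apply/andP; split; lra.
have tE : t = pi / 2 - 2 * b by rewrite bE; field.
have c2 : cos t = 2 * sin b * cos b by rewrite {1}tE; exact: (cos_alpha _ _ erefl).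
have s2 : sin (2 * t) = 2 * (cos t * sin t).
  by rewrite mulr_natl sin_mulr2n mulr_natl.
rewrite /Hfun -/b s2 /chord_ratio.
have -> : r * (6 - 2) * cos b * sin b ^+ 2 = r * sin b * (2 * cos t).
  by rewrite c2; ring.
by field; rewrite !gt_eqF.
Qed.

(** When [t] increases, [alpha_bar 6 t] decreases and does not exceed [t], so that
    [sin t * (chord_ratio (alpha_bar 6 t) - chord_ratio t)] increases while the
    area does not. *)
Lemma H_root_unique r a b : 0 <= r -> a < b -> H_root 6 r a -> H_root 6 r b -> False.
Proof.
move=> r0 ab [/andP[a0 a1] Ha] [/andP[b0 b1] Hb]; have p0 := pi0.
move: Ha Hb; rewrite !Hfun6E; try by apply/andP; split; lra.
set a' := alpha_bar 6 a; set b' := alpha_bar 6 b.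
have aE : a' = (pi - 2 * a) / 4 by rewrite /a' /alpha_bar; field.
have bE : b' = (pi - 2 * b) / 4 by rewrite /b' /alpha_bar; field.
have [sa _] : 0 < sin a' /\ 0 < cos a'.
  by apply: sin_cos_gt0; rewrite aE; apply/andP; split; lra.
have [sb _] : 0 < sin b' /\ 0 < cos b'.
  by apply: sin_cos_gt0; rewrite bE; apply/andP; split; lra.
move=> /eqP; rewrite mulf_eq0 gt_eqF//= subr_eq0 => /eqP Ea.
move=> /eqP; rewrite mulf_eq0 gt_eqF//= subr_eq0 => /eqP Eb.
have s1 : 2^-1 <= sin a by apply: sin_ge_half; rewrite a0.
have s2 : sin a < sin b by rewrite ltr_sin// in_itv /=; apply/andP; split; lra.
have d1 : chord_ratio b < chord_ratio a by apply: chord_ratio_decr; lra.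
have d2 : chord_ratio a' < chord_ratio b' by apply: chord_ratio_decr; rewrite ?aE ?bE; lra.
have d3 : 0 <= chord_ratio a' - chord_ratio a.
  rewrite subr_ge0; have [->|ne] := eqVneq a' a; first by [].
  have aa : a' < a by rewrite lt_neqAle ne aE; lra.
  by apply/ltW/chord_ratio_decr => //; rewrite aE; lra.
have area := ler_wpM2l r0 (hexagon_area_decr _ _ a0 ab b1).
have m1 : sin a * (chord_ratio a' - chord_ratio a) <= sin b * (chord_ratio a' - chord_ratio a).
  by apply: ler_wpM2r => //; exact: ltW.
have m2 : sin b * (chord_ratio a' - chord_ratio a) < sin b * (chord_ratio b' - chord_ratio b).
  by rewrite ltr_pM2l; lra.
lra.
Qed.

Lemma continuous_Hfun r x : 0 < x < pi / 2 -> {for x, continuous (Hfun 6 r)}.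
Proof.
move=> xx; have p0 := pi0; have /andP[x0 x1] := xx.
set b := alpha_bar 6 x.
have bE : b = (pi - 2 * x) / 4 by rewrite /b /alpha_bar; field.
have cL : {for x, continuous (@logtan R)}.
  by apply: continuous_at_is_derive (is_derive_logtan _ _); apply/andP; split; lra.
have cB : {for x, continuous (fun y : R => alpha_bar 6 y)}.
  have -> : (fun y : R => alpha_bar 6 y) = (fun y => pi / 4 + (- 2^-1) * y).
    by apply/funext => y; rewrite /alpha_bar; field.
  exact: continuous_at_is_derive (is_derive_addE _ _ _ _ _ (is_derive_cst (pi / 4 : R) x 1)
    (is_derive_cmulE (- 2^-1) _ _ _ (is_derive_id x (1 : R)))).
have cLb : {for x, continuous (fun y => logtan (alpha_bar 6 y))}.
  apply: (continuous_comp cB); rewrite -/b.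
  by apply: continuous_at_is_derive (is_derive_logtan _ _); rewrite bE; apply/andP; split; lra.
have cs := @continuous_sin R x; have cc := @continuous_cos R x.
have csb : {for x, continuous (fun y => sin (alpha_bar 6 y))}.
  by apply: (continuous_comp cB); exact: continuous_sin.
have ccb : {for x, continuous (fun y => cos (alpha_bar 6 y))}.
  by apply: (continuous_comp cB); exact: continuous_cos.
have cs2 : {for x, continuous (fun y : R => sin (2 * y))}.
  apply: continuous_comp; last exact: continuous_sin.
  by apply: continuous_at_is_derive (is_derive_cmulE 2 _ _ _ (is_derive_id _ _)).
have K k : {for x, continuous (fun _ : R => k)} :=
  continuous_at_is_derive _ _ _ (is_derive_cst k x (1 : R)).
have sq (f : R -> R) : {for x, continuous f} -> {for x, continuous (fun y => f y ^+ 2)}.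
  by move=> cf; exact: (continuousM cf cf).
rewrite /Hfun.
apply: continuousB; last first.
  apply: continuousM; last exact: sq.
  by apply: continuousM; [exact: K|].
apply: continuousB; last first.
  by apply: continuousM => //; apply: continuousM => //; exact: K.
apply: continuousB.
  by apply: continuousM => //; apply: continuousM => //; exact: sq.
by apply: continuousM => //; apply: continuousM => //; exact: sq.
Qed.

(** For the regular hexagon both half angles are [pi / 6] and [H] is not positive;
    near a right angle the area tends to zero and [H] is positive. *)
Lemma H_root_exists r : 0 <= r -> exists t, H_root 6 r t.
Proof.
move=> r0; have p0 := pi0.
(* the cosine of an angle at which the area, at most [4 * k], satisfies [r * area <= 1 / 4] *)
pose k : R := (16 * r + 16)^-1.
have k0 : 0 < k by rewrite invr_gt0; lra.
have k1 : k <= 16^-1 by rewrite lef_pV2 ?posrE; lra.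
have rk : (16 * r + 16) * k = 1 by rewrite mulfV// gt_eqF//; lra.
have k11 : -1 <= k <= 1 by apply/andP; split; lra.
pose t := acos k.
have ct : cos t = k by rewrite acosK// in_itv.
have t0 : 0 <= t <= pi by rewrite acos_ge0// acos_lepi.
have /andP[t00 tp] := t0.
have t1 : t < pi / 2.
  have : cos (pi / 2) < cos t by rewrite cos_pihalf ct.
  by rewrite ltr_cos// in_itv /=; apply/andP; split; lra.
have t6 : pi / 6 <= t.
  rewrite leNgt; apply/negP => tlt.
  have : cos (pi / 6) < cos t.
    by rewrite ltr_cos// in_itv /=; apply/andP; split; lra.
  have [_ c6] : 0 < sin (pi / 6) :> R /\ 0 < cos (pi / 6) :> R.
    by apply: sin_cos_gt0; apply/andP; split; lra.
  have : cos (pi / 6) ^+ 2 = 3 / 4 :> R by rewrite cos2sin2 sin_pi6; field.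
  by rewrite ct; nra.
have st := sin_ge_half t; rewrite t6 t1 in st; have {}st := st isT.
have Hlow : Hfun 6 r (pi / 6) <= 0.
  rewrite Hfun6E; last by apply/andP; split; lra.
  have -> : alpha_bar 6 (pi / 6) = pi / 6 :> R by rewrite /alpha_bar; field.
  have [s6 c6] : 0 < sin (pi / 6) :> R /\ 0 < cos (pi / 6) :> R.
    by apply: sin_cos_gt0; apply/andP; split; lra.
  rewrite subrr mulr0 sub0r mulrN oppr_le0 mulr_ge0 ?(ltW s6)// mulr_ge0//.
  by rewrite mulr_ge0// mulr_ge0 ?(ltW c6)//; lra.
have Hhigh : 0 <= Hfun 6 r t.
  rewrite Hfun6E; last by apply/andP; split; lra.
  set b := alpha_bar 6 t; have bE : b = (pi - 2 * t) / 4 by rewrite /b /alpha_bar; field.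
  have bb : 0 < b < pi / 2 by rewrite bE; apply/andP; split; lra.
  have [sb cb] := sin_cos_gt0 _ bb.
  rewrite mulr_ge0 ?(ltW sb)// subr_ge0.
  have s6 : sin b <= 2^-1.
    by rewrite -sin_pi6 leNgt ltr_sin -?leNgt ?bE ?in_itv /=; try (apply/andP; split); lra.
  have ub : 3 / 4 <= chord_ratio b.
    rewrite /chord_ratio ler_pdivlMr//.
    have c2 : 3 / 4 <= cos b ^+ 2 by rewrite cos2sin2; nra.
    by apply: ler_pM => //; [rewrite ltW|exact: sin_le_logtan].
  have tt : 0 < t < pi / 2 by apply/andP; split; lra.
  have lt : chord_ratio t <= 4 * k.
    rewrite /chord_ratio ler_pdivrMr; last by lra.
    apply: (@le_trans _ _ (cos t ^+ 2 * (2 / cos t))).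
      by apply: ler_wpM2l; [exact: sqr_ge0|exact: logtan_le].
    rewrite ct; have -> : k ^+ 2 * (2 / k) = 2 * k by field; rewrite gt_eqF.
    by nra.
  have s1 := sin_le1 t.
  have m1 : r * (2 * (cos t * (1 + sin t))) <= r * (4 * k).
    by rewrite ct; apply: ler_wpM2l => //; nra.
  have m2 : 2^-1 * 2^-1 <= sin t * (chord_ratio b - chord_ratio t).
    by apply: ler_pM => //; lra.
  by apply: le_trans m2; apply: (le_trans m1); lra.
have cH : {within `[pi / 6, t], continuous (Hfun 6 r)}.
  apply: continuous_in_subspaceT => x; rewrite inE /= in_itv /= => /andP[x1 x2].
  by apply: continuous_Hfun; apply/andP; split; lra.
have [|x + Hx] := @IVT R (Hfun 6 r) (pi / 6) t 0 t6 cH.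
  by rewrite ge_min le_max Hlow Hhigh orbT.
rewrite in_itv /= => /andP[x1 x2]; exists x; split => //.
by apply/andP; split; lra.
Qed.

Lemma alpha_starP r : 0 <= r -> H_root 6 r (alpha_star 6 r).
Proof.
move=> r0; have [t Ht] := H_root_exists r r0.
have U : unique (H_root 6 r) t.
  split => // x Hx; have [tx|xt|//] := ltgtP t x.
    by exfalso; exact: (H_root_unique r t x).
  by exfalso; exact: (H_root_unique r x t).
by have [] := xgetI (0 : R) (P := [set alpha | unique (H_root 6 r) alpha]) U.
Qed.

End OptimalAngle.

(** * The honeycomb design *)
Section HexagonalDesign.
Context {R : realType}.
Variables (rho beta : R).
Hypotheses (rho0 : 0 < rho) (beta0 : 0 < beta) (betapi : beta < pi / 4).
Local Notation sg := (sin beta).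
Local Notation gm := (cos beta).
Local Notation c := (hexc rho sg gm).
Local Notation h := (hexh rho gm).
Local Notation cell := (hexcell rho sg gm).
Local Notation lattice := (lattice rho sg gm).
Local Notation point := (fun p : int * int => lattice_point rho sg gm p.1 p.2).
Local Notation disc_radius := (disc_radius rho sg gm).
Local Notation tour_list := (tour_list rho sg gm).
Local Notation leg_weight := (leg_weight rho sg gm).
Local Notation adj := adjacent.
Local Notation margin := (4 * c + rho + 1).

Let sg0 : 0 < sg. Proof. exact: sin_beta_gt0. Qed.
Let sg_gm : sg < gm. Proof. exact: sin_lt_cos_beta. Qed.
Let sc1 : sg ^+ 2 + gm ^+ 2 = 1. Proof. exact: sin2Dcos2. Qed.
Let c0 : 0 < c. Proof. exact: hexc_gt0. Qed.
Let h0 : 0 < h. Proof. exact: (hexh_gt0 _ sg). Qed.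

Definition hex_stop N (i : 'I_N) : int * int := nth (0, 0) (tour_list N) i.
Definition hex_tour N (i : 'I_N) : plane R := point (hex_stop N i).

Lemma hex_stop_inj N : injective (hex_stop N).
Proof.
move=> i j /eqP; rewrite nth_uniq ?size_tour_list// ?uniq_tour_list// => /eqP.
exact: val_inj.
Qed.

Lemma hex_tour_inj N : injective (@hex_tour N).
Proof.
move=> i j /lattice_point_inj H; apply: hex_stop_inj.
have [//|//|//|E1 E2] := H.
by move: E1 E2; case: (hex_stop N i) => ? ?; case: (hex_stop N j) => ? ? /= -> ->.
Qed.

Lemma hex_tour_region N : \bigcup_(i in [set: 'I_N]) cell (hex_tour N i) =
  cells rho beta (tour_list N).
Proof.
apply/seteqP; split => x.
  by move=> [i _ Hi]; exists (hex_stop N i) => //=; apply: mem_nth; rewrite size_tour_list.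
move=> [p /= pt px]; have pN : (index p (tour_list N) < N)%N.
  by rewrite -{2}[N](size_tour_list rho sg gm) index_mem.
by exists (Ordinal pN) => //; rewrite /hex_tour /hex_stop /= nth_index.
Qed.

Lemma disc_radius_cvgy : ((disc_radius N)%:R * h - margin) @[N --> \oo] --> +oo.
Proof.
apply/cvgryPge => M.
have := disc_radius_unbounded rho beta (Num.truncn ((M + margin) / h)).+1.
apply: filterS => N nN; rewrite lerBrDr -ler_pdivrMr//.
apply: ltW; apply: lt_le_trans (truncnS_gt _) _; by rewrite ler_nat.
Qed.

Lemma hex_tour_exhausts : exists t : nat -> R,
    let U N := \bigcup_(i in [set: 'I_N]) cell (hex_tour N i) in
    [/\ t N @[N --> \oo] --> +oo,
        \forall N \near \oo, leb2 (eball (0, 0) (t N) `\` U N) = 0%E &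
        (fine (leb2 (U N `\` eball (0, 0) (t N))) / fine (leb2 (U N)))
          @[N --> \oo] --> (0 : R)].
Proof.
exists (fun N => (disc_radius N)%:R * h - margin) => U.
have UE N : U N = cells rho beta (tour_list N) by exact: hex_tour_region.
split; first exact: disc_radius_cvgy.
  apply: nearW => N; rewrite UE (_ : _ `\` _ = set0) ?measure0//.
  by rewrite setD_eq0; exact: tour_covers_disc.
have := tour_ratio_cvg0 rho beta rho0 beta0 betapi.
by apply: cvg_trans; apply: near_eq_cvg; apply: nearW => N; rewrite UE.
Qed.

Lemma lattice_cells_cover : \bigcup_(p in lattice) cell p = setT.
Proof.
apply/seteqP; split => // x _.
have [i [j Hx]] := hexcell_cover rho sg gm rho0 sg0 sg_gm sc1 x.
by exists (lattice_point rho sg gm i j) => //; exact: lattice_point_in.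
Qed.

Lemma leb2_cell_gt0 p : (0 < leb2 (cell p))%E.
Proof.
rewrite (leb2_hexcell rho _ beta rho0 beta0 betapi erefl) lte_fin.
by apply: mulr_gt0 => //; apply: mulr_gt0.
Qed.

Definition hexagonal_design : design R.
Proof.
refine (@Design R lattice cell hex_tour _ _ _ _ _ _ _ _ _ _ _).
- exact: infinite_lattice.
- exact: lattice_locally_finite.
- by move=> p _; exact: measurable_hexcell.
- by move=> p _; exact: leb2_cell_gt0.
- by move=> p _; rewrite (leb2_hexcell rho _ beta rho0 beta0 betapi erefl) ltry.
- exact: lattice_cells_cover.
- by move=> p q lp lq pq; apply: hexcell_overlap => //; exact: measurable_hexcell.
- by move=> p q x lp lq; exact: hexcell_voronoi.
- by move=> N i; exact: lattice_point_in.
- exact: hex_tour_inj.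
- exact: hex_tour_exhausts.
Defined.

Local Notation D := hexagonal_design.
Local Notation W := (tour_weight_total rho beta).

Lemma sum_leg_weight N :
  \sum_(i < N) leg_weight (hex_stop N (ord_pred i)) (hex_stop N i) = W N.
Proof.
by apply: sum_cyclic_weight; [exact: size_tour_list|].
Qed.

Lemma sum_travel N : \sum_(i < N) travel D i =
  \sum_(i < N) edist (hex_tour N (ord_pred i)) (hex_tour N i).
Proof.
rewrite /travel -mulr_suml big_split /=.
rewrite [X in _ + X](reindex_inj (@ord_pred_inj N)) /=.
under [X in _ + X]eq_bigr do rewrite ord_predK.
by field.
Qed.

Lemma travel_deviation N : `|\sum_(i < N) travel D i - 2 * c * N%:R| <= W N.
Proof.
rewrite sum_travel -sum_leg_weight.
have -> : 2 * c * N%:R = \sum_(i < N) 2 * c.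
  by rewrite sumr_const card_ord mulr_natr.
rewrite -sumrB; apply: le_trans (ler_norm_sum _ _ _) _.
by apply: ler_sum => i _; exact: leg_weight_length.
Qed.

Lemma travel_cvg :
  ((\sum_(i < N) travel D i) / N%:R) @[N --> \oo] --> 2 * c.
Proof.
apply/cvgrPdist_le => e e0.
have /cvgrPdist_le /(_ e e0) := tour_weight_cvg0 rho beta rho0 beta0 betapi.
apply: filterS2 (nbhs_infty_ge 1) => N N1; rewrite sub0r normrN => H.
have N0 : 0 < N%:R :> R by rewrite ltr0n.
apply: le_trans (le_trans (ler_norm _) H); rewrite distrC.
have -> : (\sum_(i < N) travel D i) / N%:R - 2 * c =
   (\sum_(i < N) travel D i - 2 * c * N%:R) / N%:R by field; rewrite gt_eqF.
by rewrite normrM normfV (gtr0_norm N0) ler_pM2r ?invr_gt0// travel_deviation.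
Qed.

Lemma cost_uptoE (f kappa r : R) N :
  let A := 2 * c * h in let M := hexmoment rho (pi / 2 - 2 * beta) beta in
  cost_upto D f kappa r N =
  (f / (N%:R * A) * (N%:R * (1 + kappa * M)) +
   kappa * r * f * ((\sum_(i < N) travel D i) / N%:R))%:E.
Proof.
move=> A M; rewrite /cost_upto.
have -> : \sum_(i < N) area D (tour D i) = N%:R * A.
  rewrite (eq_bigr (fun=> A)) ?sumr_const ?card_ord ?mulr_natl// => i _.
  by rewrite /area /= (leb2_hexcell rho _ beta rho0 beta0 betapi erefl).
have -> : (\sum_(i < N) (1 + kappa%:E *
   \int[leb2]_(x in region D (tour D i)) (edist (tour D i) x)%:E) =
   (N%:R * (1 + kappa * M))%:E)%E.
  rewrite (eq_bigr (fun=> (1 + kappa * M)%:E)) => [|i _].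
    by rewrite sumEFin sumr_const card_ord mulr_natl.
  by rewrite /= (integral_edist_hexcell rho _ beta rho0 beta0 betapi erefl).
by rewrite -EFinM -EFinD; congr (_%:E); ring.
Qed.

(** All the stops have the same area and moment, and the mean length of a leg tends
    to [2 c]. *)
Lemma cost_hexagonal_design (f kappa r : R) :
  cost D f kappa r =
  (f * (1 + kappa * hexmoment rho (pi / 2 - 2 * beta) beta) / (2 * c * h) +
   kappa * r * f * (2 * c))%:E.
Proof.
set M := hexmoment _ _ _; set A := 2 * c * h.
have A0 : 0 < A by apply: mulr_gt0 => //; apply: mulr_gt0.
rewrite /cost; suff /cvg_limn_einf_sup[-> _] : cost_upto D f kappa r @ \oo -->
  (f * (1 + kappa * M) / A + kappa * r * f * (2 * c))%:E by [].
pose u N := f * (1 + kappa * M) / A + kappa * r * f * ((\sum_(i < N) travel D i) / N%:R).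
have cu : (u N)%:E @[N --> \oo] --> (f * (1 + kappa * M) / A + kappa * r * f * (2 * c))%:E.
  apply: cvg_EFin; first exact: nearW.
  by apply: cvgD; [exact: cvg_cst|apply: cvgM; [exact: cvg_cst|exact: travel_cvg]].
apply: cvg_trans cu; apply: near_eq_cvg.
apply: filterS (nbhs_infty_ge 1) => N N1.
have N0 : N%:R != 0 :> R by rewrite pnatr_eq0 -lt0n.
rewrite cost_uptoE -/M -/A; congr (_%:E); rewrite /u; congr (_ + _).
by field; rewrite N0 gt_eqF.
Qed.

Definition truck_sides : {set 'I_6} := [set @Ordinal 6 0 isT; @Ordinal 6 3 isT]%SET.

(** A leg along a row crosses the middle of the side [0] or of the opposite side
    [3]. *)
Lemma leg_right (p : int * int) :
  leg_through (point p) (point (p.1 + 1, p.2)) (hexvertices rho sg gm (point p))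
    (@Ordinal 6 0 isT).
Proof.
exists 2^-1, 2^-1; rewrite /lattice_point /hexvertices /=.
split; try (by apply/andP; split; lra).
by rewrite intrD; congr pair; field.
Qed.

Lemma leg_left (p : int * int) :
  leg_through (point p) (point (p.1 - 1, p.2)) (hexvertices rho sg gm (point p))
    (@Ordinal 6 3 isT).
Proof.
exists 2^-1, 2^-1; rewrite /lattice_point /hexvertices /=.
split; try (by apply/andP; split; lra).
by rewrite rmorphB /=; congr pair; field.
Qed.

Lemma adjacentP p q : adj p q -> q = (p.1 + 1, p.2) \/ q = (p.1 - 1, p.2).
Proof.
case: p q => a b [a' b'] /andP[/= /eqP -> /eqP H].
have [H'|H'] : a' - a = 1 \/ a' - a = -1 by lia.
  by left; congr pair; lia.
by right; congr pair; lia.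
Qed.

Lemma ord_pred_neq_ordS N (i : 'I_N) : (2 < N)%N -> ord_pred i != ordS i.
Proof.
case: i => i iN N2; apply/eqP => /(congr1 val) /=.
have [i1|i1] := ltnP i.+1 N.
  rewrite (modn_small i1); case: i iN i1 => [|i] iN i1.
    by rewrite add0n modn_small; lia.
  by rewrite addSn /= modnDr modn_small; lia.
have -> : i.+1 = N by lia.
rewrite modnn; have -> : (i + N).-1 = ((i.-1) + N)%N by lia.
by rewrite modnDr modn_small; lia.
Qed.

(** With more than two stops the previous and the next one are different, so that
    they lie on opposite sides. *)
Lemma stop_passed_through N (i : 'I_N) : (2 < N)%N ->
  adj (hex_stop N (ord_pred i)) (hex_stop N i) ->
  adj (hex_stop N i) (hex_stop N (ordS i)) ->
  forall j, j \in truck_sides ->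
    truck_through D i (hexvertices rho sg gm (tour D i)) j.
Proof.
move=> N2 a1 a2.
have {a1} : adj (hex_stop N i) (hex_stop N (ord_pred i)).
  move: a1; rewrite /adjacent => /andP[/eqP -> /eqP H]; rewrite eqxx /=.
  by apply/eqP; rewrite distrC.
have ne : hex_stop N (ord_pred i) <> hex_stop N (ordS i).
  by move=> /hex_stop_inj /eqP; apply/negP; exact: ord_pred_neq_ordS.
have R1 := leg_right (hex_stop N i); have L1 := leg_left (hex_stop N i).
move=> /adjacentP[] E1; move: a2 => /adjacentP[] E2.
- by case: ne; rewrite E1 E2.
- move=> j; rewrite !inE => /orP[/eqP ->|/eqP ->]; [left|right].
    by rewrite -E1 in R1.
  by rewrite -E2 in L1.
- move=> j; rewrite !inE => /orP[/eqP ->|/eqP ->]; [right|left].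
    by rewrite -E2 in R1.
  by rewrite -E1 in L1.
- by case: ne; rewrite E1 E2.
Qed.

(** A stop that is not passed through has an irregular leg, whose weight is at least
    one, and each leg belongs to two stops. *)
Lemma card_passed_through N (P : pred 'I_N) : (2 < N)%N ->
  (forall i, adj (hex_stop N (ord_pred i)) (hex_stop N i) ->
     adj (hex_stop N i) (hex_stop N (ordS i)) -> P i) ->
  N%:R - 2 * W N <= #|[set i | P i]%SET|%:R.
Proof.
move=> N2 HP; rewrite cardsE -sum1_card natr_sum big_mkcond /=.
have -> : N%:R = \sum_(i < N) (1 : R) by rewrite sumr_const card_ord.
have E : W N = \sum_(i < N) leg_weight (hex_stop N i) (hex_stop N (ordS i)).
  rewrite -sum_leg_weight (reindex_inj (@ordS_inj N)).
  by apply: eq_bigr => i _; rewrite ordSK.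
have -> : 2 * W N = \sum_(i < N) (leg_weight (hex_stop N (ord_pred i)) (hex_stop N i) +
     leg_weight (hex_stop N i) (hex_stop N (ordS i))).
  by rewrite big_split /= -E sum_leg_weight mulr_natl mulr2n.
rewrite -sumrB; apply: ler_sum => i _.
have := leg_weight_ge1 rho sg gm rho0 sg0 sg_gm (hex_stop N (ord_pred i)) (hex_stop N i).
have := leg_weight_ge1 rho sg gm rho0 sg0 sg_gm (hex_stop N i) (hex_stop N (ordS i)).
have := leg_weight_ge0 rho sg gm rho0 sg0 sg_gm (hex_stop N (ord_pred i)) (hex_stop N i).
have := leg_weight_ge0 rho sg gm rho0 sg0 sg_gm (hex_stop N i) (hex_stop N (ordS i)).
have [a1|a1] := boolP (adj (hex_stop N (ord_pred i)) (hex_stop N i)) => /=;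
have [a2|a2] := boolP (adj (hex_stop N i) (hex_stop N (ordS i))) => /=.
- by have -> : (i \in P) = true by [exact: HP]; lra.
- by case: (i \in P); lra.
- by case: (i \in P); lra.
- by case: (i \in P); lra.
Qed.

Lemma truck_passes_hexagonal_design :
  truck_passes_through D (hexvertices rho sg gm) (fun=> truck_sides).
Proof.
apply/cvgrPdist_le => e e0.
have e2 : 0 < e / 2 by rewrite divr_gt0.
have /cvgrPdist_le /(_ _ e2) := tour_weight_cvg0 rho beta rho0 beta0 betapi.
apply: filterS2 (nbhs_infty_ge 3) => N N3; rewrite sub0r normrN => H.
have N0 : 0 < N%:R :> R by rewrite ltr0n; apply: leq_trans N3.
set k := #|_|.
have kN : k%:R <= N%:R :> R.
  by rewrite ler_nat /k -[leqRHS]card_ord max_card.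
have kW : N%:R - 2 * W N <= k%:R.
  apply: card_passed_through => // i a1 a2; apply/asboolP.
  exact: stop_passed_through.
have {H} H := le_trans (ler_norm _) H.
rewrite ler_pdivrMr// in H.
rewrite ger0_norm; last by rewrite subr_ge0 ler_pdivrMr// mul1r.
by rewrite lerBlDr -lerBlDl ler_pdivlMr//; lra.
Qed.

Lemma hexcell_congruent p q : congruent (cell p) (cell q) p q.
Proof.
exists (fun x => (x.1 + (q.1 - p.1), x.2 + (q.2 - p.2))); split.
- by move=> x y; rewrite /Defs.edist /vec /=; congr enorm; congr pair; ring.
- by case: p => a b; case: q => a' b' /=; congr pair; ring.
- apply/seteqP; split => x.
    move=> [y Hy <-]; move: Hy; rewrite /hexcell /= /vec /=.
    by congr (hexagon _ _ _ _); congr pair; ring.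
  move=> Hx; exists (x.1 - (q.1 - p.1), x.2 - (q.2 - p.2)).
    move: Hx; rewrite /hexcell /= /vec /=.
    by congr (hexagon _ _ _ _); congr pair; ring.
  by case: x {Hx} => a b /=; congr pair; ring.
Qed.

End HexagonalDesign.

(** * The optimal scale *)
Section OptimalScale.
Context {R : realType}.
Variables (kappa r : R).
Hypotheses (kappa0 : 0 < kappa) (r0 : 0 <= r).

Local Notation alpha := (alpha_star 6 r : R).
Definition best_beta : R := (pi - 2 * alpha_star 6 r) / 4.
Local Notation beta := best_beta.
Local Notation g := (gfun 6 r : R).

Let root : H_root 6 r alpha. Proof. exact: alpha_starP. Qed.

Let alpha_bounds : pi / 6 <= alpha < pi / 2. Proof. by case: root. Qed.

Lemma best_beta_gt0 : 0 < beta.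
Proof. by have /andP[a0 a1] := alpha_bounds; rewrite /best_beta; lra. Qed.

Lemma best_beta_lt : beta < pi / 4.
Proof.
by have /andP[a0 a1] := alpha_bounds; have p0 := pi_gt0 R; rewrite /best_beta; lra.
Qed.

Lemma alpha_best_beta : alpha = pi / 2 - 2 * beta.
Proof. by rewrite /best_beta; field. Qed.

Let sa0 : 0 < sin alpha /\ 0 < cos alpha.
Proof.
have /andP[a0 a1] := alpha_bounds; have p0 := pi_gt0 R.
by apply: sin_cos_gt0; apply/andP; split; lra.
Qed.

Let sb0 : 0 < sin beta /\ 0 < cos beta.
Proof.
have b0 := best_beta_gt0; have b1 := best_beta_lt; have p0 := pi_gt0 R.
by apply: sin_cos_gt0; apply/andP; split; lra.
Qed.

(** The area and the moment of the optimal hexagon of unit circumradius. *)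
Definition unit_area : R := 2 * cos alpha * (1 + sin alpha).

Definition unit_moment : R :=
  (2 * (cos alpha * sin alpha + cos alpha ^+ 3 * logtan alpha) +
   4 * (cos beta * sin beta + cos beta ^+ 3 * logtan beta)) / 3.

Lemma unit_area_gt0 : 0 < unit_area.
Proof.
have [sa ca] := sa0; rewrite /unit_area.
by apply: mulr_gt0; [exact: mulr_gt0|lra].
Qed.

Lemma unit_areaE : unit_area = 2 * (sin alpha * cos alpha) + 4 * (sin beta * cos beta).
Proof.
have -> : 4 * (sin beta * cos beta) = 2 * (2 * sin beta * cos beta) by ring.
by rewrite -(cos_alpha _ _ alpha_best_beta) /unit_area; ring.
Qed.

Lemma gfunE : g = 3 * sin beta * Num.sqrt unit_area /
   (sin beta + cos beta ^+ 2 * logtan beta + 4 * r * sin beta * cos alpha).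
Proof.
rewrite /gfun; have -> : alpha_bar 6 alpha = beta.
  by rewrite /alpha_bar /best_beta; congr (_ / _); ring.
congr (3 * sin beta * Num.sqrt _ / _).
by rewrite unit_areaE mulr_natl sin_mulr2n -mulr_natl; ring.
Qed.

Let den0 : 0 < sin beta + cos beta ^+ 2 * logtan beta + 4 * r * sin beta * cos alpha.
Proof.
have [sb cb] := sb0; have [sa ca] := sa0.
have b0 := best_beta_gt0; have b1 := best_beta_lt; have p0 := pi_gt0 R.
have L : sin beta <= logtan beta.
  by apply: sin_le_logtan; apply/andP; split; lra.
have H1 : 0 <= cos beta ^+ 2 * logtan beta by rewrite mulr_ge0 ?sqr_ge0//; lra.
have H2 : 0 <= 4 * r * sin beta * cos alpha.
  by rewrite mulr_ge0 ?(ltW ca)// mulr_ge0 ?(ltW sb)// mulr_ge0.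
lra.
Qed.

Lemma gfun_gt0 : 0 < g.
Proof.
rewrite gfunE divr_gt0// mulr_gt0 ?sqrtr_gt0 ?unit_area_gt0//.
by have [sb _] := sb0; rewrite mulr_gt0.
Qed.

(** For the hexagon of unit circumradius, of area [A], moment [M] and half width
    [cos alpha], this is [g * (M + 2 r (cos alpha) A) = A ^ (3 / 2)]. The
    difference of the two sides, after clearing denominators, is a multiple of
    [H(6, r, alpha)]. *)
Lemma gfun_optimal :
  g * (unit_moment + 2 * r * cos alpha * unit_area) = unit_area * Num.sqrt unit_area.
Proof.
have [sb _] := sb0.
have key : 3 * sin beta * (unit_moment + 2 * r * cos alpha * unit_area) =
  unit_area * (sin beta + cos beta ^+ 2 * logtan beta + 4 * r * sin beta * cos alpha).
  have [_] := root; rewrite /Hfun.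
  have -> : alpha_bar 6 alpha = beta.
    by rewrite /alpha_bar /best_beta; congr (_ / _); ring.
  have -> : sin (2 * alpha) = 2 * (cos alpha * sin alpha).
    by rewrite mulr_natl sin_mulr2n mulr_natl.
  set H := (X in X = 0) => H0.
  apply/eqP; rewrite -subr_eq0 unit_areaE /unit_moment.
  rewrite (_ : _ - _ = - (2 * cos alpha) * H); first by rewrite H0 mulr0.
  by rewrite /H; field.
have dd := den0; rewrite gfunE; set d := (X in _ = unit_area * X) in key; rewrite -/d in dd *.
have dne : d != 0 by rewrite gt_eqF /d.
apply: (mulIf dne); transitivity (unit_area * d * Num.sqrt unit_area); last by ring.
by rewrite -key; field.
Qed.

(** The square root of the optimal area. For hexagons of area [X ^ 2] the cost is
    [f / X ^ 2 + kappa * f * X / g], which is least when [X ^ 3 = 2 g / kappa];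
    the second term is then twice the first one. *)
Definition best_side : R := (2 * g / kappa) `^ 3^-1.
Definition best_radius : R := best_side / Num.sqrt unit_area.

Let g2k : 0 < 2 * g / kappa.
Proof. by rewrite divr_gt0// mulr_gt0// gfun_gt0. Qed.

Lemma best_side_gt0 : 0 < best_side.
Proof. exact: powR_gt0. Qed.

Lemma best_side_cube : best_side ^+ 3 = 2 * g / kappa.
Proof.
rewrite -powR_mulrn ?powR_ge0// /best_side -powRrM mulVf ?pnatr_eq0//.
by rewrite powRr1// ltW.
Qed.

Lemma best_radius_gt0 : 0 < best_radius.
Proof. by rewrite divr_gt0 ?best_side_gt0// sqrtr_gt0 unit_area_gt0. Qed.

Lemma best_area :
  2 * hexc best_radius (sin beta) (cos beta) * hexh best_radius (cos beta) =
  best_side ^+ 2.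
Proof.
have sc := sin2Dcos2 beta.
rewrite (hexhE _ (sin beta) _ sc).
rewrite (hexc_cos _ _ _ alpha_best_beta) (hexs_sin _ _ _ alpha_best_beta).
transitivity (best_radius ^+ 2 * unit_area); first by rewrite /unit_area; ring.
rewrite /best_radius expr_div_n sqr_sqrtr ?(ltW unit_area_gt0)// divfK//.
by rewrite gt_eqF// unit_area_gt0.
Qed.

Lemma best_area_powR :
  best_side ^+ 2 = (kappa / 2) `^ (- (2 / 3)) * g `^ (2 / 3).
Proof.
have k2 : 0 < kappa / 2 by rewrite divr_gt0.
rewrite -powR_mulrn ?powR_ge0// /best_side -powRrM.
have -> : 3^-1 * 2 = 2 / 3 :> R by field.
have -> : 2 * g / kappa = (kappa / 2)^-1 * g.
  by field; rewrite gt_eqF.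
have k2' : 0 <= (kappa / 2)^-1 by rewrite invr_ge0 ltW.
rewrite (powRM _ k2' (ltW gfun_gt0)); congr (_ * _).
by rewrite -powR_inv1 ?(ltW k2)// -powRrM mulN1r.
Qed.

Lemma best_transport :
  kappa * (hexmoment best_radius alpha beta +
    2 * r * hexc best_radius (sin beta) (cos beta) * best_side ^+ 2) = 2.
Proof.
have a0 := unit_area_gt0; have q0 : 0 < Num.sqrt unit_area by rewrite sqrtr_gt0.
have rq : best_side = best_radius * Num.sqrt unit_area.
  by rewrite /best_radius divfK// gt_eqF.
have -> : hexmoment best_radius alpha beta +
    2 * r * hexc best_radius (sin beta) (cos beta) * best_side ^+ 2 =
    best_radius ^+ 3 * (unit_moment + 2 * r * cos alpha * unit_area).
  rewrite (hexc_cos _ _ _ alpha_best_beta) rq exprMn sqr_sqrtr ?(ltW a0)//.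
  by rewrite /hexmoment /unit_moment; field.
have g0 := gfun_gt0.
have -> : unit_moment + 2 * r * cos alpha * unit_area =
    Num.sqrt unit_area ^+ 3 / g.
  have -> : Num.sqrt unit_area ^+ 3 = unit_area * Num.sqrt unit_area.
    by rewrite exprSr sqr_sqrtr// ltW.
  by rewrite -gfun_optimal [RHS]mulrC mulKf// gt_eqF.
rewrite [_ ^+ 3 * _]mulrA -exprMn -rq best_side_cube.
by field; rewrite !gt_eqF.
Qed.

Lemma best_cost (f : R) : 0 < f ->
  f * (1 + kappa * hexmoment best_radius alpha beta) / best_side ^+ 2 +
    kappa * r * f * (2 * hexc best_radius (sin beta) (cos beta)) =
  3 * ((kappa ^+ 2 * f ^+ 3) / (4 * g ^+ 2)) `^ (1 / 3).
Proof.
move=> f0; have X0 := best_side_gt0; have g0 := gfun_gt0.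
transitivity (3 * (f / best_side ^+ 2)).
  transitivity (f / best_side ^+ 2 * (1 + kappa * (hexmoment best_radius alpha beta +
     2 * r * hexc best_radius (sin beta) (cos beta) * best_side ^+ 2))).
    by field; rewrite gt_eqF.
  by rewrite best_transport; ring.
congr (3 * _).
have -> : (kappa ^+ 2 * f ^+ 3) / (4 * g ^+ 2) = (f / best_side ^+ 2) ^+ 3.
  have X6 : (best_side ^+ 2) ^+ 3 = (2 * g / kappa) ^+ 2.
    by rewrite -best_side_cube -!exprM.
  rewrite (expr_div_n f) X6.
  by field; rewrite !gt_eqF.
have Y0 : 0 <= f / best_side ^+ 2 by rewrite divr_ge0 ?(ltW f0)// sqr_ge0.
set y := f / _ in Y0 *.
rewrite -(powR_mulrn 3 Y0) -powRrM -[LHS]powRr1//; congr (_ `^ _).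
by field.
Qed.

End OptimalScale.

(** * The upper bound *)

Theorem mainTheorem3 (R : realType) (f kappa r : R)
    (f_gt0 : 0 < f) (kappa_gt0 : 0 < kappa) (r_ge0 : 0 <= r) :
  let bound := 3 * ((kappa ^+ 2 * f ^+ 3) / (4 * gfun 6 r ^+ 2)) `^ (1 / 3) in
  let alpha := alpha_star 6 r in
  (optimal_value f kappa r <= bound%:E)%E /\
  exists (D : design R) (w : plane R -> 'I_6 -> plane R)
         (T : plane R -> {set 'I_6}),
    [/\ cost D f kappa r = bound%:E,
        forall p q, facilities D p -> facilities D q ->
          congruent (region D p) (region D q) p q,
        forall p, facilities D p ->
          [/\ cyclic_hexagon p (w p) (region D p),
              region D p = \bigcup_(j in [set: 'I_6]) basic_triangle p (w p) j,
              forall j, isosceles p (w p) j,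
              #|T p| = 2%N &
              forall j, apex_angle p (w p) j =
                if j \in T p then 2 * alpha else 2 * ((pi - 2 * alpha) / 4)],
        truck_passes_through D w T &
        forall p, facilities D p ->
          leb2 (region D p) = ((kappa / 2) `^ (- (2 / 3)) * gfun 6 r `^ (2 / 3))%:E].
Proof.
move=> bound alpha.
pose beta := best_beta r; pose rho := best_radius kappa r.
have b0 : 0 < beta := best_beta_gt0 r r_ge0.
have b1 : beta < pi / 4 := best_beta_lt r r_ge0.
have aE : alpha = pi / 2 - 2 * beta := alpha_best_beta r.
have rho0 : 0 < rho := best_radius_gt0 kappa r kappa_gt0 r_ge0.
have sb0 : 0 < sin beta by exact: sin_beta_gt0.
have sbc : sin beta < cos beta by exact: sin_lt_cos_beta.
have sc : sin beta ^+ 2 + cos beta ^+ 2 = 1 by exact: sin2Dcos2.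
pose D := hexagonal_design rho beta rho0 b0 b1.
have costD : cost D f kappa r = bound%:E.
  rewrite cost_hexagonal_design -aE; congr (_%:E).
  by rewrite best_area// best_cost.
split; first by apply: ereal_inf_lbound; exists D.
exists D, (hexvertices rho (sin beta) (cos beta)), (fun=> truck_sides); split => //.
- by move=> p q _ _; exact: hexcell_congruent.
- move=> p _; split.
  + exact: hexcell_cyclic.
  + exact: hexcell_triangles.
  + by move=> j; rewrite /isosceles !edist_hexvertices.
  + by rewrite /truck_sides cards2.
  + by move=> j; rewrite (hexcell_apex_angle _ _ _ rho0 b0 b1 aE).
- exact: truck_passes_hexagonal_design.
- move=> p _; rewrite /= (leb2_hexcell rho _ beta rho0 b0 b1 erefl).
  by rewrite best_area// best_area_powR.
Qed.
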